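(* Let $\mathcal C$ be a strict BTC over $\mathbb F$, let $\mathcal S\subset\mathcal C$ be a full tensor subcategory which is a finite admissible STC, and let $G=\mathrm{Aut}(\Gamma,m,\eta)$ be the associated finite group, so that $\mathcal S\simeq\mathrm{Rep}\,G$. Then the Galois extension $\mathcal C\rtimes\mathcal S$, with its full subcategory $(\mathcal C\rtimes\mathcal S)_G$ of homogeneous objects, the grading $\partial$ and the $G$-action $\gamma$, is a braided crossed $G$-category.
   Context: **Categories.** $\mathbb F$ is an algebraically closed field of characteristic zero. A BTC is a semisimple $\mathbb F$-linear rigid braided ribbon category with finite dimensional $\mathrm{Hom}$-spaces and $\mathrm{End}\,\mathbf 1=\mathbb F\,\mathrm{id}_{\mathbf 1}$; it carries a canonical spherical structure with dimension function $d$. For each object $X$ with dual $\overline X$ let $\varepsilon_X:\mathbf 1\to X\otimes\overline X$ and $\overline\varepsilon_X:X\otimes\overline X\to\mathbf 1$ be the duality morphisms of the spherical structure, so that $\overline\varepsilon_X\circ(s\otimes\mathrm{id}_{\overline X})\circ\varepsilon_X=\mathrm{Tr}_X(s)$ and $\overline\varepsilon_X\circ\varepsilon_X=d(X)$. An STC is a symmetric BTC; it is finite if it has finitely many isomorphism classes of simple objects. An STC is admissible if either (i) $\mathbb F=\mathbb C$, the category is a $*$-category (it has a positive involutive antilinear contravariant monoidal endofunctor $*$ acting trivially on objects) and all objects have trivial twist, or (ii) $d(X)\in\mathbb Z_+$ for all $X$, the dimension being that of the symmetric category for which the twist is trivial; in both cases twists are trivial and dimensions are positive integers for nonzero objects.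 **The Frobenius algebra.** $\mathcal C$ is a strict BTC with braiding $c$, not necessarily finite; $\mathcal S\subset\mathcal C$ is a full tensor subcategory (closed under duals, finite direct sums and subobjects) which is a finite admissible STC. By Doplicher–Roberts and Deligne there is a finite group $G$, unique up to isomorphism, with $\mathcal S\simeq\mathrm{Rep}_{\mathbb F}G$ as symmetric tensor categories. Let $(\Gamma,m,\eta,\Delta,\varepsilon)$ be the Frobenius algebra in $\mathcal S$ corresponding to the left regular representation on functions $G\to\mathbb F$, with pointwise multiplication $m$, unit $\eta$ the constant function $1$, $\Delta(\delta_g)=|G|\,\delta_g\otimes\delta_g$, $\varepsilon(\delta_g)=|G|^{-1}$. Thus $m\circ\Delta=|G|\,\mathrm{id}_\Gamma$, $\varepsilon\circ\eta=\mathrm{id}_{\mathbf 1}$, $m\circ c_{\Gamma,\Gamma}=m$, $c_{\Gamma,\Gamma}\circ\Delta=\Delta$. The group $G$ is identified with $\mathrm{Aut}(\Gamma,m,\eta)=\{g\in\mathrm{End}\,\Gamma\mid g\circ m=m\circ(g\otimes g),\ g\circ\eta=\eta\}$ under composition. **The Galois extension.** $\mathcal C\rtimes_0\mathcal S$ is the strict tensor category with the same objects, and the same tensor product of objects, as $\mathcal C$; $\mathrm{Hom}_{\mathcal C\rtimes_0\mathcal S}(X,Y)=\mathrm{Hom}_{\mathcal C}(\Gamma\otimes X,Y)$; composition $t\,\hat\circ\, s=t\circ(\mathrm{id}_\Gamma\otimes s)\circ(\Delta\otimes\mathrm{id}_X)$ for $s\in\mathrm{Hom}_{\mathcal C}(\Gamma\otimes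 X,Y)$, $t\in\mathrm{Hom}_{\mathcal C}(\Gamma\otimes Y,Z)$; and $s\,\hat\otimes\, t=(s\otimes t)\circ(\mathrm{id}_\Gamma\otimes c_{\Gamma,X}\otimes\mathrm{id}_Z)\circ(\Delta\otimes\mathrm{id}_X\otimes\mathrm{id}_Z)$ for $s\in\mathrm{Hom}_{\mathcal C}(\Gamma\otimes X,Y)$, $t\in\mathrm{Hom}_{\mathcal C}(\Gamma\otimes Z,T)$. The identity of $X$ is $\varepsilon\otimes\mathrm{id}_X$. $\mathcal C\rtimes\mathcal S$ is its idempotent completion: objects are pairs $(X,p)$ with $p=p\,\hat\circ\,p\in\mathrm{End}_{\mathcal C\rtimes_0\mathcal S}(X)$, and $(X,p)\otimes(Y,q)=(X\otimes Y,p\,\hat\otimes\,q)$. It is a semisimple strict spherical tensor category. $G$ acts by strict tensor automorphisms: $\gamma_g(s)=s\circ(g^{-1}\otimes\mathrm{id}_X)$ for $s\in\mathrm{Hom}_{\mathcal C}(\Gamma\otimes X,Y)$, and $\gamma_g((X,p))=(X,\gamma_g(p))$. **Grading.** For a simple object $X_1=(X,p)$ of $\mathcal C\rtimes\mathcal S$ put $d(X_1)=\overline\varepsilon_X\circ(p\otimes\mathrm{id}_{\overline X})\circ(\eta\otimes\varepsilon_X)$ and $$\partial X_1=d(X_1)^{-1}\,(\mathrm{id}_\Gamma\otimes\overline\varepsilon_X)\circ\big((c_{\Gamma,X}^{-1}\circ c_{X,\Gamma}^{-1})\otimes\mathrm{id}_{\overline X}\big)\circ(\mathrm{id}_\Gamma\otimes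 p\otimes\mathrm{id}_{\overline X})\circ(\Delta\otimes\varepsilon_X)\in\mathrm{End}_{\mathcal C}(\Gamma).$$ This is an element of $G$ depending only on the isomorphism class of $X_1$. A nonzero object of $\mathcal C\rtimes\mathcal S$ is homogeneous of grade $g\in G$ if it is isomorphic to a finite direct sum of simple objects $X_i$ with $\partial X_i=g$ for all $i$; then $\partial$ of it is $g$. $(\mathcal C\rtimes\mathcal S)_G$ is the full subcategory of homogeneous objects. **Braided crossed $G$-categories.** A (strict) crossed $G$-category is a strict tensor category $\mathcal D$ with a full tensor subcategory $\mathcal D_G\subset\mathcal D$ of homogeneous objects, a map $\partial:\mathrm{Obj}\,\mathcal D_G\to G$ constant on isomorphism classes, and a homomorphism $\gamma$ from $G$ to the group of invertible strict tensor functors $\mathcal D\to\mathcal D$, such that $\partial(X\otimes Y)=\partial X\,\partial Y$ for $X,Y\in\mathcal D_G$, and $\gamma_g(\mathcal D_h)\subset\mathcal D_{ghg^{-1}}$, where $\mathcal D_g=\partial^{-1}(g)$ as a full subcategory of $\mathcal D_G$; if $\mathcal D$ is additive, every object must be a direct sum of objects of $\mathcal D_G$. Write ${}^X\!(\cdot)=\gamma_{\partial X}(\cdot)$ for $X\in\mathcal D_G$. A braiding on $\mathcal D$ is a family of isomorphisms $c_{X,Y}:X\otimes Y\to{}^X\!Y\otimes X$ for all $X\in\mathcal D_G$, $Y\in\mathcal D$ such that $c_{X',Y'}\circ(s\otimes t)=({}^X\!t\otimes s)\circ c_{X,Y}$ for all $X,X'\in\mathcal D_G$ with $\partial X=\partial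 X'$ and all $s:X\to X'$, $t:Y\to Y'$; $c_{X,Z\otimes T}=(\mathrm{id}_{{}^X\!Z}\otimes c_{X,T})\circ(c_{X,Z}\otimes\mathrm{id}_T)$; and $c_{X\otimes Y,Z}=(c_{X,{}^Y\!Z}\otimes\mathrm{id}_Y)\circ(\mathrm{id}_X\otimes c_{Y,Z})$ for all $X,Y\in\mathcal D_G$, $Z,T\in\mathcal D$. (There are no nonzero morphisms between homogeneous objects of $\mathcal C\rtimes\mathcal S$ of different grades.) The $\gamma_g$ are required to respect the braiding: $\gamma_g(c_{X,Y})=c_{\gamma_g(X),\gamma_g(Y)}$. A braided crossed $G$-category is a crossed $G$-category admitting such a braiding. *)

(* Defs.v *)
From HB Require Import structures.
From mathcomp Require Import all_boot all_order all_algebra all_fingroup.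
From mathcomp Require Import boolp reals.
From mathcomp Require Import complex.

Set Implicit Arguments.
Unset Strict Implicit.
Unset Printing Implicit Defensive.

Import GRing.Theory.
Local Open Scope ring_scope.

Declare Scope tcat_scope.
Delimit Scope tcat_scope with T.
Local Open Scope tcat_scope.

Reserved Notation "X ⊗ Y" (at level 40, left associativity).
Reserved Notation "f ⊗ₘ g" (at level 40, left associativity).
Reserved Notation "g ∘ f" (at level 45, right associativity).
Reserved Notation "g ∘[ e ] f"
  (at level 45, right associativity, format "g  ∘[ e ]  f").
Reserved Notation "f ≈ g" (at level 70, no associativity).

(* The Hom-spaces are finite dimensional by virtue of being [vectType]s. *)
Record tcData (F : fieldType) := TcData {
  obj : Type;
  mor : obj -> obj -> vectType F;
  ident : forall X, mor X X;
  cmp : forall X Y Z, mor Y Z -> mor X Y -> mor X Z;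
  tone : obj;
  ten : obj -> obj -> obj;
  tem : forall X Y X' Y', mor X Y -> mor X' Y' -> mor (ten X X') (ten Y Y')
}.

Arguments mor {F t} X Y.
Arguments ident {F t} X.
Arguments tone {F t}.
Arguments ten {F t} X Y.

Notation "X ⊗ Y" := (ten X Y) : tcat_scope.
Notation "f ⊗ₘ g" := (tem f g) : tcat_scope.
Notation "g ∘ f" := (cmp g f) : tcat_scope.

(* In a strict tensor category the associativity and unit constraints are
   identities between objects that are equal but not convertible:
   [eqh e] is the identity of X seen as a morphism X -> Y, [g ∘[e] f] composes
   across such an identity, and [f ≈ g] says that f and g are the same morphism,
   i.e. have equal sources, equal targets, and are equal. *)
Definition eqh F (T : tcData F) (X Y : obj T) (e : X = Y) : mor X Y :=
  match e with erefl => ident X end.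

Notation "g ∘[ e ] f" := (cmp g (cmp (eqh e) f)) : tcat_scope.

Record arrow F (T : tcData F) :=
  Arr { asrc : obj T; atgt : obj T; amor : mor asrc atgt }.

Notation "f ≈ g" := (Arr f = Arr g) : tcat_scope.

Record isStrictTensor F (T : tcData F) : Prop := IsStrictTensor {
  cmpA : forall (X Y Z W : obj T) (h : mor Z W) (g : mor Y Z) (f : mor X Y),
    h ∘ (g ∘ f) = (h ∘ g) ∘ f;
  cmp1f : forall (X Y : obj T) (f : mor X Y), ident Y ∘ f = f;
  cmpf1 : forall (X Y : obj T) (f : mor X Y), f ∘ ident X = f;
  cmpPl : forall (X Y Z : obj T) a (g g' : mor Y Z) (f : mor X Y),
    (a *: g + g') ∘ f = a *: (g ∘ f) + (g' ∘ f);
  cmpPr : forall (X Y Z : obj T) a (g : mor Y Z) (f f' : mor X Y),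
    g ∘ (a *: f + f') = a *: (g ∘ f) + (g ∘ f');
  temPl : forall (X Y X' Y' : obj T) a (f f' : mor X Y) (g : mor X' Y'),
    (a *: f + f') ⊗ₘ g = a *: (f ⊗ₘ g) + (f' ⊗ₘ g);
  temPr : forall (X Y X' Y' : obj T) a (f : mor X Y) (g g' : mor X' Y'),
    f ⊗ₘ (a *: g + g') = a *: (f ⊗ₘ g) + (f ⊗ₘ g');
  tem_id : forall X Y : obj T, ident X ⊗ₘ ident Y = ident (X ⊗ Y);
  tem_cmp : forall (X Y Z X' Y' Z' : obj T) (g : mor Y Z) (f : mor X Y)
      (g' : mor Y' Z') (f' : mor X' Y'),
    (g ∘ f) ⊗ₘ (g' ∘ f') = (g ⊗ₘ g') ∘ (f ⊗ₘ f');
  tenA : forall X Y Z : obj T, (X ⊗ Y) ⊗ Z = X ⊗ (Y ⊗ Z);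
  ten1X : forall X : obj T, tone ⊗ X = X;
  tenX1 : forall X : obj T, X ⊗ tone = X;
  temA : forall (X Y X' Y' X'' Y'' : obj T)
      (f : mor X Y) (g : mor X' Y') (h : mor X'' Y''),
    (f ⊗ₘ g) ⊗ₘ h ≈ f ⊗ₘ (g ⊗ₘ h);
  tem1f : forall (X Y : obj T) (f : mor X Y), ident tone ⊗ₘ f ≈ f;
  temf1 : forall (X Y : obj T) (f : mor X Y), f ⊗ₘ ident tone ≈ f
}.

Record stc (F : fieldType) := Stc {
  stc_data :> tcData F;
  stcP : isStrictTensor stc_data
}.

Section Linear.
Variables (F : fieldType) (T : tcData F).
Implicit Types X Y Z : obj T.

Definition isIso X Y (f : mor X Y) : Prop :=
  exists g : mor Y X, g ∘ f = ident X /\ f ∘ g = ident Y.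

Definition isomorphic X Y : Prop := exists f : mor X Y, isIso f.

(* Z is a direct sum of the finite family Y; the empty direct sum is zero. *)
Definition isDsum n (Y : 'I_n -> obj T) Z : Prop :=
  exists (i : forall k, mor (Y k) Z) (p : forall k, mor Z (Y k)),
  [/\ forall k, p k ∘ i k = ident (Y k),
      forall k l, k != l -> p k ∘ i l = 0
    & \sum_k (i k ∘ p k) = ident Z].

Definition nonzero X : Prop := ident X != 0.

(* Since F is algebraically closed, simple means End X = F id. *)
Definition simple X : Prop :=
  nonzero X /\ forall f : mor X X, exists a : F, f = a *: ident X.

Definition isAdditive : Prop :=
  forall n (Y : 'I_n -> obj T), exists Z, isDsum Y Z.

Definition isSemisimple : Prop :=
  [/\ isAdditive,
      forall X, exists n, exists Y : 'I_n -> obj T,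
        (forall k, simple (Y k)) /\ isDsum Y X
    & forall X Y, simple X -> simple Y -> ~ isomorphic X Y ->
        forall f : mor X Y, f = 0].

End Linear.

Record btc (F : fieldType) := Btc {
  btc_stc :> stc F;
  btc_semisimple : isSemisimple btc_stc;
  btc_one : simple (tone : obj btc_stc);
  br : forall X Y : obj btc_stc, mor (X ⊗ Y) (Y ⊗ X);
  brI : forall X Y : obj btc_stc, mor (Y ⊗ X) (X ⊗ Y);
  brK : forall X Y : obj btc_stc, brI X Y ∘ br X Y = ident (X ⊗ Y);
  brIK : forall X Y : obj btc_stc, br X Y ∘ brI X Y = ident (Y ⊗ X);
  br_nat : forall (X Y X' Y' : obj btc_stc) (s : mor X Y) (t : mor X' Y'),
    br Y Y' ∘ (s ⊗ₘ t) = (t ⊗ₘ s) ∘ br X X';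
  br_tenr : forall X Z W : obj btc_stc,
    br X (Z ⊗ W)
    ≈ (ident Z ⊗ₘ br X W) ∘[tenA (stcP btc_stc) Z X W] (br X Z ⊗ₘ ident W);
  br_tenl : forall X Y Z : obj btc_stc,
    br (X ⊗ Y) Z
    ≈ (br X Z ⊗ₘ ident Y) ∘[esym (tenA (stcP btc_stc) X Z Y)] (ident X ⊗ₘ br Y Z);
  du : obj btc_stc -> obj btc_stc;
  coev : forall X : obj btc_stc, mor tone (X ⊗ du X);
  ev : forall X : obj btc_stc, mor (du X ⊗ X) tone;
  zigzag : forall X : obj btc_stc,
    (ident X ⊗ₘ ev X) ∘[tenA (stcP btc_stc) X (du X) X] (coev X ⊗ₘ ident X)
    ≈ ident X;
  zigzag_du : forall X : obj btc_stc,
    (ev X ⊗ₘ ident (du X)) ∘[esym (tenA (stcP btc_stc) (du X) X (du X))]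
      (ident (du X) ⊗ₘ coev X)
    ≈ ident (du X);
  tw : forall X : obj btc_stc, mor X X;
  tw_iso : forall X : obj btc_stc, isIso (tw X);
  tw_nat : forall (X Y : obj btc_stc) (f : mor X Y), tw Y ∘ f = f ∘ tw X;
  tw_ten : forall X Y : obj btc_stc,
    tw (X ⊗ Y) = br Y X ∘ br X Y ∘ (tw X ⊗ₘ tw Y);
  tw_du : forall X : obj btc_stc,
    (tw X ⊗ₘ ident (du X)) ∘ coev X = (ident X ⊗ₘ tw (du X)) ∘ coev X
}.

Arguments br {F b} X Y.
Arguments brI {F b} X Y.
Arguments du {F b} X.
Arguments coev {F b} X.
Arguments ev {F b} X.
Arguments tw {F b} X.

(* Right duality X ⊗ du X -> 1 of the canonical spherical structure of a ribbon category. *)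
Definition evb F (C : btc F) (X : obj C) : mor (X ⊗ du X) tone :=
  ev X ∘ br X (du X) ∘ (tw X ⊗ₘ ident (du X)).

Definition sdim F (C : btc F) (X : obj C) : mor (tone : obj C) tone :=
  evb X ∘ coev X.

(* The scalar a such that s = a id, which exists since 1 is simple. *)
Definition scal F (C : btc F) (s : mor (tone : obj C) tone) : F :=
  coord [tuple ident (tone : obj C)] ord0 s.

Section Sub.
Variables (F : closedFieldType) (C : btc F) (S : obj C -> Prop).
Implicit Types X Y Z : obj C.

(* S is the class of objects of a full subcategory. *)
Record isTensorSub : Prop := IsTensorSub {
  sub_one : S tone;
  sub_ten : forall X Y, S X -> S Y -> S (X ⊗ Y);
  sub_du : forall X, S X -> S (du X);
  sub_dsum : forall n (Y : 'I_n -> obj C) Z,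
    (forall k, S (Y k)) -> isDsum Y Z -> S Z;
  sub_retract : forall X Y (i : mor Y X) (p : mor X Y),
    S X -> p ∘ i = ident Y -> S Y
}.

Definition isSymmetric : Prop :=
  forall X Y, S X -> S Y -> br Y X ∘ br X Y = ident (X ⊗ Y).

Definition isFinite : Prop :=
  exists n, exists Y : 'I_n -> obj C,
    forall X, S X -> simple X -> exists k, isomorphic X (Y k).

(* A positive *-operation, with conjugation on F transported from the complex
   numbers along the identification phi. *)
Record isStar (R : realType) (phi : F -> R[i])
    (st : forall X Y, mor X Y -> mor Y X) : Prop := IsStar {
  st_antilin : forall X Y, S X -> S Y -> forall (a b : F) (f g : mor X Y),
    phi b = conjc (phi a) -> st _ _ (a *: f + g) = b *: st _ _ f + st _ _ g;
  st_inv : forall X Y, S X -> S Y -> forall f : mor X Y, st _ _ (st _ _ f) = f;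
  st_ident : forall X, S X -> st _ _ (ident X) = ident X;
  st_cmp : forall X Y Z, S X -> S Y -> S Z ->
    forall (g : mor Y Z) (f : mor X Y), st _ _ (g ∘ f) = st _ _ f ∘ st _ _ g;
  st_tem : forall X Y X' Y', S X -> S Y -> S X' -> S Y' ->
    forall (f : mor X Y) (g : mor X' Y'), st _ _ (f ⊗ₘ g) = st _ _ f ⊗ₘ st _ _ g;
  st_pos : forall X Y, S X -> S Y ->
    forall f : mor X Y, st _ _ f ∘ f = 0 -> f = 0
}.

Definition isAdmissible : Prop :=
  (forall X, S X -> tw X = ident X) /\
  ((exists R : realType, exists phi : {rmorphism F -> R[i]},
      bijective phi /\ exists st, isStar phi st)
   \/ (forall X, S X -> exists n : nat, sdim X = n%:R *: ident tone)).

Definition isFiniteAdmissible : Prop :=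
  [/\ isSymmetric, isFinite & isAdmissible].

(* An equivalence of symmetric tensor categories from S to the category of
   finite dimensional representations of G over F: X is sent to the space
   [fE X] with the action [fR X], f to [fM f], and the tensor structure is the
   bilinear map [fT X Y], which identifies [fE (X ⊗ Y)] with the tensor product
   of [fE X] and [fE Y] through the universal property. Only the values on S
   are constrained. *)
Record repEquiv (G : finGroupType) := RepEquiv {
  fE : obj C -> vectType F;
  fM : forall X Y, mor X Y -> 'Hom(fE X, fE Y);
  fR : forall X, G -> 'End(fE X);
  fT : forall X Y, fE X -> fE Y -> fE (X ⊗ Y);
  f1 : fE tone;

  fR1 : forall X, S X -> fR X 1%g = \1%VF;
  fRM : forall X, S X -> forall g h, fR X (g * h)%g = (fR X g \o fR X h)%VF;

  fM_lin : forall X Y, S X -> S Y -> forall a (f g : mor X Y),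
    fM (a *: f + g) = a *: fM f + fM g;
  fM_ident : forall X, S X -> fM (ident X) = \1%VF;
  fM_cmp : forall X Y Z, S X -> S Y -> S Z ->
    forall (g : mor Y Z) (f : mor X Y), fM (g ∘ f) = (fM g \o fM f)%VF;
  fM_equiv : forall X Y, S X -> S Y -> forall (f : mor X Y) g,
    (fM f \o fR X g)%VF = (fR Y g \o fM f)%VF;

  fM_faithful : forall X Y, S X -> S Y -> injective (@fM X Y);
  fM_full : forall X Y, S X -> S Y -> forall l : 'Hom(fE X, fE Y),
    (forall g, (l \o fR X g)%VF = (fR Y g \o l)%VF) ->
    exists f : mor X Y, fM f = l;
  f_esurj : forall (V : vectType F) (r : G -> 'End(V)),
    r 1%g = \1%VF -> (forall g h, r (g * h)%g = (r g \o r h)%VF) ->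
    exists X, S X /\ exists l : 'Hom(fE X, V),
      bijective l /\ forall g, (l \o fR X g)%VF = (r g \o l)%VF;

  fT_linl : forall X Y, S X -> S Y -> forall a (x x' : fE X) (y : fE Y),
    fT (a *: x + x') y = a *: fT x y + fT x' y;
  fT_linr : forall X Y, S X -> S Y -> forall a (x : fE X) (y y' : fE Y),
    fT x (a *: y + y') = a *: fT x y + fT x y';
  fT_univ : forall X Y, S X -> S Y ->
    forall (V : vectType F) (b : fE X -> fE Y -> V),
    (forall a x x' y, b (a *: x + x') y = a *: b x y + b x' y) ->
    (forall a x y y', b x (a *: y + y') = a *: b x y + b x y') ->
    exists! l : 'Hom(fE (X ⊗ Y), V), forall x y, l (fT x y) = b x y;
  fT_rep : forall X Y, S X -> S Y -> forall g (x : fE X) (y : fE Y),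
    fR (X ⊗ Y) g (fT x y) = fT (fR X g x) (fR Y g y);
  fT_nat : forall X Y X' Y', S X -> S Y -> S X' -> S Y' ->
    forall (f : mor X Y) (f' : mor X' Y') x x',
    fM (f ⊗ₘ f') (fT x x') = fT (fM f x) (fM f' x');
  fT_assoc : forall X Y Z, S X -> S Y -> S Z -> forall x y z,
    fM (eqh (tenA (stcP C) X Y Z)) (fT (fT x y) z) = fT x (fT y z);
  f1_basis : basis_of fullv [:: f1];
  f1_rep : forall g, fR tone g f1 = f1;
  fT_1l : forall X, S X -> forall x : fE X,
    fM (eqh (ten1X (stcP C) X)) (fT f1 x) = x;
  fT_1r : forall X, S X -> forall x : fE X,
    fM (eqh (tenX1 (stcP C) X)) (fT x f1) = x;
  fT_sym : forall X Y, S X -> S Y -> forall (x : fE X) (y : fE Y),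
    fM (br X Y) (fT x y) = fT y x
}.

End Sub.

Arguments fE {F C S G} _ X.
Arguments fM {F C S G} _ {X Y}.
Arguments fR {F C S G} _ X.
Arguments fT {F C S G} _ {X Y}.
Arguments f1 {F C S G} _.

(* The Frobenius algebra that the equivalence E and the isomorphism [ru]
   identify with the functions on G, with the left regular representation. *)
Record regAlg (F : closedFieldType) (C : btc F) (S : obj C -> Prop)
    (G : finGroupType) (E : repEquiv S G) := RegAlg {
  Gam : obj C;
  Gmul : mor (Gam ⊗ Gam) Gam;
  Gunt : mor tone Gam;
  Gdel : mor Gam (Gam ⊗ Gam);
  Geps : mor Gam tone;
  Gam_sub : S Gam;
  ru : 'Hom(fE E Gam, {ffun G -> F^o});
  ru_bij : bijective ru;
  ru_rep : forall g a, ru (fR E Gam g a) = [ffun x => ru a (g^-1 * x)%g];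
  ru_mul : forall a b,
    ru (fM E Gmul (fT E a b)) = [ffun x => (ru a x : F) * ru b x];
  ru_unt : ru (fM E Gunt (f1 E)) = [ffun=> 1];
  ru_Del : forall g a, ru a = [ffun x => (x == g)%:R] ->
    fM E Gdel a = #|G|%:R *: fT E a a;
  ru_eps : forall g a, ru a = [ffun x => (x == g)%:R] ->
    fM E Geps a = #|G|%:R^-1 *: f1 E
}.

Section StrictCalculus.
Variables (F : fieldType) (C : stc F).
Implicit Types X Y Z W : obj C.

Lemma sameE X Y (f g : mor X Y) : f ≈ g -> f = g.
Proof.
move=> e; have [ex ey] : X = X /\ Y = Y by [].
suff H : forall a b : arrow C, a = b -> forall (e1 : asrc a = asrc b)
  (e2 : atgt a = atgt b), eqh e2 ∘ amor a = amor b ∘ eqh e1.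
  have := H _ _ e erefl erefl.
  by rewrite /= (cmp1f (stcP C)) (cmpf1 (stcP C)).
move=> a b <- e1 e2.
by rewrite (Prop_irrelevance e1 erefl) (Prop_irrelevance e2 erefl) /=
  (cmp1f (stcP C)) (cmpf1 (stcP C)).
Qed.

Lemma same_eqhl X Y Z (e : Y = Z) (f : mor X Y) : eqh e ∘ f ≈ f.
Proof. by case: _ / e; rewrite /= (cmp1f (stcP C)). Qed.

Lemma same_eqhr X Y Z (e : X = Y) (f : mor Y Z) : f ∘ eqh e ≈ f.
Proof. by case: _ / e f => f; rewrite /= (cmpf1 (stcP C)). Qed.

Lemma same_cmp X Y Z X' Y' Z' (g : mor Y Z) (f : mor X Y)
    (g' : mor Y' Z') (f' : mor X' Y') :
  g ≈ g' -> f ≈ f' -> g ∘ f ≈ g' ∘ f'.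
Proof.
move=> eg ef.
have [ey ez ex] : [/\ Y = Y', Z = Z' & X = X'].
  by split; [exact: (congr1 (@asrc F C) eg) | exact: (congr1 (@atgt F C) eg)
            | exact: (congr1 (@asrc F C) ef)].
by subst; rewrite (sameE eg) (sameE ef).
Qed.

Lemma same_cmpe X Y W Z X' Y' W' Z' (e : Y = W) (e' : Y' = W')
    (g : mor W Z) (f : mor X Y) (g' : mor W' Z') (f' : mor X' Y') :
  g ≈ g' -> f ≈ f' -> g ∘[e] f ≈ g' ∘[e'] f'.
Proof. by move=> eg ef; apply: same_cmp => //; rewrite !same_eqhl. Qed.

Lemma same_tem X Y Z W X' Y' Z' W' (f : mor X Y) (g : mor Z W)
    (f' : mor X' Y') (g' : mor Z' W') :
  f ≈ f' -> g ≈ g' -> f ⊗ₘ g ≈ f' ⊗ₘ g'.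
Proof.
move=> ef eg.
have [ex ey] : X = X' /\ Y = Y'.
  by split; [exact: (congr1 (@asrc F C) ef) | exact: (congr1 (@atgt F C) ef)].
have [ez ew] : Z = Z' /\ W = W'.
  by split; [exact: (congr1 (@asrc F C) eg) | exact: (congr1 (@atgt F C) eg)].
by subst; rewrite (sameE eg) (sameE ef).
Qed.

End StrictCalculus.

Section RegularAlgebra.
Variables (F : closedFieldType) (C : btc F) (S : obj C -> Prop).
Hypothesis HS : isTensorSub S.
Variables (G0 : finGroupType) (E : repEquiv S G0) (A : regAlg E).
Local Notation Γ := (Gam A).
Local Notation CP := (stcP C).

Let SG : S Γ := Gam_sub A.
Let SGG : S (Γ ⊗ Γ) := sub_ten HS SG SG.

Let fM_ext X Y (f g : mor X Y) : S X -> S Y -> fM E f =1 fM E g -> f = g.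
Proof. by move=> SX SY fg; apply: (@fM_faithful _ _ _ _ E _ _ SX SY); apply/lfunP. Qed.

Let fM_comp X Y Z (g : mor Y Z) (f : mor X Y) a : S X -> S Y -> S Z ->
  fM E (g ∘ f) a = fM E g (fM E f a).
Proof. by move=> SX SY SZ; rewrite fM_cmp // comp_lfunE. Qed.

Lemma regAlg_basis (g : G0) : exists a, ru A a = [ffun x => (x == g)%:R].
Proof. by case: (ru_bij A) => r' _ rK; exists (r' [ffun x => (x == g)%:R]). Qed.

Definition dlt g : fE E Γ := sval (cid (regAlg_basis g)).

Lemma dltE g : ru A (dlt g) = [ffun x => (x == g)%:R].
Proof. exact: svalP (cid (regAlg_basis g)). Qed.

Lemma dlt_sum a : a = \sum_g (ru A a g : F) *: dlt g.
Proof.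
apply: (bij_inj (ru_bij A)); rewrite linear_sum /=.
apply/ffunP => x; rewrite sum_ffunE (bigD1 x) //= big1 => [|g nx].
  by rewrite linearZ /= dltE !ffunE eqxx addr0 /GRing.scale /= mulr1.
by rewrite linearZ /= dltE !ffunE eq_sym (negbTE nx) /GRing.scale /= mulr0.
Qed.

Let dlt_ext Y (f g : mor Γ Y) : S Y ->
  (forall x, fM E f (dlt x) = fM E g (dlt x)) -> f = g.
Proof.
move=> SY fg; apply: fM_ext => // a; rewrite (dlt_sum a) !linear_sum /=.
by apply: eq_bigr => x _; rewrite !linearZ /= fg.
Qed.

Let DelE g : fM E (Gdel A) (dlt g) = #|G0|%:R *: fT E (dlt g) (dlt g).
Proof. exact: ru_Del (dltE g). Qed.

Let epsE g : fM E (Geps A) (dlt g) = #|G0|%:R^-1 *: f1 E.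
Proof. exact: ru_eps (dltE g). Qed.

Let fT_Zl X Y a (x : fE E X) (y : fE E Y) : S X -> S Y ->
  fT E (a *: x) y = a *: fT E x y.
Proof.
move=> SX SY; have := @fT_linl _ _ _ _ E _ _ SX SY (-1) x x y.
rewrite !scaleN1r !addNr => T0.
by have := @fT_linl _ _ _ _ E _ _ SX SY a x 0 y; rewrite T0 !addr0.
Qed.

Let fT_Zr X Y a (x : fE E X) (y : fE E Y) : S X -> S Y ->
  fT E x (a *: y) = a *: fT E x y.
Proof.
move=> SX SY; have := @fT_linr _ _ _ _ E _ _ SX SY (-1) x y y.
rewrite !scaleN1r !addNr => T0.
by have := @fT_linr _ _ _ _ E _ _ SX SY a x y 0; rewrite T0 !addr0.
Qed.

Let fM1 X (x : fE E X) : S X -> fM E (ident X) x = x.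
Proof. by move=> SX; rewrite fM_ident // id_lfunE. Qed.

Lemma Del_cocomm : br Γ Γ ∘ Gdel A = Gdel A.
Proof.
apply: dlt_ext => // x; rewrite fM_comp // DelE linearZ /=.
by rewrite fT_sym.
Qed.

Lemma Del_coassoc :
  (ident Γ ⊗ₘ Gdel A) ∘ Gdel A
  = eqh (tenA CP Γ Γ Γ) ∘ (Gdel A ⊗ₘ ident Γ) ∘ Gdel A.
Proof.
have SR := sub_ten HS SG SGG; have SL := sub_ten HS SGG SG.
apply: dlt_ext => // x; rewrite !fM_comp // !DelE !linearZ /=; congr (_ *: _).
by rewrite !fT_nat // !DelE !fM1 // fT_Zr // fT_Zl // linearZ /= fT_assoc.
Qed.

Hypothesis char0 : [pchar F] =i pred0.

Lemma order_neq0 : (#|G0|%:R : F) != 0.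
Proof. by rewrite ((pcharf0P F).1 char0) -lt0n; apply/card_gt0P; exists 1%g. Qed.

Lemma eps_counitl : eqh (ten1X CP Γ) ∘ (Geps A ⊗ₘ ident Γ) ∘ Gdel A = ident Γ.
Proof.
have S1 := sub_one HS; have S1G := sub_ten HS S1 SG.
apply: dlt_ext => // x; rewrite !fM_comp // DelE linearZ /= fT_nat // epsE.
rewrite fM1 // fT_Zl // !linearZ /= fT_1l // scalerA divff ?order_neq0 //.
by rewrite scale1r.
Qed.

(* Automorphisms of the algebra permute the minimal idempotents, hence respect
   the comultiplication. *)
Lemma Del_aut (g h : mor Γ Γ) :
    g ∘ Gmul A = Gmul A ∘ (g ⊗ₘ g) -> h ∘ Gmul A = Gmul A ∘ (h ⊗ₘ h) ->
    g ∘ h = ident Γ -> h ∘ g = ident Γ ->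
  Gdel A ∘ g = (g ⊗ₘ g) ∘ Gdel A.
Proof.
move=> gM hM gh hg.
have multE (k : mor Γ Γ) a b : k ∘ Gmul A = Gmul A ∘ (k ⊗ₘ k) ->
    fM E k (fM E (Gmul A) (fT E a b))
    = fM E (Gmul A) (fT E (fM E k a) (fM E k b)).
  by move=> kM; rewrite -fM_comp // kM fM_comp // fT_nat.
have ghK a : fM E g (fM E h a) = a by rewrite -fM_comp // gh fM1.
have hgK a : fM E h (fM E g a) = a by rewrite -fM_comp // hg fM1.
have mulE a b y : ru A (fM E (Gmul A) (fT E a b)) y = (ru A a y : F) * ru A b y.
  by rewrite ru_mul ffunE.
have dd x a : fM E (Gmul A) (fT E a (dlt x)) = (ru A a x : F) *: dlt x.
  apply: (bij_inj (ru_bij A)); apply/ffunP => y.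
  rewrite mulE linearZ /= dltE !ffunE /GRing.scale /=.
  by case: eqP => [->//|_]; rewrite !mulr0.
have gdlt x : exists y, fM E g (dlt x) = dlt y.
  have [y yP] : exists y, ru A (fM E g (dlt x)) y != 0.
    apply: contrapT => /forallNP z.
    have : fM E g (dlt x) = 0.
      apply: (bij_inj (ru_bij A)); apply/ffunP => y; rewrite linear0 ffunE.
      by have /negP := z y; rewrite negbK => /eqP.
    move/(congr1 (fM E h)); rewrite hgK linear0 => /(congr1 (ru A)).
    rewrite dltE linear0 => /ffunP/(_ x); rewrite !ffunE eqxx /=.
    by move/eqP; rewrite oner_eq0.
  exists y.
  set c := ru A (fM E g (dlt x)) y in yP.
  have e1 : fM E (Gmul A) (fT E (fM E g (dlt x)) (dlt y)) = (c : F) *: dlt y.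
    by rewrite dd.
  have symm a b : fM E (Gmul A) (fT E a b) = fM E (Gmul A) (fT E b a).
    apply: (bij_inj (ru_bij A)); apply/ffunP => z.
    by rewrite !mulE mulrC.
  have := congr1 (fM E h) e1; rewrite multE // hgK linearZ /= symm dd => e2.
  set k : F := ru A (fM E h (dlt y)) x in e2.
  have e3 : k *: fM E g (dlt x) = (c : F) *: dlt y.
    by rewrite -linearZ /= e2 linearZ /= ghK.
  have := congr1 (fun a => ru A a y) e3.
  rewrite !linearZ /= dltE !ffunE eqxx -/c /GRing.scale /= mulr1.
  rewrite -[RHS]mul1r => /(mulIf yP) k1.
  move: e3; rewrite k1 scale1r => e3.
  have ii : fM E (Gmul A) (fT E (dlt x) (dlt x)) = dlt x.
    by rewrite dd dltE ffunE eqxx scale1r.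
  have := congr1 (fM E g) ii; rewrite multE // => /(congr1 (fun a => ru A a y)).
  rewrite mulE -/c -[RHS]mul1r => /(mulIf yP) c1.
  by rewrite e3 c1 scale1r.
apply: dlt_ext => // x; rewrite !fM_comp // DelE linearZ /= fT_nat //.
by have [y ->] := gdlt x; rewrite DelE.
Qed.

End RegularAlgebra.

Section StrictWords.
Variables (F : fieldType) (C : stc F).
Local Notation CP := (stcP C).
Implicit Types X Y Z W : obj C.

(* Partial composition and total tensor product of morphisms with variable
   source and target; [None] is the value of an undefined composition. *)
Definition oc (a b : option (arrow C)) : option (arrow C) :=
  match a, b with
  | Some x, Some y =>
    match pselect (atgt y = asrc x) with
    | left e => Some (Arr (amor x ∘[e] amor y))
    | right _ => None
    end
  | _, _ => None
  end.

Definition ot (a b : option (arrow C)) : option (arrow C) :=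
  match a, b with
  | Some x, Some y => Some (Arr (amor x ⊗ₘ amor y))
  | _, _ => None
  end.

Definition J X Y (f : mor X Y) : option (arrow C) := Some (Arr f).

Local Notation ι X := (J (ident X)).
Local Infix "⋆" := ot (at level 40, left associativity).
Local Infix "•" := oc (at level 45, right associativity).

Lemma J_inj X Y (f g : mor X Y) : J f = J g -> f = g.
Proof. by move/(congr1 (odflt (Arr f))) => e; apply: sameE. Qed.

Lemma J_same X Y X' Y' (f : mor X Y) (g : mor X' Y') : f ≈ g -> J f = J g.
Proof. by rewrite /J => ->. Qed.

Lemma Jce X Y Y' Z (e : Y = Y') (g : mor Y' Z) (f : mor X Y) :
  J (g ∘[e] f) = J g • J f.
Proof.
rewrite /oc /=; case: pselect => // e'.
by rewrite (Prop_irrelevance e e').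
Qed.

Lemma Jc X Y Z (g : mor Y Z) (f : mor X Y) : J (g ∘ f) = J g • J f.
Proof. by rewrite -(Jce (erefl Y)) /= (cmp1f CP). Qed.

Lemma Jt X Y X' Y' (f : mor X Y) (g : mor X' Y') : J (f ⊗ₘ g) = J f ⋆ J g.
Proof. by []. Qed.

Lemma Jeqh X Y (e : X = Y) : J (eqh e) = ι X.
Proof. by case: _ / e. Qed.

Lemma Jid X Y : ι (X ⊗ Y) = ι X ⋆ ι Y.
Proof. by rewrite -Jt (tem_id CP). Qed.

Lemma oc_none X Y Y' Z (g : mor Y' Z) (f : mor X Y) : Y <> Y' ->
  J g • J f = None.
Proof. by move=> ne; rewrite /oc /=; case: pselect. Qed.

Lemma ocA a b c : a • (b • c) = (a • b) • c.
Proof.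
have aN (d : option (arrow C)) : d • None = None by case: d.
case: a b c => [[Z W a]|] [[Y Z' b]|] [[X Y' c]|] //; rewrite ?aN //.
rewrite -!/(J _); have [e|ne] := pselect (Y' = Y); last first.
  rewrite (oc_none b c) // aN; have [e'|ne'] := pselect (Z' = Z).
    by subst; rewrite -(Jc a b) oc_none.
  by rewrite (oc_none a b).
have [e'|ne'] := pselect (Z' = Z); last first.
  by subst; rewrite -(Jc b c) (oc_none a b) // (oc_none a).
by subst; rewrite -(Jc b c) -(Jc a b) -(Jc a) -(Jc _ c) (cmpA CP).
Qed.

Lemma otA a b c : (a ⋆ b) ⋆ c = a ⋆ (b ⋆ c).
Proof.
case: a b c => [a|] [b|] [c|] //=; congr Some.
exact: (temA CP (amor a) (amor b) (amor c)).
Qed.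

Lemma otJ X Y Y1 Z X' Y' Y1' Z' (f : mor X Y) (g : mor Y1 Z)
    (f' : mor X' Y') (g' : mor Y1' Z') : Y = Y1 -> Y' = Y1' ->
  (J g • J f) ⋆ (J g' • J f') = (J g ⋆ J g') • (J f ⋆ J f').
Proof.
move=> e e'; subst; rewrite -(Jc g f) -(Jc g' f') -!Jt.
by rewrite -(Jc (g ⊗ₘ g') (f ⊗ₘ f')) (tem_cmp CP).
Qed.

Lemma Jid1 X Y (f : mor X Y) : J f • ι X = J f.
Proof. by rewrite -Jc (cmpf1 CP). Qed.

Lemma J1id X Y (f : mor X Y) : ι Y • J f = J f.
Proof. by rewrite -Jc (cmp1f CP). Qed.

Lemma Jwl W X Y Y1 Z (f : mor X Y) (g : mor Y1 Z) : Y = Y1 ->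
  ι W ⋆ (J g • J f) = (ι W ⋆ J g) • (ι W ⋆ J f).
Proof. by move=> e; rewrite -otJ // Jid1. Qed.

Lemma Jwr W X Y Y1 Z (f : mor X Y) (g : mor Y1 Z) : Y = Y1 ->
  (J g • J f) ⋆ ι W = (J g ⋆ ι W) • (J f ⋆ ι W).
Proof. by move=> e; rewrite -otJ // Jid1. Qed.

Lemma Jxl X Y X' Y' (f : mor X Y) (g : mor X' Y') :
  J f ⋆ J g = (J f ⋆ ι Y') • (ι X ⋆ J g).
Proof. by rewrite -otJ // Jid1 J1id. Qed.

Lemma Jxr X Y X' Y' (f : mor X Y) (g : mor X' Y') :
  J f ⋆ J g = (ι Y ⋆ J g) • (J f ⋆ ι X').
Proof. by rewrite -otJ // Jid1 J1id. Qed.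

Lemma Jxch X X' Y Y' V W (f : mor X X') (g : mor Y Y') : W = Y' -> V = X ->
  (J f ⋆ ι W) • (ι V ⋆ J g) = (ι X' ⋆ J g) • (J f ⋆ ι Y).
Proof. by move=> -> ->; rewrite -Jxl -Jxr. Qed.

Lemma Jone X Y (f : mor X Y) : ι tone ⋆ J f = J f.
Proof. by apply: J_same; exact: (tem1f CP). Qed.

End StrictWords.

Section Kleisli.
Variables (F : closedFieldType) (C : btc F) (S : obj C -> Prop).
Variables (G0 : finGroupType) (E : repEquiv S G0) (A : regAlg E).
Local Notation Γ := (Gam A).
Local Notation Δ := (Gdel A).
Local Notation CP := (stcP C).
Implicit Types X Y Z W : obj C.

Definition kcmp X Y Z (t : mor (Γ ⊗ Y) Z) (s : mor (Γ ⊗ X) Y) : mor (Γ ⊗ X) Z :=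
  t ∘ (ident Γ ⊗ₘ s) ∘[tenA CP Γ Γ X] (Δ ⊗ₘ ident X).

Definition kid X : mor (Γ ⊗ X) X :=
  eqh (ten1X CP X) ∘ (Geps A ⊗ₘ ident X).

Lemma kswap_src X Z : (Γ ⊗ Γ) ⊗ (X ⊗ Z) = Γ ⊗ ((Γ ⊗ X) ⊗ Z).
Proof. by rewrite !(tenA CP). Qed.

Lemma kswap_tgt X Z : Γ ⊗ ((X ⊗ Γ) ⊗ Z) = (Γ ⊗ X) ⊗ (Γ ⊗ Z).
Proof. by rewrite !(tenA CP). Qed.

Definition ktem X Y Z W (s : mor (Γ ⊗ X) Y) (t : mor (Γ ⊗ Z) W) :
    mor (Γ ⊗ (X ⊗ Z)) (Y ⊗ W) :=
  (s ⊗ₘ t)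
  ∘[kswap_tgt X Z] (ident Γ ⊗ₘ (br Γ X ⊗ₘ ident Z))
  ∘[kswap_src X Z] (Δ ⊗ₘ ident (X ⊗ Z)).

Definition kact X Y (g : mor Γ Γ) (s : mor (Γ ⊗ X) Y) : mor (Γ ⊗ X) Y :=
  s ∘ (g ⊗ₘ ident X).

Local Notation ι X := (J (ident X)).
Local Infix "⋆" := (@ot F C) (at level 40, left associativity).
Local Infix "•" := (@oc F C) (at level 45, right associativity).

Hypothesis HS : isTensorSub S.
Hypothesis char0 : [pchar F] =i pred0.

Let i := ι Γ.
Let D := J Δ.
Let c X Y := J (br X Y : mor (X ⊗ Y) (Y ⊗ X)).

Let coassoc : (i ⋆ D) • D = (D ⋆ i) • D.
Proof.
rewrite -!Jt -!Jc (Del_coassoc HS A) (cmpA CP).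
by apply: J_same; apply: same_cmp => //; rewrite same_eqhl.
Qed.

Let cocomm : c Γ Γ • D = D.
Proof. by rewrite -Jc (Del_cocomm HS A). Qed.

Lemma J_kcmp X Y Z (t : mor (Γ ⊗ Y) Z) (s : mor (Γ ⊗ X) Y) :
  J (kcmp t s) = J t • (i ⋆ J s) • (D ⋆ ι X).
Proof. by rewrite Jc Jce. Qed.

Lemma J_ktem X Y Z W (s : mor (Γ ⊗ X) Y) (t : mor (Γ ⊗ Z) W) :
  J (ktem s t) = (J s ⋆ J t) • (i ⋆ (c Γ X ⋆ ι Z)) • (D ⋆ (ι X ⋆ ι Z)).
Proof. by rewrite !Jce -Jid. Qed.

Lemma J_kid X : J (kid X) = J (Geps A) ⋆ ι X.
Proof. by apply: J_same; rewrite same_eqhl. Qed.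

Lemma kcmpA X Y Z W (t : mor (Γ ⊗ Z) W) (s : mor (Γ ⊗ Y) Z)
    (r : mor (Γ ⊗ X) Y) :
  kcmp t (kcmp s r) = kcmp (kcmp t s) r.
Proof.
apply: J_inj; rewrite !J_kcmp -!ocA; congr (_ • _).
have -> : (i ⋆ J r) • (D ⋆ ι X)
    = J ((ident Γ ⊗ₘ r) ∘[tenA CP Γ Γ X] (Δ ⊗ₘ ident X)) by rewrite Jce.
rewrite Jwl // Jce Jwl ?(tenA CP) // !Jt -!ocA; congr (_ • _).
rewrite [RHS]ocA.
have -> : (D ⋆ ι Y) • (i ⋆ J r) = ((i ⋆ i) ⋆ J r) • (D ⋆ (i ⋆ ι X)).
  by rewrite -Jid -Jxl -Jid -Jxr.
rewrite -!ocA otA; congr (_ • _).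
have e : (i ⋆ (D ⋆ ι X)) • (D ⋆ ι X) = ((i ⋆ D) • D) ⋆ ι X.
  by rewrite -otA -!Jt Jwr.
by rewrite e coassoc -!Jt Jwr // Jt otA.
Qed.

Lemma J_kact X Y g (s : mor (Γ ⊗ X) Y) : J (kact g s) = J s • (J g ⋆ ι X).
Proof. by rewrite /kact Jc. Qed.

Lemma kcmp1f X Y (s : mor (Γ ⊗ X) Y) : kcmp (kid Y) s = s.
Proof.
apply: J_inj; rewrite J_kcmp J_kid.
rewrite ocA -Jxl Jxr -ocA Jone.
have -> : (J (Geps A) ⋆ ι (Γ ⊗ X)) • (D ⋆ ι X)
    = ((J (Geps A) ⋆ i) • D) ⋆ ι X.
  by rewrite Jid -otA -!Jt Jwr.
have -> : (J (Geps A) ⋆ i) • D = i.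
  rewrite -Jt -Jc -[X in _ = J X](eps_counitl HS A char0).
  by apply: J_same; rewrite same_eqhl.
by rewrite -Jid Jid1.
Qed.

Let sg X1 X2 := (i ⋆ (c Γ X1 ⋆ ι X2)) • (D ⋆ (ι X1 ⋆ ι X2)).

Let sg_nat X1 X2 Y1 Y2 (s1 : mor X1 Y1) (s2 : mor X2 Y2) :
  sg Y1 Y2 • (i ⋆ (J s1 ⋆ J s2)) = ((i ⋆ J s1) ⋆ (i ⋆ J s2)) • sg X1 X2.
Proof.
rewrite /sg -ocA.
have -> : (D ⋆ (ι Y1 ⋆ ι Y2)) • (i ⋆ (J s1 ⋆ J s2))
    = (i ⋆ (i ⋆ (J s1 ⋆ J s2))) • (D ⋆ (ι X1 ⋆ ι X2)).
  by rewrite -!Jid -Jt -Jxl Jxr Jid otA.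
rewrite !ocA; congr (_ • _).
have cn : c Γ Y1 • (i ⋆ J s1) = (J s1 ⋆ i) • c Γ X1.
  by rewrite /c -Jt -Jc br_nat Jc.
have -> : (i ⋆ (c Γ Y1 ⋆ ι Y2)) • (i ⋆ (i ⋆ (J s1 ⋆ J s2)))
    = i ⋆ ((c Γ Y1 • (i ⋆ J s1)) ⋆ (ι Y2 • J s2)).
  rewrite (otJ (ident Γ ⊗ₘ s1) (br Γ Y1) s2 (ident Y2)) //.
  rewrite (Jwl Γ ((ident Γ ⊗ₘ s1) ⊗ₘ s2) (br Γ Y1 ⊗ₘ ident Y2)) //.
  by rewrite !Jt otA.
rewrite cn J1id -{1}[J s2]Jid1 (otJ (br Γ X1) (s1 ⊗ₘ ident Γ) (ident X2) s2) //.
rewrite (Jwl Γ (br Γ X1 ⊗ₘ ident X2) ((s1 ⊗ₘ ident Γ) ⊗ₘ s2)) //.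
by rewrite !Jt !otA.
Qed.

Let sg_comul X1 X2 :
  sg (Γ ⊗ X1) (Γ ⊗ X2) • (i ⋆ sg X1 X2) • (D ⋆ (ι X1 ⋆ ι X2))
  = ((D ⋆ ι X1) ⋆ (D ⋆ ι X2)) • sg X1 X2.
Proof.
pose U := ((i ⋆ D) ⋆ i) • (D ⋆ i) • D.
have EK : (D ⋆ ι (Γ ⊗ Γ)) • (i ⋆ D) • D = U.
  rewrite coassoc Jid -otA.
  have -> : ((D ⋆ i) ⋆ i) • (D ⋆ i) • D = (((D ⋆ i) • D) ⋆ i) • D.
    by rewrite ocA (Jwr Γ Δ (Δ ⊗ₘ ident Γ)).
  rewrite -coassoc (Jwr Γ Δ (ident Γ ⊗ₘ Δ)) // -ocA.
  by rewrite /U !Jt.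
have EU : ((i ⋆ c Γ Γ) ⋆ i) • U = U.
  rewrite /U ocA; congr (_ • _).
  rewrite -(Jwr Γ (ident Γ ⊗ₘ Δ) (ident Γ ⊗ₘ br Γ Γ)) // !Jt.
  by rewrite -(Jwl Γ Δ (br Γ Γ)) // cocomm.
have tail : (D ⋆ ι (Γ ⊗ (Γ ⊗ (X1 ⊗ X2)))) • (i ⋆ (D ⋆ ι (X1 ⊗ X2)))
    • (D ⋆ ι (X1 ⊗ X2)) = U ⋆ ι (X1 ⊗ X2).
  have -> : D ⋆ ι (Γ ⊗ (Γ ⊗ (X1 ⊗ X2))) = (D ⋆ ι (Γ ⊗ Γ)) ⋆ ι (X1 ⊗ X2).
    by rewrite !Jid !otA.
  rewrite -otA -(Jwr (X1 ⊗ X2) Δ (ident Γ ⊗ₘ Δ)) // -Jc.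
  rewrite -(Jwr (X1 ⊗ X2) ((ident Γ ⊗ₘ Δ) ∘ Δ) (Δ ⊗ₘ ident (Γ ⊗ Γ))) //.
  by rewrite Jc !Jt EK.
have id3 : ι (Γ ⊗ ((Γ ⊗ X1) ⊗ X2)) = ι (Γ ⊗ (Γ ⊗ (X1 ⊗ X2))).
  by rewrite !Jid !otA.
have cl : c Γ (Γ ⊗ X1) = (i ⋆ c Γ X1) • (c Γ Γ ⋆ ι X1).
  by rewrite /c (J_same (br_tenr Γ Γ X1)) Jce.
have cr : (ι X1 ⋆ D) • c Γ X1
    = (c Γ X1 ⋆ i) • (i ⋆ c Γ X1) • (D ⋆ ι X1).
  rewrite /c -Jt -Jc -br_nat Jc (J_same (br_tenl Γ Γ X1)) Jce.
  by rewrite -ocA.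
transitivity ((ι (Γ ⊗ Γ) ⋆ ((c Γ X1 ⋆ i) ⋆ ι X2))
    • (ι (Γ ⊗ Γ) ⋆ ((i ⋆ c Γ X1) ⋆ ι X2)) • (U ⋆ ι (X1 ⊗ X2))).
  rewrite /sg cl.
  rewrite (Jwr (Γ ⊗ X2) (br Γ Γ ⊗ₘ ident X1) (ident Γ ⊗ₘ br Γ X1)) ?(tenA CP) //.
  rewrite (Jwl Γ ((br Γ Γ ⊗ₘ ident X1) ⊗ₘ ident (Γ ⊗ X2))
    ((ident Γ ⊗ₘ br Γ X1) ⊗ₘ ident (Γ ⊗ X2))) ?(tenA CP) //.
  have -> : i ⋆ ((i ⋆ (c Γ X1 ⋆ ι X2)) • (D ⋆ (ι X1 ⋆ ι X2)))
      = (i ⋆ (i ⋆ (c Γ X1 ⋆ ι X2))) • (i ⋆ (D ⋆ ι (X1 ⊗ X2))).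
    rewrite -Jid (Jwl Γ (Δ ⊗ₘ ident (X1 ⊗ X2))
      (ident Γ ⊗ₘ (br Γ X1 ⊗ₘ ident X2))) //; exact: kswap_src.
  rewrite -!Jid -!ocA; rewrite [X in _ • _ • X]ocA.
  rewrite (Jxch Δ (ident Γ ⊗ₘ (br Γ X1 ⊗ₘ ident X2))) //; last first.
    by rewrite kswap_tgt.
  rewrite -!ocA id3 tail.
  have -> : i ⋆ ((c Γ Γ ⋆ ι X1) ⋆ ι (Γ ⊗ X2))
      = (i ⋆ c Γ Γ) ⋆ ι (X1 ⊗ (Γ ⊗ X2)) by rewrite (Jid X1) !otA.
  have -> : ι (Γ ⊗ Γ) ⋆ (i ⋆ (c Γ X1 ⋆ ι X2))
      = ι ((Γ ⊗ Γ) ⊗ Γ) ⋆ (c Γ X1 ⋆ ι X2) by rewrite !Jid !otA.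
  rewrite [X in _ • X]ocA.
  rewrite (Jxch (ident Γ ⊗ₘ br Γ Γ) (br Γ X1 ⊗ₘ ident X2)) ?(tenA CP) //.
  rewrite -ocA.
  have -> : ((i ⋆ c Γ Γ) ⋆ ι ((Γ ⊗ X1) ⊗ X2)) • (U ⋆ ι (X1 ⊗ X2))
      = U ⋆ ι (X1 ⊗ X2).
    have -> : (i ⋆ c Γ Γ) ⋆ ι ((Γ ⊗ X1) ⊗ X2)
        = ((i ⋆ c Γ Γ) ⋆ i) ⋆ ι (X1 ⊗ X2) by rewrite !Jid !otA.
    have eU : U = J ((Δ ⊗ₘ ident (Γ ⊗ Γ)) ∘ (ident Γ ⊗ₘ Δ) ∘ Δ).
      by rewrite !Jc !Jt EK.
    rewrite eU -(Jwr (X1 ⊗ X2) ((Δ ⊗ₘ ident (Γ ⊗ Γ)) ∘ (ident Γ ⊗ₘ Δ) ∘ Δ)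
      ((ident Γ ⊗ₘ br Γ Γ) ⊗ₘ ident Γ)) ?(tenA CP) // -eU.
    by rewrite !Jt EU.
  by congr (_ • _); [|congr (_ • _)]; rewrite ?Jt ?Jid ?Jt ?otA.
rewrite /sg (Jxl (Δ ⊗ₘ ident X1) (Δ ⊗ₘ ident X2)) -!ocA.
rewrite [X in _ = _ • X]ocA.
have -> : (ι (Γ ⊗ X1) ⋆ J (Δ ⊗ₘ ident X2)) • (i ⋆ (c Γ X1 ⋆ ι X2))
    = (i ⋆ ((c Γ X1 ⋆ i) ⋆ ι X2)) • (i ⋆ ((i ⋆ c Γ X1) ⋆ ι X2))
      • (i ⋆ ((D ⋆ ι X1) ⋆ ι X2)).
  have -> : ι (Γ ⊗ X1) ⋆ J (Δ ⊗ₘ ident X2) = i ⋆ ((ι X1 ⋆ D) ⋆ ι X2).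
    by rewrite Jid !otA.
  rewrite -(Jwl Γ (br Γ X1 ⊗ₘ ident X2) ((ident X1 ⊗ₘ Δ) ⊗ₘ ident X2)) //.
  rewrite !Jt -(Jwr X2 (br Γ X1) (ident X1 ⊗ₘ Δ)) // !Jt cr.
  rewrite -(Jce (tenA CP Γ Γ X1) (ident Γ ⊗ₘ br Γ X1) (Δ ⊗ₘ ident X1)).
  rewrite (Jwr X2 ((ident Γ ⊗ₘ br Γ X1) ∘[tenA CP Γ Γ X1] (Δ ⊗ₘ ident X1))
    (br Γ X1 ⊗ₘ ident Γ)) ?(tenA CP) //.
  rewrite Jce (Jwr X2 (Δ ⊗ₘ ident X1) (ident Γ ⊗ₘ br Γ X1)) ?(tenA CP) //.
  have e : ((Γ ⊗ Γ) ⊗ X1) ⊗ X2 = (Γ ⊗ (Γ ⊗ X1)) ⊗ X2 by rewrite (tenA CP Γ Γ).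
  rewrite -(Jce e ((ident Γ ⊗ₘ br Γ X1) ⊗ₘ ident X2)
    ((Δ ⊗ₘ ident X1) ⊗ₘ ident X2)).
  rewrite (Jwl Γ (((ident Γ ⊗ₘ br Γ X1) ⊗ₘ ident X2)
    ∘[e] ((Δ ⊗ₘ ident X1) ⊗ₘ ident X2))
    ((br Γ X1 ⊗ₘ ident Γ) ⊗ₘ ident X2)) ?(tenA CP) //.
  rewrite Jce (Jwl Γ ((Δ ⊗ₘ ident X1) ⊗ₘ ident X2)
    ((ident Γ ⊗ₘ br Γ X1) ⊗ₘ ident X2)) ?(tenA CP) //.
rewrite -!ocA.
have -> : J (Δ ⊗ₘ ident X1) ⋆ ι ((Γ ⊗ Γ) ⊗ X2) = D ⋆ ι (X1 ⊗ ((Γ ⊗ Γ) ⊗ X2)).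
  by rewrite Jt otA -Jid.
rewrite [RHS]ocA (Jxch Δ ((br Γ X1 ⊗ₘ ident Γ) ⊗ₘ ident X2)) ?(tenA CP) //.
rewrite -[RHS]ocA; congr (_ • _).
rewrite [RHS]ocA (Jxch Δ ((ident Γ ⊗ₘ br Γ X1) ⊗ₘ ident X2)) ?(tenA CP) //.
rewrite -[RHS]ocA; congr (_ • _).
have -> : ι ((Γ ⊗ (Γ ⊗ X1)) ⊗ X2) = ι (Γ ⊗ (Γ ⊗ (X1 ⊗ X2))).
  by rewrite !Jid !otA.
by rewrite otA -Jid tail.
Qed.



Lemma ktem_kcmp X Y Z X' Y' Z' (t : mor (Γ ⊗ Y) Z) (s : mor (Γ ⊗ X) Y)
    (t' : mor (Γ ⊗ Y') Z') (s' : mor (Γ ⊗ X') Y') :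
  kcmp (ktem t t') (ktem s s') = ktem (kcmp t s) (kcmp t' s').
Proof.
apply: J_inj; rewrite J_kcmp !J_ktem !J_kcmp Jid -/(sg X X') -/(sg Y Y').
have es : sg X X' = J ((ident Γ ⊗ₘ (br Γ X ⊗ₘ ident X'))
    ∘[kswap_src X X'] (Δ ⊗ₘ ident (X ⊗ X'))) by rewrite Jce /sg -Jid.
have -> : i ⋆ ((J s ⋆ J s') • sg X X') = (i ⋆ (J s ⋆ J s')) • (i ⋆ sg X X').
  by rewrite es -Jt Jwl // kswap_tgt.
transitivity ((J t ⋆ J t') • (sg Y Y' • (i ⋆ (J s ⋆ J s')))
    • (i ⋆ sg X X') • (D ⋆ (ι X ⋆ ι X'))); first by rewrite -!ocA.
rewrite sg_nat -(ocA ((i ⋆ J s) ⋆ (i ⋆ J s'))) sg_comul.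
have k (t1 : mor (Γ ⊗ Y) Z) : J t • (i ⋆ J s) • (D ⋆ ι X)
   = J t • J ((ident Γ ⊗ₘ s) ∘[tenA CP Γ Γ X] (Δ ⊗ₘ ident X)) by rewrite Jce.
rewrite k //.
have -> : J t' • (i ⋆ J s') • (D ⋆ ι X')
   = J t' • J ((ident Γ ⊗ₘ s') ∘[tenA CP Γ Γ X'] (Δ ⊗ₘ ident X')) by rewrite Jce.
by rewrite otJ // !Jce otJ ?(tenA CP) // -!ocA.
Qed.

Lemma kact_kcmp X Y Z (g h : mor Γ Γ) (t : mor (Γ ⊗ Y) Z) (s : mor (Γ ⊗ X) Y) :
    g ∘ Gmul A = Gmul A ∘ (g ⊗ₘ g) -> h ∘ Gmul A = Gmul A ∘ (h ⊗ₘ h) ->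
    g ∘ h = ident Γ -> h ∘ g = ident Γ ->
  kact g (kcmp t s) = kcmp (kact g t) (kact g s).
Proof.
move=> gM hM gh hg; have gD := Del_aut HS gM hM gh hg.
apply: J_inj; rewrite !J_kact !J_kcmp !J_kact -!ocA; congr (_ • _).
have -> : (D ⋆ ι X) • (J g ⋆ ι X) = (J g ⋆ (J g ⋆ ι X)) • (D ⋆ ι X).
  by rewrite -(Jwr X g Δ) // -Jc gD Jc (Jwr X Δ (g ⊗ₘ g)) // Jt otA.
rewrite !ocA; congr (_ • _).
rewrite -(J_kact g s) -(Jxl g (kact g s)) J_kact -{3}[J g]J1id.
by rewrite (otJ g (ident Γ) (g ⊗ₘ ident X) s).
Qed.

Lemma kcmpPl X Y Z a (t t' : mor (Γ ⊗ Y) Z) (s : mor (Γ ⊗ X) Y) :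
  kcmp (a *: t + t') s = a *: kcmp t s + kcmp t' s.
Proof. exact: cmpPl CP _ _ _ _ _ _ _. Qed.

Lemma kcmpPr X Y Z a (t : mor (Γ ⊗ Y) Z) (s s' : mor (Γ ⊗ X) Y) :
  kcmp t (a *: s + s') = a *: kcmp t s + kcmp t s'.
Proof. by rewrite /kcmp (temPr CP) (cmpPl CP) (cmpPr CP). Qed.

End Kleisli.

Section Galois.
Variables (F : closedFieldType) (char0 : [pchar F] =i pred0) (C : btc F).
Variables (S : obj C -> Prop) (HS : isTensorSub S).
Variables (G0 : finGroupType) (E : repEquiv S G0) (A : regAlg E).
Local Notation Γ := (Gam A).
Local Notation Δ := (Gdel A).
Local Notation CP := (stcP C).

Record galObj := GalObj {
  gob : obj C;
  gid : mor (Γ ⊗ gob) gob;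
  gidP : kcmp gid gid = gid
}.

(* Hom-spaces of the idempotent completion: the s with s = q s p. *)
Definition galSpace (X Y : galObj) : {vspace mor (Γ ⊗ gob X) (gob Y)} :=
  fixedSpace (linfun (fun s => kcmp (gid Y) (kcmp s (gid X)))).

Lemma galSpaceP (X Y : galObj) (s : mor (Γ ⊗ gob X) (gob Y)) :
  s \in galSpace X Y <-> kcmp (gid Y) (kcmp s (gid X)) = s.
Proof.
pose f (r : mor (Γ ⊗ gob X) (gob Y)) := kcmp (gid Y) (kcmp r (gid X)).
have fl : linear f by move=> a r r'; rewrite /f kcmpPl kcmpPr.
pose fL := GRing.isLinear.Build _ _ _ _ f fl.
pose ff : {linear _ -> _} := HB.pack f fL.
have fE' : linfun f s = f s by rewrite -[f]/(ff : _ -> _) lfunE.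
by rewrite -/(f s) -fE'; split => /fixedSpaceP.
Qed.

Lemma galSpace_cmpl (X Y : galObj) (s : subvs_of (galSpace X Y)) :
  kcmp (gid Y) (vsval s) = vsval s.
Proof.
by have /galSpaceP sP := valP s; rewrite -[X in kcmp _ X]sP kcmpA // gidP.
Qed.

Lemma galSpace_cmpr (X Y : galObj) (s : subvs_of (galSpace X Y)) :
  kcmp (vsval s) (gid X) = vsval s.
Proof.
by have /galSpaceP sP := valP s; rewrite -[X in kcmp X _]sP -!kcmpA // gidP.
Qed.

Lemma gal_ident_subproof (X : galObj) : gid X \in galSpace X X.
Proof. by apply/galSpaceP; rewrite !gidP. Qed.

Definition galIdent (X : galObj) : subvs_of (galSpace X X) :=
  Subvs (gal_ident_subproof X).

Lemma gal_cmp_subproof (X Y Z : galObj) (t : subvs_of (galSpace Y Z))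
    (s : subvs_of (galSpace X Y)) : kcmp (vsval t) (vsval s) \in galSpace X Z.
Proof.
by apply/galSpaceP; rewrite -(kcmpA HS) galSpace_cmpr (kcmpA HS) galSpace_cmpl.
Qed.

Definition galCmp (X Y Z : galObj) (t : subvs_of (galSpace Y Z))
    (s : subvs_of (galSpace X Y)) : subvs_of (galSpace X Z) :=
  Subvs (gal_cmp_subproof t s).

Definition galOne : galObj := GalObj (kcmp1f HS char0 (kid A tone)).

Lemma gal_ten_subproof (X Y : galObj) :
  kcmp (ktem (gid X) (gid Y)) (ktem (gid X) (gid Y)) = ktem (gid X) (gid Y).
Proof. by rewrite (ktem_kcmp HS) !gidP. Qed.

Definition galTen (X Y : galObj) : galObj := GalObj (gal_ten_subproof X Y).

Lemma gal_tem_subproof (X Y X' Y' : galObj) (s : subvs_of (galSpace X Y))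
    (t : subvs_of (galSpace X' Y')) :
  ktem (vsval s) (vsval t) \in galSpace (galTen X X') (galTen Y Y').
Proof.
by apply/galSpaceP; rewrite !(ktem_kcmp HS) !galSpace_cmpr !galSpace_cmpl.
Qed.

Definition galTem (X Y X' Y' : galObj) (s : subvs_of (galSpace X Y))
    (t : subvs_of (galSpace X' Y')) :
    subvs_of (galSpace (galTen X X') (galTen Y Y')) :=
  Subvs (gal_tem_subproof s t).

Definition galois : tcData F :=
  @TcData F galObj (fun X Y => subvs_of (galSpace X Y))
    galIdent galCmp galOne galTen galTem.

(* For the regular algebra the endomorphisms satisfying the first two conditions
   are automatically invertible. *)
Definition isAlgAut (g : mor Γ Γ) : Prop :=
  [/\ g ∘ Gmul A = Gmul A ∘ (g ⊗ₘ g), g ∘ Gunt A = Gunt A & isIso g].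

Record algAut := AlgAut { aut_val :> mor Γ Γ; _ : `[< isAlgAut aut_val >] }.

HB.instance Definition _ := [isSub for aut_val].
HB.instance Definition _ := [Choice of algAut by <:].

Lemma algAutP (g : algAut) : isAlgAut g.
Proof. by apply/asboolP; case: g. Qed.

Lemma algAut1_subproof : `[< isAlgAut (ident Γ) >].
Proof.
apply/asboolP; split; rewrite ?(tem_id CP) ?(cmp1f CP) ?(cmpf1 CP) //.
by exists (ident Γ); rewrite (cmp1f CP).
Qed.

Lemma algAutM_subproof (g h : algAut) : `[< isAlgAut (g ∘ h) >].
Proof.
have [gM g1 [g' [g'g gg']]] := algAutP g.
have [hM h1 [h' [h'h hh']]] := algAutP h.
apply/asboolP; split.
- by rewrite -(cmpA CP) hM (cmpA CP) gM -(cmpA CP) -(tem_cmp CP).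
- by rewrite -(cmpA CP) h1.
exists (h' ∘ g'); split; rewrite -(cmpA CP).
  by rewrite (cmpA CP g') g'g (cmp1f CP).
by rewrite (cmpA CP h) hh' (cmp1f CP).
Qed.

Definition algAut_inv (g : algAut) : mor Γ Γ :=
  let: And3 _ _ gi := algAutP g in sval (cid gi).

Lemma algAut_invP (g : algAut) :
  algAut_inv g ∘ g = ident Γ /\ g ∘ algAut_inv g = ident Γ.
Proof. by rewrite /algAut_inv; case: (algAutP g) => _ _ gi; case: cid. Qed.

Lemma algAutV_subproof (g : algAut) : `[< isAlgAut (algAut_inv g) >].
Proof.
have [gM g1 _] := algAutP g; have [hg gh] := algAut_invP g.
apply/asboolP; split; last by exists g.
- set h := algAut_inv g in hg gh *.
  rewrite -[LHS](cmpf1 CP) -(tem_id CP) -gh (tem_cmp CP) (cmpA CP).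
  by rewrite -(cmpA CP h) -gM (cmpA CP h) hg (cmp1f CP).
- by rewrite -[in LHS]g1 (cmpA CP) hg (cmp1f CP).
Qed.

Lemma algAut_mulA : associative
  (fun g h => AlgAut (algAutM_subproof g h)).
Proof. by move=> f g h; apply: val_inj; rewrite /= (cmpA CP). Qed.

Lemma algAut_mul1g : left_id (AlgAut algAut1_subproof)
  (fun g h => AlgAut (algAutM_subproof g h)).
Proof. by move=> g; apply: val_inj; rewrite /= (cmp1f CP). Qed.

Lemma algAut_mulg1 : right_id (AlgAut algAut1_subproof)
  (fun g h => AlgAut (algAutM_subproof g h)).
Proof. by move=> g; apply: val_inj; rewrite /= (cmpf1 CP). Qed.

Lemma algAut_mulVg : left_inverse (AlgAut algAut1_subproof)
  (fun g => AlgAut (algAutV_subproof g))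
  (fun g h => AlgAut (algAutM_subproof g h)).
Proof. by move=> g; apply: val_inj; rewrite /= (algAut_invP g).1. Qed.

Lemma algAut_mulgV : right_inverse (AlgAut algAut1_subproof)
  (fun g => AlgAut (algAutV_subproof g))
  (fun g h => AlgAut (algAutM_subproof g h)).
Proof. by move=> g; apply: val_inj; rewrite /= (algAut_invP g).2. Qed.

HB.instance Definition _ := isGroup.Build algAut
  algAut_mulA algAut_mul1g algAut_mulg1 algAut_mulVg algAut_mulgV.

Lemma kact_algAut X Y Z (g : algAut) (t : mor (Γ ⊗ Y) Z) (s : mor (Γ ⊗ X) Y) :
  kact g (kcmp t s) = kcmp (kact g t) (kact g s).
Proof.
have [gM _ _] := algAutP g; have [hM _ _] := algAutP (g^-1)%g.
have [hg gh] := algAut_invP g.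
exact: (kact_kcmp HS t s gM hM gh hg).
Qed.

Lemma gal_act_subproof (g : algAut) (X : galObj) :
  let p := kact (g^-1)%g (gid X) in kcmp p p = p.
Proof. by move=> p; rewrite /p -kact_algAut gidP. Qed.

Definition galActO (g : algAut) (X : galObj) : galObj :=
  GalObj (gal_act_subproof g X).

Lemma gal_actM_subproof (g : algAut) (X Y : galObj)
    (s : subvs_of (galSpace X Y)) :
  kact (g^-1)%g (vsval s) \in galSpace (galActO g X) (galActO g Y).
Proof.
apply/galSpaceP; have /galSpaceP e := valP s.
by rewrite -[X in _ = kact _ X]e !kact_algAut.
Qed.

Definition galActM (g : algAut) (X Y : galObj) (s : subvs_of (galSpace X Y)) :
    subvs_of (galSpace (galActO g X) (galActO g Y)) :=
  Subvs (gal_actM_subproof g s).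

Definition galDim (X : galObj) : mor (tone : obj C) tone :=
  evb (gob X) ∘ (gid X ⊗ₘ ident (du (gob X)))
  ∘[esym (tenA CP Γ (gob X) (du (gob X)))] (Gunt A ⊗ₘ coev (gob X))
  ∘ eqh (esym (tenX1 CP tone)).

Lemma galDeg_subproof (X : obj C) :
  (Γ ⊗ Γ) ⊗ (X ⊗ du X) = (Γ ⊗ (Γ ⊗ X)) ⊗ du X.
Proof. by rewrite !(tenA CP). Qed.

Definition galDeg (X : galObj) : mor Γ Γ :=
  (scal (galDim X))^-1 *:
  (eqh (tenX1 CP Γ)
   ∘ (ident Γ ⊗ₘ evb (gob X))
   ∘[tenA CP Γ (gob X) (du (gob X))]
     ((brI Γ (gob X) ∘ brI (gob X) Γ) ⊗ₘ ident (du (gob X)))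
   ∘ ((ident Γ ⊗ₘ gid X) ⊗ₘ ident (du (gob X)))
   ∘[galDeg_subproof (gob X)] (Δ ⊗ₘ coev (gob X))
   ∘ eqh (esym (tenX1 CP Γ))).

Definition homogOf (X : obj galois) (g : algAut) : Prop :=
  nonzero X /\ exists n, exists Y : 'I_n -> obj galois,
    (forall k, simple (Y k) /\ galDeg (Y k) = g) /\ isDsum Y X.

Definition homog (X : obj galois) : Prop := exists g, homogOf X g.

(* The grade of a homogeneous object is unique, so the choice is immaterial. *)
Definition galGrade (X : {X | homog X}) : algAut := sval (cid (svalP X)).

End Galois.

(* [hg] selects the objects of the full subcategory of homogeneous objects, and
   [deg] is defined on these only; hence the grade of, say, a tensor product of
   homogeneous objects is that of any Z in the subtype lying over it. *)
Record crossedData (F : fieldType) (D : tcData F) (G : groupType) :=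
  CrossedData {
    hg : obj D -> Prop;
    deg : {X | hg X} -> G;
    actO : G -> obj D -> obj D;
    actM : forall g X Y, mor X Y -> mor (actO g X) (actO g Y)
  }.

Record isCrossed F (D : tcData F) G (K : crossedData D G) : Prop := IsCrossed {
  cr_strict : isStrictTensor D;
  hg_one : hg K tone;
  hg_ten : forall X Y, hg K X -> hg K Y -> hg K (X ⊗ Y);
  deg_iso : forall X Y : {X | hg K X},
    isomorphic (sval X) (sval Y) -> deg X = deg Y;
  actM_lin : forall g X Y a (s t : mor X Y),
    actM K g (a *: s + t) = a *: actM K g s + actM K g t;
  actM_ident : forall g X, actM K g (ident X) = ident (actO K g X);
  actM_cmp : forall g X Y Z (t : mor Y Z) (s : mor X Y),
    actM K g (t ∘ s) = actM K g t ∘ actM K g s;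
  actO_one : forall g, actO K g tone = tone;
  actO_ten : forall g X Y, actO K g (X ⊗ Y) = actO K g X ⊗ actO K g Y;
  actM_tem : forall g X Y X' Y' (s : mor X Y) (t : mor X' Y'),
    actM K g (s ⊗ₘ t) ≈ actM K g s ⊗ₘ actM K g t;
  actO_1 : forall X, actO K 1%g X = X;
  actM_1 : forall X Y (s : mor X Y), actM K 1%g s ≈ s;
  actO_M : forall g h X, actO K (g * h)%g X = actO K g (actO K h X);
  actM_M : forall g h X Y (s : mor X Y),
    actM K (g * h)%g s ≈ actM K g (actM K h s);
  deg_ten : forall X Y Z : {X | hg K X},
    sval Z = sval X ⊗ sval Y -> deg Z = (deg X * deg Y)%g;
  hg_act : forall g X, hg K X -> hg K (actO K g X);
  deg_act : forall g (X Y : {X | hg K X}),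
    sval Y = actO K g (sval X) -> deg Y = (g * deg X * g^-1)%g;
  cr_dsum : isAdditive D -> forall X, exists n, exists Y : 'I_n -> obj D,
    (forall k, hg K (Y k)) /\ isDsum Y X
}.

Record isCrossedBraiding F (D : tcData F) G (K : crossedData D G)
    (H : isStrictTensor D)
    (c : forall (X : {X | hg K X}) (Y : obj D),
      mor (sval X ⊗ Y) (actO K (deg X) Y ⊗ sval X)) : Prop :=
  IsCrossedBraiding {
  cb_iso : forall X Y, isIso (c X Y);
  cb_nat : forall (X X' : {X | hg K X}) (Y Y' : obj D)
      (s : mor (sval X) (sval X')) (t : mor Y Y'), deg X = deg X' ->
    c X' Y' ∘ (s ⊗ₘ t) ≈ (actM K (deg X) t ⊗ₘ s) ∘ c X Y;
  cb_tenr : forall X Z W,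
    c X (Z ⊗ W)
    ≈ (ident (actO K (deg X) Z) ⊗ₘ c X W)
      ∘[tenA H (actO K (deg X) Z) (sval X) W] (c X Z ⊗ₘ ident W);
  cb_tenl : forall (X Y XY : {X | hg K X}) Z, sval XY = sval X ⊗ sval Y ->
    c XY Z
    ≈ (c X (actO K (deg Y) Z) ⊗ₘ ident (sval Y))
      ∘[esym (tenA H (sval X) (actO K (deg Y) Z) (sval Y))]
      (ident (sval X) ⊗ₘ c Y Z);
  cb_act : forall g (X gX : {X | hg K X}) Y, sval gX = actO K g (sval X) ->
    actM K g (c X Y) ≈ c gX (actO K g Y)
}.

Arguments isCrossedBraiding {F D G} K H c.

Definition isBraidedCrossed F (D : tcData F) G (K : crossedData D G) : Prop :=
  exists H : isCrossed K, exists c, isCrossedBraiding K (cr_strict H) c.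

Definition galoisCrossed (F : closedFieldType) (char0 : [pchar F] =i pred0)
    (C : btc F) (S : obj C -> Prop) (HS : isTensorSub S) (G0 : finGroupType)
    (E : repEquiv S G0) (A : regAlg E) :
    crossedData (galois char0 HS A) (algAut A) :=
  @CrossedData F (galois char0 HS A) (algAut A) (@homog F char0 C S HS G0 E A)
    (@galGrade F char0 C S HS G0 E A) (@galActO F C S HS G0 E A)
    (@galActM F C S HS G0 E A).

(* Main.v *)
(* Everything happens in K = C ⋊₀ S, a strict tensor category containing C and a
   grouplike point j : 1 -> Γ (the identity of Γ) through which every morphism
   of K factors. The braiding of C is natural in K in its first variable; in its
   second one it fails by the monodromy of X with Γ, read as a morphism
   X -> Γ ⊗ X of K. An idempotent p of K has grade g when, on p, this monodromy is
   g^-1 applied to j; then the braiding of C is natural on p up to the action of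
   g, which makes it a crossed braiding. If p is simple, its monodromy is (L ⊗ p) Δ
   for an endomorphism L of Γ, because Γ is a multiple of 1 in K; comultiplicativity
   makes L a coalgebra map, hence a right translation of G. To recover the grade
   from its definition as a partial trace one needs d(p) <> 0. By averaging, every
   morphism of K is von Neumann regular, since C is semisimple; this splits the
   evaluation of p, and cyclicity of the trace (a consequence of tw Γ = 1) then
   gives d(p) <> 0. Regularity also gives semisimplicity of C ⋊ S. *)

Require Import Defs.
From HB Require Import structures.
From mathcomp Require Import all_boot all_order all_algebra all_fingroup.
From mathcomp Require Import boolp.

Set Implicit Arguments.
Unset Strict Implicit.
Unset Printing Implicit Defensive.

Import GRing.Theory.
Local Open Scope ring_scope.
Local Open Scope tcat_scope.

(** * Words in a strict tensor category *)

(** The grade is defined through a division by d(p) and on simple objects only, which suits neither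
    tensor products nor direct sums. The condition [isDeg] is linear in p and makes sense for every
    endomorphism p of an object of K. Since monodromies and points are natural in K, it passes to
    retracts and sums, multiplies under tensor products and is conjugated by the action. The trace
    formula is compared with it for simple objects only ([galDeg_isDeg]), after which [homogP]
    replaces the one by the other. The exponent in g^-1 fits two conventions at once: the grade is
    defined with inverse braidings, and γ_g is precomposition with g^-1. A morphism of K carries its
    own strand Γ, which must cross the strand of a point or of a monodromy; cocommutativity of Δ
    absorbs this crossing. Semisimplicity of C is used in the form of regularity because this is an
    equation: it survives averaging, where m Δ = |G| is invertible, and compression by
    idempotents. *)

Section Words.
Variables (F : fieldType) (T : stc F).
Local Notation TP := (stcP T).
Implicit Types X Y Z W : obj T.
Local Notation word := (option (arrow T)).
Local Notation ι X := (J (ident X)).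
Local Infix "⋆" := (@ot F T) (at level 40, left associativity).
Local Infix "•" := (@oc F T) (at level 45, right associativity).

(* Interchange of • and ⋆ only holds for composable words; the tactic [ty] below
   decides composability by computing sources and targets up to strictness. *)
Definition typed (a : word) X Y : Prop := exists f : mor X Y, a = J f.

Lemma typed_J X Y (f : mor X Y) : typed (J f) X Y.
Proof. by exists f. Qed.

Lemma typed_oc a b X Y Y' Z :
  typed a Y' Z -> typed b X Y -> Y = Y' -> typed (a • b) X Z.
Proof.
move=> [g ->] [f ->] e; subst; exists (g ∘ f); by rewrite Jc.
Qed.

Lemma typed_ot a b X Y X' Y' :
  typed a X Y -> typed b X' Y' -> typed (a ⋆ b) (X ⊗ X') (Y ⊗ Y').
Proof. by move=> [g ->] [f ->]; exists (g ⊗ₘ f). Qed.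

Definition joinable a b : Prop :=
  exists X Y Y' Z, [/\ typed a Y' Z, typed b X Y & Y = Y'].

Lemma otoc a b a' b' : joinable a b -> joinable a' b' ->
  (a • b) ⋆ (a' • b') = (a ⋆ a') • (b ⋆ b').
Proof.
move=> [X [Y [Y' [Z [[g ->] [f ->] e]]]]].
by move=> [U [V [V' [W [[g' ->] [f' ->] e']]]]]; rewrite otJ.
Qed.

Lemma joinableI a b X Y Y' Z : typed a Y' Z -> typed b X Y -> Y = Y' ->
  joinable a b.
Proof. by move=> ? ? ?; exists X, Y, Y', Z. Qed.

Definition source a X : Prop := exists X' Y, typed a X' Y /\ X' = X.
Definition target a Y : Prop := exists X Y', typed a X Y' /\ Y' = Y.

Lemma sourceI a X X' Y : typed a X' Y -> X' = X -> source a X.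
Proof. by exists X', Y. Qed.

Lemma targetI a X Y Y' : typed a X Y' -> Y' = Y -> target a Y.
Proof. by exists X, Y'. Qed.

Lemma oc1 a X : source a X -> a • ι X = a.
Proof. by move=> [X' [Y [[f ->] <-]]]; rewrite Jid1. Qed.

Lemma o1c a Y : target a Y -> ι Y • a = a.
Proof. by move=> [X [Y' [[f ->] <-]]]; rewrite J1id. Qed.

Lemma whl W a b : joinable a b -> ι W ⋆ (a • b) = (ι W ⋆ a) • (ι W ⋆ b).
Proof.
by move=> ab; rewrite -otoc ?Jid1 //; apply: joinableI (typed_J _) (typed_J _) _.
Qed.

Lemma whr W a b : joinable a b -> (a • b) ⋆ ι W = (a ⋆ ι W) • (b ⋆ ι W).
Proof.
by move=> ab; rewrite -otoc ?Jid1 //; apply: joinableI (typed_J _) (typed_J _) _.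
Qed.

Lemma xl a b V W : source a V -> target b W -> (a ⋆ ι W) • (ι V ⋆ b) = a ⋆ b.
Proof.
by move=> [X [Y [[f ->] <-]]] [X' [Y' [[g ->] <-]]]; rewrite -Jxl.
Qed.

Lemma xr a b V W : target a W -> source b V -> (ι W ⋆ b) • (a ⋆ ι V) = a ⋆ b.
Proof.
by move=> [X [Y [[f ->] <-]]] [X' [Y' [[g ->] <-]]]; rewrite -Jxr.
Qed.

Lemma xch a b V V' W W' : source a V -> target a V' -> source b W -> target b W' ->
  (a ⋆ ι W') • (ι V ⋆ b) = (ι V' ⋆ b) • (a ⋆ ι W).
Proof. by move=> ? ? ? ?; rewrite xl // xr. Qed.

Lemma otone a : a ⋆ ι tone = a.
Proof. by case: a => [[X Y f]|] //; apply: J_same; exact: (temf1 TP). Qed.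

Lemma oneot a : ι tone ⋆ a = a.
Proof. by case: a => [[X Y f]|] //; apply: J_same; exact: (tem1f TP). Qed.

Lemma wl_cmp X Y Z W (g : mor Y Z) (f : mor X Y) :
  ident W ⊗ₘ (g ∘ f) = (ident W ⊗ₘ g) ∘ (ident W ⊗ₘ f).
Proof. by rewrite -(tem_cmp TP) (cmp1f TP). Qed.

Lemma wr_cmp X Y Z W (g : mor Y Z) (f : mor X Y) :
  (g ∘ f) ⊗ₘ ident W = (g ⊗ₘ ident W) ∘ (f ⊗ₘ ident W).
Proof. by rewrite -(tem_cmp TP) (cmp1f TP). Qed.

Lemma exch X Y X' Y' (f : mor X Y) (g : mor X' Y') :
  (f ⊗ₘ ident Y') ∘ (ident X ⊗ₘ g) = (ident Y ⊗ₘ g) ∘ (f ⊗ₘ ident X').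
Proof. by rewrite -!(tem_cmp TP) !(cmp1f TP) !(cmpf1 TP). Qed.

End Words.

Ltac objeq := solve [reflexivity
 | rewrite ?(tenA (stcP _), ten1X (stcP _), tenX1 (stcP _)); reflexivity ].
Ltac ty := first
  [ eassumption
  | objeq
  | apply: typed_J
  | apply: typed_oc; [ty | ty | ty]
  | apply: typed_ot; ty
  | apply: sourceI; ty
  | apply: targetI; ty
  | apply: joinableI; ty].

(** Stated for bare [tcData], because it serves for [kdata] before that is known to be strict. *)
Lemma arr_inj F (T : tcData F) (X Y : obj T) (f g : mor X Y) : f ≈ g -> f = g.
Proof.
move=> e; have H : forall a b : arrow T, a = b ->
    forall (ex : asrc a = asrc b) (ey : atgt a = atgt b),
    eq_rect _ (fun Z => mor _ Z) (eq_rect _ (fun Z => mor Z _) (amor a) _ ex) _ ey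
    = amor b.
  move=> a _ <- ex ey.
  by rewrite (Prop_irrelevance ex erefl) (Prop_irrelevance ey erefl).
exact: (H _ _ e erefl erefl).
Qed.

Lemma same0 F (T : tcData F) (X Y X' Y' : obj T) (f : mor X Y) :
  f ≈ (0 : mor X' Y') -> f = 0.
Proof.
move=> e; have eX := congr1 (@asrc F T) e; have eY := congr1 (@atgt F T) e.
by rewrite /= in eX eY; subst; exact: arr_inj.
Qed.

(** * Regularity and decomposition into simple objects *)

Section LinearCategory.
Variables (F : fieldType) (T : stc F).
Local Notation TP := (stcP T).
Implicit Types X Y Z W : obj T.

Lemma cmpDl X Y Z (g g' : mor Y Z) (f : mor X Y) :
  (g + g') ∘ f = g ∘ f + g' ∘ f.
Proof. by have := cmpPl TP 1 g g' f; rewrite !scale1r. Qed.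

Lemma cmpDr X Y Z (g : mor Y Z) (f f' : mor X Y) :
  g ∘ (f + f') = g ∘ f + g ∘ f'.
Proof. by have := cmpPr TP 1 g f f'; rewrite !scale1r. Qed.

Lemma cmp0l X Y Z (f : mor X Y) : (0 : mor Y Z) ∘ f = 0.
Proof. by apply: (addrI (0 ∘ f)); rewrite -cmpDl !addr0. Qed.

Lemma cmp0r X Y Z (g : mor Y Z) : g ∘ (0 : mor X Y) = 0.
Proof. by apply: (addrI (g ∘ 0)); rewrite -cmpDr !addr0. Qed.

Lemma cmpZl X Y Z a (g : mor Y Z) (f : mor X Y) : (a *: g) ∘ f = a *: (g ∘ f).
Proof. by have := cmpPl TP a g 0 f; rewrite cmp0l !addr0. Qed.

Lemma cmpZr X Y Z a (g : mor Y Z) (f : mor X Y) : g ∘ (a *: f) = a *: (g ∘ f).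
Proof. by have := cmpPr TP a g f 0; rewrite cmp0r !addr0. Qed.

Lemma cmpNl X Y Z (g : mor Y Z) (f : mor X Y) : (- g) ∘ f = - (g ∘ f).
Proof. by rewrite -scaleN1r cmpZl scaleN1r. Qed.

Lemma cmpNr X Y Z (g : mor Y Z) (f : mor X Y) : g ∘ (- f) = - (g ∘ f).
Proof. by rewrite -scaleN1r cmpZr scaleN1r. Qed.

Lemma cmpBl X Y Z (g g' : mor Y Z) (f : mor X Y) :
  (g - g') ∘ f = g ∘ f - g' ∘ f.
Proof. by rewrite cmpDl cmpNl. Qed.

Lemma cmpBr X Y Z (g : mor Y Z) (f f' : mor X Y) :
  g ∘ (f - f') = g ∘ f - g ∘ f'.
Proof. by rewrite cmpDr cmpNr. Qed.

Lemma cmp_suml (I : finType) X Y Z (g : I -> mor Y Z) (f : mor X Y) :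
  (\sum_k g k) ∘ f = \sum_k (g k ∘ f).
Proof.
by apply: (big_ind2 (fun a b => a ∘ f = b)) => [|a b a' b' <- <-|//];
  rewrite ?cmp0l ?cmpDl.
Qed.

Lemma cmp_sumr (I : finType) X Y Z (g : mor Y Z) (f : I -> mor X Y) :
  g ∘ (\sum_k f k) = \sum_k (g ∘ f k).
Proof.
by apply: (big_ind2 (fun a b => g ∘ a = b)) => [|a b a' b' <- <-|//];
  rewrite ?cmp0r ?cmpDr.
Qed.

Lemma tem0l X Y X' Y' (g : mor X' Y') : (0 : mor X Y) ⊗ₘ g = 0.
Proof.
have := temPl TP (-1) (0 : mor X Y) 0 g.
by rewrite scaler0 addr0 scaleN1r addNr.
Qed.

Lemma tem_Zl X Y X' Y' a (f : mor X Y) (g : mor X' Y') :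
  (a *: f) ⊗ₘ g = a *: (f ⊗ₘ g).
Proof. by have := temPl TP a f 0 g; rewrite tem0l !addr0. Qed.

Lemma tem0r X Y X' Y' (g : mor X' Y') : g ⊗ₘ (0 : mor X Y) = 0.
Proof.
have := temPr TP (-1) g (0 : mor X Y) 0.
by rewrite scaler0 addr0 scaleN1r addNr.
Qed.

Lemma J_eq X Y X' Y' (f : mor X Y) (g : mor X' Y') : J f = J g -> f ≈ g.
Proof. exact: (congr1 (odflt (Arr f))). Qed.

Lemma J_eq0 X Y X' Y' (f : mor X Y) : J f = J (0 : mor X' Y') -> f = 0.
Proof. by move/J_eq/same0. Qed.

Definition regular X Y (f : mor X Y) : Prop := exists u, f ∘ u ∘ f = f.

(* Splitting off v makes the left ideal f ∘ Hom(Y, X) strictly smaller. *)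
Lemma regular_quasi X Y :
  (forall f : mor X Y, f != 0 -> exists v : mor Y X, v != 0 /\ v ∘ f ∘ v = v) ->
  forall f : mor X Y, regular f.
Proof.
move=> qr f.
pose lc (f : mor X Y) := fun h : mor Y X => f ∘ h.
have lcL f' : linear (lc f') by move=> a h h'; rewrite /lc (cmpPr TP).
pose L f' : {linear _ -> _} := HB.pack (lc f')
  (GRing.isLinear.Build _ _ _ _ (lc f') (lcL f')).
pose I f' := limg (linfun (L f')).
have IP f' h : f' ∘ h \in I f'.
  by have := memv_img (linfun (L f')) (memvf h); rewrite lfunE.
have [m] := ubnP (\dim (I f)); elim: m f => // m IH f dm.
have [->|f0] := eqVneq f 0; first by exists 0; rewrite !cmp0l.
have [v [v0 vfv]] := qr f f0.
pose f' := f - f ∘ v ∘ f.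
have vf' : v ∘ f' = v ∘ f - v ∘ f ∘ v ∘ f by rewrite /f' cmpBr.
have vf'0 : v ∘ f' = 0.
  by rewrite vf' !(cmpA TP) -(cmpA TP v f v) vfv subrr.
have sub : (I f' <= I f)%VS.
  apply/subvP => w /memv_imgP[h _ ->]; rewrite lfunE /= /lc.
  have -> : f' ∘ h = f ∘ (h - v ∘ f ∘ h) by rewrite cmpBl cmpBr !(cmpA TP).
  exact: IP.
have lt : (\dim (I f') < \dim (I f))%N.
  rewrite ltn_neqAle dimvS // andbT; apply: contra v0 => /eqP e.
  (* Were the dimensions equal, f v would be some f' h, and v = v f v = v f' h would vanish. *)
  have : f ∘ v \in I f' by rewrite (_ : I f' = I f) ?IP //; apply/eqP; rewrite eqEdim sub e /=.
  case/memv_imgP => h _; rewrite lfunE /= /lc => fv.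
  by rewrite -vfv fv (cmpA TP) vf'0 cmp0l.
have [u uP] := IH f' (leq_trans lt dm).
have [e1 e2] : f' = f ∘ (ident X - v ∘ f) /\ f' = (ident Y - f ∘ v) ∘ f.
  by rewrite cmpBr cmpBl (cmpf1 TP) (cmp1f TP) -(cmpA TP).
(* As f' = f (1 - v f) = (1 - f v) f, the second term contributes f' u f' = f', and v contributes
   the missing f v f. *)
exists (v + (ident X - v ∘ f) ∘ u ∘ (ident Y - f ∘ v)).
rewrite cmpDl cmpDr.
have -> : f ∘ ((ident X - v ∘ f) ∘ u ∘ (ident Y - f ∘ v)) ∘ f = f'.
  by rewrite -[RHS]uP {2}e2 {1}e1 !(cmpA TP).
by rewrite /f' addrC subrK.
Qed.

(** A nonzero f has a nonzero component between simple summands. By Schur this is a φ with φ an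
    isomorphism and a a nonzero scalar, and a^-1 φ^-1 between projection and inclusion is the v that
    [regular_quasi] asks for. *)
Lemma semisimple_regular X Y (f : mor X Y) : isSemisimple T -> regular f.
Proof.
move=> [_ dec schur]; apply: regular_quasi => {}f f0.
have [n [Xk [sX [i [p [pi _ ip]]]]]] := dec X.
have [m [Yk [sY [j [q [qj _ jq]]]]]] := dec Y.
have [[k l] kl] : exists kl : 'I_n * 'I_m, q kl.2 ∘ f ∘ i kl.1 != 0.
  apply: contrapT => /forallNP z; move/eqP: f0; apply.
  rewrite -[f](cmpf1 TP) -ip cmp_sumr big1 // => k _; rewrite (cmpA TP).
  suff -> : f ∘ i k = 0 by rewrite cmp0l.
  rewrite -[f ∘ i k](cmp1f TP) -jq cmp_suml big1 // => l _; rewrite -(cmpA TP).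
  by have /negP := z (k, l); rewrite negbK => /eqP ->; rewrite cmp0r.
have [[φ [ψ [ψφ φψ]]]|ne] := pselect (isomorphic (Xk k) (Yk l)); last first.
  by move: kl => /=; rewrite (schur _ _ (sX k) (sY l) ne (q l ∘ f ∘ i k)) eqxx.
have [a aE] := (sX k).2 (ψ ∘ q l ∘ f ∘ i k).
have fa : q l ∘ f ∘ i k = a *: φ.
  rewrite -[LHS](cmp1f TP) -φψ -(cmpA TP) aE cmpZr.
  by rewrite (cmpf1 TP).
have a0 : a != 0 by apply: contraNneq kl => a0; rewrite /= fa a0 scale0r.
pose v := a^-1 *: (i k ∘ ψ ∘ q l).
have vE : v ∘ f ∘ v = v.
  rewrite /v cmpZl cmpZr cmpZr; congr (_ *: _).
  have -> : (i k ∘ ψ ∘ q l) ∘ f ∘ i k ∘ ψ ∘ q l = i k ∘ (ψ ∘ q l ∘ f ∘ i k) ∘ ψ ∘ q l.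
    by rewrite !(cmpA TP).
  by rewrite aE cmpZl cmpZr (cmp1f TP) scalerA mulVf // scale1r.
exists v; split=> //; apply: contraTneq (sX k).1 => v0; rewrite negbK.
have : p k ∘ v ∘ j l ∘ φ = a^-1 *: ident (Xk k).
  rewrite /v cmpZl cmpZr; congr (_ *: _).
  have -> : p k ∘ (i k ∘ ψ ∘ q l) ∘ j l ∘ φ = (p k ∘ i k) ∘ ψ ∘ (q l ∘ j l) ∘ φ.
    by rewrite !(cmpA TP).
  by rewrite pi qj !(cmp1f TP) ψφ.
by rewrite v0 cmp0l cmp0r => /esym/eqP; rewrite scaler_eq0 invr_eq0 (negbTE a0).
Qed.

End LinearCategory.

Import VectorInternalTheory.

(** The vector x witnesses that V is nonzero, so that the characteristic polynomial is not constant
    and has a root. *)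
Lemma linear_eigenvector (F : closedFieldType) (V : vectType F)
    (f : {linear V -> V}) (x : V) : x != 0 ->
  exists a v, v != 0 /\ f v = a *: v.
Proof.
move=> x0; pose fr := v2r \o f \o r2v.
have frL : linear fr by move=> a u v; rewrite /fr /= !linearP.
pose frl : {linear _ -> _} := HB.pack fr (GRing.isLinear.Build _ _ _ _ fr frL).
have [a] : exists a, root (char_poly (lin1_mx frl)) a.
  apply/closed_rootP; rewrite size_char_poly; apply: contra x0 => /eqP[V0].
  apply/eqP/v2r_inj; rewrite linear0; apply/rowP => -[i ilt].
  by exfalso; move: ilt; rewrite V0.
rewrite -eigenvalue_root_char => /eigenvalueP[v vE v0].
exists a, (r2v v); split.
  by apply: contra v0 => /eqP/(congr1 v2r); rewrite r2vK linear0 => ->.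
by apply: v2r_inj; rewrite [RHS]linearZ /= r2vK -vE mul_rV_lin1.
Qed.

Section Decomposition.
Variables (F : closedFieldType) (T : stc F).
Local Notation TP := (stcP T).
Implicit Types X Y Z : obj T.
Hypothesis all_regular : forall X Y (f : mor X Y), regular f.
Hypothesis idem_split : forall X (e : mor X X), e ∘ e = e ->
  exists Y (i : mor Y X) (r : mor X Y), r ∘ i = ident Y /\ i ∘ r = e.

(** For a non-scalar f, left multiplication by f on End X has an eigenvector h with eigenvalue a.
    Then f' = f - a is nonzero with f' h = 0, and for a quasi-inverse u of f' the idempotent u f' is
    nonzero and kills h. *)
Lemma proper_idempotent X : nonzero X -> ~ simple X ->
  exists e : mor X X, [/\ e ∘ e = e, e != 0 & e != ident X].
Proof.
move=> X0 nsX.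
have [f fP] : exists f : mor X X, forall a, f != a *: ident X.
  apply: contrapT => /forallNP H; apply: nsX; split=> // f.
  have /existsNP[a /negP] := H f; rewrite negbK => /eqP ->; by exists a.
pose lc (h : mor X X) := f ∘ h.
have lcL : linear lc by move=> a h h'; rewrite /lc (cmpPr TP).
pose L : {linear _ -> _} := HB.pack lc (GRing.isLinear.Build _ _ _ _ lc lcL).
have [a [h [h0]]] := linear_eigenvector L X0; rewrite /= /lc => fh.
pose f' := f - a *: ident X.
have f'0 : f' != 0 by rewrite subr_eq0 fP.
have f'h : f' ∘ h = 0 by rewrite cmpBl cmpZl (cmp1f TP) fh subrr.
have [u uP] := all_regular f'.
exists (u ∘ f'); split.
- by rewrite -(cmpA TP) (cmpA TP f') -(cmpA TP f') uP.
- by apply: contraNneq f'0 => e0; rewrite -uP e0 cmp0r.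
apply: contraNneq h0 => e1.
by rewrite -[h](cmp1f TP) -e1 -(cmpA TP) f'h cmp0r.
Qed.

(** This makes the induction of [semisimple_dec] terminate: h ↦ i h r embeds End Y in End X, and if
    the identity were in the image, i r would be the identity. *)
Lemma retract_dim X Y (i : mor Y X) (r : mor X Y) :
  r ∘ i = ident Y -> i ∘ r != ident X ->
  (\dim (fullv : {vspace mor Y Y}) < \dim (fullv : {vspace mor X X}))%N.
Proof.
move=> ri ir.
pose c (h : mor Y Y) := i ∘ h ∘ r.
have cL : linear c by move=> a h h'; rewrite /c (cmpPl TP) (cmpPr TP).
pose L : {linear _ -> _} := HB.pack c (GRing.isLinear.Build _ _ _ _ c cL).
have cE h : linfun L h = i ∘ h ∘ r by rewrite lfunE.
have kerL : lker (linfun L) == 0%VS.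
  apply/lker0P => h h'; rewrite !cE => e.
  have : r ∘ (i ∘ h ∘ r) ∘ i = r ∘ (i ∘ h' ∘ r) ∘ i by rewrite e.
  by rewrite !(cmpA TP) ri !(cmp1f TP) -!(cmpA TP) ri !(cmpf1 TP).
have : (limg (linfun L) <= fullv)%VS by rewrite subvf.
have dE : \dim (limg (linfun L)) = \dim (fullv : {vspace mor Y Y}).
  by rewrite limg_dim_eq // (eqP kerL) capv0.
rewrite -dE ltn_neqAle => /dimvS ->; rewrite andbT.
apply: contra ir => /eqP e.
have /memv_imgP[h _] : ident X \in limg (linfun L).
  have : (limg (linfun L) == fullv)%VS by rewrite eqEdim subvf e /=.
  by move=> /eqP ->; rewrite memvf.
rewrite cE => idE; have : i ∘ r ∘ ident X = ident X.
  by rewrite {1}idE (cmpA TP r) ri (cmp1f TP) -idE.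
by rewrite (cmpf1 TP) => ->.
Qed.

Lemma isDsum_cat X X1 X2 (i1 : mor X1 X) (r1 : mor X X1) (i2 : mor X2 X) (r2 : mor X X2)
    n1 n2 (Y1 : 'I_n1 -> obj T) (Y2 : 'I_n2 -> obj T) :
    r1 ∘ i1 = ident X1 -> r2 ∘ i2 = ident X2 -> r1 ∘ i2 = 0 -> r2 ∘ i1 = 0 ->
    i1 ∘ r1 + i2 ∘ r2 = ident X -> isDsum Y1 X1 -> isDsum Y2 X2 ->
  isDsum (fun k => match split k with inl k1 => Y1 k1 | inr k2 => Y2 k2 end) X.
Proof.
move=> ri1 ri2 r12 r21 sX [j1 [q1 [qj1 qj1' jq1]]] [j2 [q2 [qj2 qj2' jq2]]].
pose Y k := match split k with inl k1 => Y1 k1 | inr k2 => Y2 k2 end.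
exists (fun k => match split k as s return
    mor (match s with inl k1 => Y1 k1 | inr k2 => Y2 k2 end) X with
  inl k1 => i1 ∘ j1 k1 | inr k2 => i2 ∘ j2 k2 end).
exists (fun k => match split k as s return
    mor X (match s with inl k1 => Y1 k1 | inr k2 => Y2 k2 end) with
  inl k1 => q1 k1 ∘ r1 | inr k2 => q2 k2 ∘ r2 end).
have mid (A B C D E' : obj T) (a : mor D E') (b : mor C D) (c : mor B C) (d : mor A B) :
   (a ∘ b) ∘ (c ∘ d) = a ∘ (b ∘ c) ∘ d by rewrite !(cmpA TP).
split.
- move=> k; case: (split k) => k'; rewrite mid.
    by rewrite ri1 (cmp1f TP) qj1.
  by rewrite ri2 (cmp1f TP) qj2.
- move=> k l; rewrite -(inj_eq (can_inj (@splitK n1 n2))).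
  case: (split k) => k'; case: (split l) => l' kl; rewrite mid.
  + by rewrite ri1 (cmp1f TP) qj1'.
  + by rewrite r12 cmp0l cmp0r.
  + by rewrite r21 cmp0l cmp0r.
  by rewrite ri2 (cmp1f TP) qj2'.
rewrite big_split_ord /= -sX; congr (_ + _).
  transitivity (\sum_k (i1 ∘ (j1 k ∘ q1 k) ∘ r1)).
    apply: eq_bigr => k _; rewrite (unsplitK (inl k : 'I_n1 + 'I_n2)) mid.
    by rewrite !(cmpA TP).
  by rewrite -cmp_sumr -cmp_suml jq1 (cmp1f TP).
transitivity (\sum_k (i2 ∘ (j2 k ∘ q2 k) ∘ r2)).
  apply: eq_bigr => k _; rewrite (unsplitK (inr k : 'I_n1 + 'I_n2)) mid.
  by rewrite !(cmpA TP).
by rewrite -cmp_sumr -cmp_suml jq2 (cmp1f TP).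
Qed.

Lemma isDsum_self X : isDsum (fun=> X : obj T) X (n := 1).
Proof.
exists (fun=> ident X), (fun=> ident X); split=> [k|k l|].
- by rewrite (cmp1f TP).
- by rewrite !ord1 eqxx.
by rewrite big_ord1 (cmp1f TP).
Qed.

Lemma semisimple_dec X : exists n, exists Y : 'I_n -> obj T,
  (forall k, simple (Y k)) /\ isDsum Y X.
Proof.
have [m] := ubnP (\dim (fullv : {vspace mor X X})); elim: m X => // m IH X; rewrite ltnS => dX.
have [X0|X0] := eqVneq (ident X) 0.
  exists 0%N, (fun k : 'I_0 => X); split; first by case.
  exists (fun k => ident X), (fun k => ident X).
  by split; [case | case | rewrite big_ord0].
have [sX|nsX] := pselect (simple X).
  by exists 1%N, (fun=> X); split=> //; exact: isDsum_self.
have [e [ee e0 e1]] := proper_idempotent X0 nsX.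
have ff : (ident X - e) ∘ (ident X - e) = ident X - e.
  by rewrite cmpBl !cmpBr (cmp1f TP) !(cmpf1 TP) (cmp1f TP) ee subrr subr0.
have [X1 [i1 [r1 [ri1 ir1]]]] := idem_split ee.
have [X2 [i2 [r2 [ri2 ir2]]]] := idem_split ff.
have [|n1 [Y1 [sY1 dY1]]] := IH X1.
  by apply: leq_trans dX; apply: retract_dim ri1 _; rewrite ir1.
have [|n2 [Y2 [sY2 dY2]]] := IH X2.
  apply: leq_trans dX; apply: retract_dim ri2 _; rewrite ir2.
  by apply: contra e0 => /eqP/(congr1 (fun h => ident X - h)); rewrite subKr subrr => ->.
exists (n1 + n2)%N, (fun k => match split k with inl k1 => Y1 k1 | inr k2 => Y2 k2 end).
split; first by move=> k; case: (split k).
apply: (isDsum_cat ri1 ri2 _ _ _ dY1 dY2); last by rewrite ir1 ir2 addrC subrK.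
- rewrite -[r1 ∘ i2](cmpf1 TP) -ri2 -[r1](cmp1f TP) -ri1.
  have -> : ((r1 ∘ i1) ∘ r1) ∘ i2 = r1 ∘ (i1 ∘ r1) ∘ i2 by rewrite !(cmpA TP).
  have -> : (r1 ∘ (i1 ∘ r1) ∘ i2) ∘ r2 ∘ i2 = r1 ∘ ((i1 ∘ r1) ∘ (i2 ∘ r2)) ∘ i2.
    by rewrite !(cmpA TP).
  by rewrite ir1 ir2 cmpBr (cmpf1 TP) ee subrr cmp0l cmp0r.
rewrite -[r2 ∘ i1](cmpf1 TP) -ri1 -[r2](cmp1f TP) -ri2.
have -> : ((r2 ∘ i2) ∘ r2) ∘ i1 = r2 ∘ (i2 ∘ r2) ∘ i1 by rewrite !(cmpA TP).
have -> : (r2 ∘ (i2 ∘ r2) ∘ i1) ∘ r1 ∘ i1 = r2 ∘ ((i2 ∘ r2) ∘ (i1 ∘ r1)) ∘ i1.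
  by rewrite !(cmpA TP).
by rewrite ir1 ir2 cmpBl (cmp1f TP) ee subrr cmp0l cmp0r.
Qed.

End Decomposition.

(** * The regular algebra *)

Section RegularAlgebra.
Variables (F : closedFieldType) (C : btc F) (S : obj C -> Prop).
Hypothesis HS : isTensorSub S.
Variables (G0 : finGroupType) (E : repEquiv S G0) (A : regAlg E).
Hypothesis char0 : [pchar F] =i pred0.
Local Notation Γ := (Gam A).
Local Notation Δ := (Gdel A).
Local Notation μ := (Gmul A).
Local Notation CP := (stcP C).
Local Notation n := (#|G0|%:R : F).
Local Notation δ := (dlt A).

Let SG : S Γ := Gam_sub A.
Let SGG : S (Γ ⊗ Γ) := sub_ten HS SG SG.
Let S1 : S tone := sub_one HS.
Let n0 : n != 0 := order_neq0 G0 char0.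

Let fM_ext X Y (f g : mor X Y) : S X -> S Y -> fM E f =1 fM E g -> f = g.
Proof. by move=> SX SY fg; apply: (@fM_faithful _ _ _ _ E _ _ SX SY); apply/lfunP. Qed.

Let fMc X Y Z (g : mor Y Z) (f : mor X Y) a : S X -> S Y -> S Z ->
  fM E (g ∘ f) a = fM E g (fM E f a).
Proof. by move=> SX SY SZ; rewrite fM_cmp // comp_lfunE. Qed.

Let fM1 X (x : fE E X) : S X -> fM E (ident X) x = x.
Proof. by move=> SX; rewrite fM_ident // id_lfunE. Qed.

Let fMZ X Y a (f : mor X Y) x : S X -> S Y -> fM E (a *: f) x = a *: fM E f x.
Proof.
move=> SX SY; have := @fM_lin _ _ _ _ E _ _ SX SY (-1) f f.
rewrite !scaleN1r !addNr => e0.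
by have := @fM_lin _ _ _ _ E _ _ SX SY a f 0; rewrite e0 !addr0 => ->; rewrite !lfunE.
Qed.

Let fMsum X Y (f : G0 -> mor X Y) x : S X -> S Y ->
  fM E (\sum_g f g) x = \sum_g fM E (f g) x.
Proof.
move=> SX SY.
have e0 : fM E (0 : mor X Y) x = 0 by rewrite -(scale0r (0 : mor X Y)) fMZ // scale0r.
apply: (big_ind2 (fun (a : mor X Y) b => fM E a x = b)) => // a1 b1 a2 b2 <- <-.
have := @fM_lin _ _ _ _ E _ _ SX SY 1 a1 a2; rewrite !scale1r => ->.
by rewrite !lfunE.
Qed.

Let fT_Zl X Y a (x : fE E X) (y : fE E Y) : S X -> S Y ->
  fT E (a *: x) y = a *: fT E x y.
Proof.
move=> SX SY; have := @fT_linl _ _ _ _ E _ _ SX SY (-1) x x y.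
rewrite !scaleN1r !addNr => T0.
by have := @fT_linl _ _ _ _ E _ _ SX SY a x 0 y; rewrite T0 !addr0.
Qed.

Let fT_Zr X Y a (x : fE E X) (y : fE E Y) : S X -> S Y ->
  fT E x (a *: y) = a *: fT E x y.
Proof.
move=> SX SY; have := @fT_linr _ _ _ _ E _ _ SX SY (-1) x y y.
rewrite !scaleN1r !addNr => T0.
by have := @fT_linr _ _ _ _ E _ _ SX SY a x y 0; rewrite T0 !addr0.
Qed.

Let fT_suml X Y (a : G0 -> F) (u : G0 -> fE E X) (y : fE E Y) : S X -> S Y ->
  fT E (\sum_g a g *: u g) y = \sum_g a g *: fT E (u g) y.
Proof.
move=> SX SY; apply: (big_ind2 (fun b c => fT E b y = c)).
- by rewrite -(scale0r (0 : fE E X)) fT_Zl // scale0r.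
- move=> x1 y1 x2 y2 <- <-.
  by rewrite -[x1]scale1r fT_linl // !scale1r.
by move=> g _; rewrite fT_Zl.
Qed.

Let fT_sumr X Y (a : G0 -> F) (u : G0 -> fE E Y) (x : fE E X) : S X -> S Y ->
  fT E x (\sum_g a g *: u g) = \sum_g a g *: fT E x (u g).
Proof.
move=> SX SY; apply: (big_ind2 (fun b c => fT E x b = c)).
- by rewrite -(scale0r (0 : fE E Y)) fT_Zr // scale0r.
- move=> x1 y1 x2 y2 <- <-.
  by rewrite -[x1]scale1r fT_linr // !scale1r.
by move=> g _; rewrite fT_Zr.
Qed.

Lemma dlt_ext Y (f g : mor Γ Y) : S Y ->
  (forall x, fM E f (δ x) = fM E g (δ x)) -> f = g.
Proof.
move=> SY fg; apply: fM_ext => // a; rewrite (dlt_sum a) !linear_sum /=.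
by apply: eq_bigr => x _; rewrite !linearZ /= fg.
Qed.

(** The functor to representations is faithful, and the uniqueness part of [fT_univ] reduces maps
    out of Γ ⊗ Γ to pure tensors. *)
Lemma dlt_ext2 Y (f g : mor (Γ ⊗ Γ) Y) : S Y ->
  (forall x y, fM E f (fT E (δ x) (δ y)) = fM E g (fT E (δ x) (δ y))) -> f = g.
Proof.
move=> SY fg; apply: fM_ext => // c.
have fg' a b : fM E f (fT E a b) = fM E g (fT E a b).
  rewrite (dlt_sum a) (dlt_sum b) !fT_suml // !linear_sum /=.
  apply: eq_bigr => x _; rewrite !linearZ /= !fT_sumr // !linear_sum /=.
  by apply: eq_bigr => y _; rewrite !linearZ /= fg.
have [||l [_ lu]] := @fT_univ _ _ _ _ E _ _ SG SG _ (fun a b => fM E f (fT E a b)).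
- by move=> a x x' y; rewrite fT_linl // linearP.
- by move=> a x y y'; rewrite fT_linr // linearP.
by rewrite -(lu (fM E f)) // -(lu (fM E g)) // => x y; rewrite fg'.
Qed.

Let DelE x : fM E Δ (δ x) = n *: fT E (δ x) (δ x).
Proof. exact: ru_Del (dltE A x). Qed.

Let epsE x : fM E (Geps A) (δ x) = n^-1 *: f1 E.
Proof. exact: ru_eps (dltE A x). Qed.

Let mulE x y : fM E μ (fT E (δ x) (δ y)) = (x == y)%:R *: δ x.
Proof.
apply: (bij_inj (ru_bij A)); rewrite ru_mul linearZ /= !dltE.
apply/ffunP => z; rewrite !ffunE /GRing.scale /=; case: (z =P x) => [->|_]; rewrite ?mulr1 ?mul1r //.
by rewrite mulr0 mul0r.
Qed.

Let untE : fM E (Gunt A) (f1 E) = \sum_x δ x.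
Proof.
apply: (bij_inj (ru_bij A)); rewrite ru_unt linear_sum /=; apply/ffunP => y.
rewrite sum_ffunE ffunE (bigD1 y) //= big1 ?addr0 => [|x xy]; rewrite dltE ffunE.
  by rewrite eqxx.
by rewrite eq_sym (negbTE xy).
Qed.

Let actE g x : fR E Γ g (δ x) = δ (g * x)%g.
Proof.
apply: (bij_inj (ru_bij A)); rewrite ru_rep !dltE; apply/ffunP => y.
by rewrite !ffunE -(inj_eq (mulgI g)) mulKVg.
Qed.

Lemma Gmul_Gdel : μ ∘ Δ = n *: ident Γ.
Proof.
apply: dlt_ext => // x; rewrite fMc // DelE linearZ /= mulE eqxx scale1r.
by rewrite fMZ // fM1.
Qed.

Lemma Geps_Gunt : Geps A ∘ Gunt A = ident tone.
Proof.
apply: fM_ext => // a; rewrite fMc // fM1 //.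
have : a \in <<[:: f1 E]>>%VS by rewrite (span_basis (f1_basis E)) memvf.
rewrite span_seq1 => /vlineP[k ->]; rewrite !linearZ /= untE linear_sum /=.
rewrite (eq_bigr (fun=> n^-1 *: f1 E)) => [|x _]; last exact: epsE.
by rewrite sumr_const -scaler_nat cardT -cardE scalerA divff // scale1r.
Qed.

Lemma eps_counitr : eqh (tenX1 CP Γ) ∘ (ident Γ ⊗ₘ Geps A) ∘ Δ = ident Γ.
Proof.
have SG1 := sub_ten HS SG S1.
apply: dlt_ext => // x; rewrite !fMc // DelE linearZ /= fT_nat // epsE.
by rewrite !fM1 // fT_Zr // !linearZ /= fT_1r // scalerA divff // scale1r.
Qed.

Lemma frobenius_l :
  Δ ∘ μ = (ident Γ ⊗ₘ μ) ∘[tenA CP Γ Γ Γ] (Δ ⊗ₘ ident Γ).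
Proof.
have SR := sub_ten HS SG SGG; have SL := sub_ten HS SGG SG.
apply: dlt_ext2 => // x y; rewrite !fMc // mulE linearZ /= DelE fT_nat // DelE fM1 //.
rewrite fT_Zl // !linearZ /= fT_assoc // fT_nat // mulE fM1 // fT_Zr //.
Qed.

Lemma frobenius_r :
  Δ ∘ μ = (μ ⊗ₘ ident Γ) ∘[esym (tenA CP Γ Γ Γ)] (ident Γ ⊗ₘ Δ).
Proof.
have SR := sub_ten HS SG SGG; have SL := sub_ten HS SGG SG.
have assV x y z : fM E (eqh (esym (tenA CP Γ Γ Γ))) (fT E (δ x) (fT E (δ y) (δ z)))
    = fT E (fT E (δ x) (δ y)) (δ z).
  rewrite -(@fT_assoc _ _ _ _ E) // -fMc //.
  have -> : eqh (esym (tenA CP Γ Γ Γ)) ∘ eqh (tenA CP Γ Γ Γ) = ident _.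
    by apply: sameE; rewrite same_eqhl; case: _ / (tenA CP Γ Γ Γ).
  by rewrite fM1.
apply: dlt_ext2 => // x y; rewrite !fMc // mulE linearZ /= DelE fT_nat // DelE fM1 //.
rewrite fT_Zr // !linearZ /= assV fT_nat // mulE fM1 // fT_Zl //.
by case: eqP => [->|_] //; rewrite !scale0r !scaler0.
Qed.

(** Right translations commute with the left regular action, so fullness lifts them to C. *)
Lemma rtrans_ex (h : G0) : exists r : mor Γ Γ, forall x, fM E r (δ x) = δ (x * h)%g.
Proof.
pose l (a : fE E Γ) : fE E Γ := \sum_x (ru A a x : F) *: δ (x * h)%g.
have ll : linear l.
  move=> c a b; rewrite /l scaler_sumr -big_split /=; apply: eq_bigr => x _.
  by rewrite linearP /= !ffunE scalerDl scalerA.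
pose lL : {linear _ -> _} := HB.pack l (GRing.isLinear.Build _ _ _ _ l ll).
have lE a : linfun l a = l a by rewrite -[l]/(lL : _ -> _) lfunE.
have lδ x : l (δ x) = δ (x * h)%g.
  rewrite /l (bigD1 x) //= big1 => [|y yx]; rewrite dltE ffunE.
    by rewrite eqxx scale1r addr0.
  by rewrite (negbTE yx) scale0r.
have [|r rE] := @fM_full _ _ _ _ E _ _ SG SG (linfun l).
  move=> g; apply/lfunP => a; rewrite !comp_lfunE (dlt_sum a) !linear_sum /=.
  apply: eq_bigr => x _; rewrite !linearZ /= actE !lE !lδ actE.
  by rewrite mulgA.
by exists r => x; rewrite rE lE lδ.
Qed.

Definition rtrans h : mor Γ Γ := sval (cid (rtrans_ex h)).

Let rtransE h x : fM E (rtrans h) (δ x) = δ (x * h)%g.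
Proof. exact: svalP (cid (rtrans_ex h)) x. Qed.

Lemma rtrans_algAut h : isAlgAut (rtrans h).
Proof.
split.
- apply: dlt_ext2 => // x y; rewrite !fMc // fT_nat // !rtransE !mulE linearZ /=.
  by rewrite rtransE (inj_eq (mulIg h)).
- apply: fM_ext => // a; have : a \in <<[:: f1 E]>>%VS.
    by rewrite (span_basis (f1_basis E)) memvf.
  rewrite span_seq1 => /vlineP[k ->]; rewrite !linearZ /= fMc // untE.
  congr (_ *: _); rewrite linear_sum /= [RHS](reindex_inj (mulIg h)) /=.
  by apply: eq_bigr => x _; rewrite rtransE.
exists (rtrans h^-1); split; apply: dlt_ext => // x.
  by rewrite fMc // fM1 // !rtransE mulgK.
by rewrite fMc // fM1 // !rtransE mulgKV.
Qed.

(** G permutes the point masses transitively, so an invariant functional takes one value k on all of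
    them; the factor n undoes ε(δ_x) = n^-1. *)
Lemma hom_tone (f : mor Γ tone) : exists a, f = a *: Geps A.
Proof.
have : fM E f (δ 1%g) \in <<[:: f1 E]>>%VS.
  by rewrite (span_basis (f1_basis E)) memvf.
rewrite span_seq1 => /vlineP[k kE]; exists (k * n); apply: dlt_ext => // x.
rewrite fMZ // epsE scalerA mulfK // -[x]mulg1 -actE.
have /lfunP/(_ (δ 1%g)) := @fM_equiv _ _ _ _ E _ _ SG S1 f x.
by rewrite !comp_lfunE /= => ->; rewrite kE linearZ /= f1_rep.
Qed.

(** By [hom_tone] the two sides are proportional, and evaluation at the unit shows the factor to be
    1. *)
Lemma Geps_unit_comp (g : mor Γ Γ) : g ∘ Gunt A = Gunt A -> Geps A ∘ g = Geps A.
Proof.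
move=> gu; have [a ga] := hom_tone (Geps A ∘ g); rewrite ga.
suff -> : a = 1 by rewrite scale1r.
have : Geps A ∘ g ∘ Gunt A = ident tone by rewrite gu Geps_Gunt.
have cZ : (a *: Geps A) ∘ Gunt A = a *: (Geps A ∘ Gunt A).
  have := cmpPl CP (-1) (Geps A) (Geps A) (Gunt A); rewrite !scaleN1r !addNr => z.
  by have := cmpPl CP a (Geps A) 0 (Gunt A); rewrite z !addr0.
rewrite (cmpA CP) ga cZ Geps_Gunt => /eqP; rewrite -subr_eq0 -{2}[ident _]scale1r.
rewrite -scalerBl scaler_eq0 subr_eq0 (negbTE (btc_one C).1) orbF => /eqP ->.
by [].
Qed.

(* A coalgebra endomorphism maps point masses to point masses, and being
   equivariant for left translations it is a right translation. *)
Lemma coalg_rtrans (L : mor Γ Γ) : Δ ∘ L = (L ⊗ₘ L) ∘ Δ ->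
  Geps A ∘ L = Geps A -> exists h, L = rtrans h.
Proof.
move=> LD Le.
pose a := ru A (fM E L (δ 1%g)).
have aE : fM E L (δ 1%g) = \sum_x (a x : F) *: δ x by rewrite -dlt_sum.
(* Applying [μ] to [LD] at δ_1 and dividing by n shows that the function a is a pointwise
   idempotent. *)
have aM x : (a x : F) * a x = a x.
  have := congr1 (fun f => ru A (fM E (μ ∘ f) (δ 1%g)) x) LD.
  rewrite /= !fMc // DelE linearZ /= fT_nat // linearZ /= !linearZ /= !ffunE.
  rewrite ru_mul ffunE -/a -[fM E μ _]fMc // Gmul_Gdel fMZ // fM1 // linearZ /= ffunE -/a.
  by move/(mulfI n0).
have [h ah] : exists h, a h != 0.
  apply: contrapT => /forallNP z.
  have : fM E (Geps A) (fM E L (δ 1%g)) = 0.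
    rewrite aE big1 ?linear0 // => x _; have /negP := z x; rewrite negbK => /eqP ->.
    by rewrite scale0r.
  rewrite -fMc // Le epsE => /eqP; rewrite scaler_eq0 invr_eq0 (negbTE n0) /=.
  have := basis_free (f1_basis E); rewrite free_cons span_nil memv0.
  by case/andP => /negbTE ->.
have Lh : fM E L (δ 1%g) = δ h.
  rewrite aE (bigD1 h) //= big1 => [|x xh].
    by rewrite addr0; have := aM h; rewrite -[RHS]mul1r => /(mulIf ah) ->; rewrite scale1r.
  pose k := (h^-1 * x)%g.
  have k1 : k != 1%g by rewrite -eq_mulVg1 eq_sym.
  (* For k different from 1, δ_{yk} δ_y = 0. On L δ_1, comultiplicativity turns this vanishing into
     a(h) a(x) = 0 at the point x = h k, so a is supported at h alone. *)
  have mk0 b : fM E (μ ∘ (rtrans k ⊗ₘ ident Γ) ∘ Δ) b = 0.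
    rewrite (dlt_sum b) linear_sum big1 //= => y _; rewrite linearZ /= !fMc // DelE.
    rewrite linearZ /= fT_nat // rtransE fM1 // linearZ /= mulE.
    have -> : (y * k == y)%g = false.
      by apply: contraNF k1 => /eqP/(congr1 (mulg y^-1)); rewrite mulKg mulVg => ->.
    by rewrite scale0r !scaler0.
  have := mk0 (fM E L (δ 1%g)).
  rewrite -fMc // -!(cmpA CP) LD !fMc // DelE !linearZ /= !fT_nat // fM1 //.
  move/eqP; rewrite scaler_eq0 (negbTE n0) /= => /eqP /(congr1 (fun b => ru A b x)).
  rewrite ru_mul linear0 !ffunE -/a aE !linear_sum /= sum_ffunE (bigD1 h) //= big1.
    rewrite !linearZ /= rtransE dltE !ffunE mulKVg eqxx /GRing.scale /= mulr1 addr0.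
    by move/eqP; rewrite mulf_eq0 (negbTE ah) /= => /eqP ->; exact: scale0r.
  move=> y yh; rewrite !linearZ /= rtransE dltE !ffunE /k.
  rewrite -{1}[x](mulKVg h) (inj_eq (mulIg _)) eq_sym (negbTE yh).
  by rewrite /GRing.scale /= mulr0.
exists h; apply: dlt_ext => // x; rewrite rtransE -[in LHS](mulg1 x) -(actE x 1%g).
have /lfunP/(_ (δ 1%g)) := @fM_equiv _ _ _ _ E _ _ SG SG L x.
by rewrite !comp_lfunE /= => ->; rewrite Lh actE.
Qed.

(* With [f_g := n^-1 ε μ (r_g ⊗ 1)], the points [r_g : 1 -> Γ] and the maps
   [f_g : Γ -> 1] exhibit Γ as a direct sum of copies of 1 over the extension. *)
Lemma Gam_split :
  \sum_h (rtrans h ∘[tenX1 CP Γ] (ident Γ ⊗ₘ (Geps A ∘ μ ∘ (rtrans h ⊗ₘ ident Γ)))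
           ∘[tenA CP Γ Γ Γ] (Δ ⊗ₘ ident Γ))
  = n *: (eqh (ten1X CP Γ) ∘ (Geps A ⊗ₘ ident Γ)).
Proof.
have SR := sub_ten HS SG SGG; have SL := sub_ten HS SGG SG.
have SG1 := sub_ten HS SG S1; have S1G := sub_ten HS S1 SG.
apply: dlt_ext2 => // x y; rewrite fMsum // fMZ // fMc // fT_nat // epsE fM1 //.
rewrite fT_Zl // linearZ /= fT_1l // scalerA divff // scale1r.
(* The h-th term contains the product δ_{xh} δ_y, which is nonzero only for h = x^-1 y. *)
rewrite (bigD1 (x^-1 * y)%g) //= big1 => [|h hx]; rewrite !fMc // fT_nat // DelE.
  rewrite fM1 // fT_Zl // !linearZ /= fT_assoc // fT_nat // !fMc // fT_nat //.
  rewrite !fM1 // rtransE mulKVg mulE eqxx scale1r epsE fT_Zr // !linearZ /=.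
  by rewrite fT_1r // rtransE mulKVg scalerA mulVf // scale1r addr0.
rewrite fM1 // fT_Zl // !linearZ /= fT_assoc // fT_nat // !fMc // fT_nat //.
rewrite !fM1 // rtransE mulE.
have -> : (x * h == y)%g = false.
  by apply: contraNF hx => /eqP <-; rewrite mulKg.
by rewrite scale0r linear0 -(scale0r (0 : fE E tone)) fT_Zr // scale0r !linear0.
Qed.

End RegularAlgebra.

(** * The Galois extension *)

Section GaloisExtension.
Variables (F : closedFieldType) (C : btc F) (S : obj C -> Prop).
Hypothesis HS : isTensorSub S.
Variables (G0 : finGroupType) (E : repEquiv S G0) (A : regAlg E).
Hypothesis char0 : [pchar F] =i pred0.
Local Notation Γ := (Gam A).
Local Notation Δ := (Gdel A).
Local Notation CP := (stcP C).
Local Notation n := (#|G0|%:R : F).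
Implicit Types X Y Z W : obj C.

Local Notation ι X := (J (ident X)).
Local Notation "a ⋆ b" := (@ot F _ a b) (at level 40, left associativity).
Local Notation "a • b" := (@oc F _ a b) (at level 45, right associativity).
Local Notation "X ◃ f" := (ident X ⊗ₘ f) (at level 40, left associativity).
Local Notation "f ▹ X" := (f ⊗ₘ ident X) (at level 40, left associativity).

Let n0 : n != 0 := order_neq0 G0 char0.

(* Locked, since rewriting with a law of ∘ would otherwise unfold them. *)
Definition delw X : mor (Γ ⊗ X) (Γ ⊗ (Γ ⊗ X)) :=
  locked (eqh (tenA CP Γ Γ X) ∘ (Δ ▹ X)).

Definition mulw X : mor (Γ ⊗ (Γ ⊗ X)) (Γ ⊗ X) :=
  locked ((Gmul A ▹ X) ∘ eqh (esym (tenA CP Γ Γ X))).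

Definition brw X Y W : mor (X ⊗ (Y ⊗ W)) (Y ⊗ (X ⊗ W)) :=
  locked (eqh (tenA CP Y X W) ∘ (br X Y ▹ W) ∘ eqh (esym (tenA CP X Y W))).

Definition whr2 X Y Z (s : mor (X ⊗ Y) Z) W : mor (X ⊗ (Y ⊗ W)) (Z ⊗ W) :=
  locked ((s ▹ W) ∘ eqh (esym (tenA CP X Y W))).

Lemma J_delw X : J (delw X) = J Δ ⋆ ι X.
Proof. by apply: J_same; rewrite /delw -lock same_eqhl. Qed.

Lemma J_mulw X : J (mulw X) = J (Gmul A) ⋆ ι X.
Proof. by apply: J_same; rewrite /mulw -lock same_eqhr. Qed.

Lemma J_brw X Y W : J (brw X Y W) = J (br X Y) ⋆ ι W.
Proof. by apply: J_same; rewrite /brw -lock same_eqhl same_eqhr. Qed.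

Lemma J_whr2 X Y Z (s : mor (X ⊗ Y) Z) W : J (whr2 s W) = J s ⋆ ι W.
Proof. by apply: J_same; rewrite /whr2 -lock same_eqhr. Qed.

Definition JE := (J_delw, J_mulw, J_brw, J_whr2, J_kid, Jc (C := C), Jt (C := C)).

Lemma delw_nat X Y (f : mor X Y) : delw Y ∘ (Γ ◃ f) = (Γ ◃ (Γ ◃ f)) ∘ delw X.
Proof. by apply: J_inj; rewrite !JE -otA -Jid; apply: xch; ty. Qed.

Lemma kid_nat X Y (f : mor X Y) : kid A Y ∘ (Γ ◃ f) = f ∘ kid A X.
Proof.
apply: J_inj; rewrite !JE -{2}(oneot (J f)).
by apply: xch; ty.
Qed.

Lemma delw_coassoc X : delw (Γ ⊗ X) ∘ delw X = (Γ ◃ delw X) ∘ delw X.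
Proof.
apply: J_inj; rewrite !JE Jid -!otA -!whr; [|ty..].
congr (_ ⋆ _); have := congr1 (@J _ _ _ _) (Del_coassoc HS A).
by rewrite !Jc Jeqh !Jt => ->; rewrite ocA o1c ?ocA //; ty.
Qed.

Lemma J_br_tenl X Y Z :
  J (br (X ⊗ Y) Z) = (J (br X Z) ⋆ ι Y) • (ι X ⋆ J (br Y Z)).
Proof. by rewrite (J_same (br_tenl X Y Z)) Jce. Qed.

Lemma J_br_tenr X Y Z :
  J (br X (Y ⊗ Z)) = (ι Y ⋆ J (br X Z)) • (J (br X Y) ⋆ ι Z).
Proof. by rewrite (J_same (br_tenr X Y Z)) Jce. Qed.

Lemma J_br_nat X Y X' Y' (s : mor X Y) (t : mor X' Y') :
  J (br Y Y') • (J s ⋆ J t) = (J t ⋆ J s) • J (br X X').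
Proof. by rewrite -!Jt -!Jc br_nat. Qed.

(** The hexagon for 1 ⊗ 1 makes this braiding idempotent, and it is invertible. *)
Lemma J_br1X X : J (br tone X) = ι X.
Proof.
have e : J (br (tone ⊗ tone) X) = J (br tone X) by rewrite (ten1X CP).
have eX : ι (tone ⊗ X) = ι X by rewrite (ten1X CP).
move: e; rewrite J_br_tenl otone oneot => e.
have bK : J (brI tone X) • J (br tone X) = ι (tone ⊗ X) by rewrite -Jc brK.
rewrite -eX -bK -{2}e ocA bK eX o1c //; ty.
Qed.

Lemma J_brX1 X : J (br X tone) = ι X.
Proof.
have e : J (br X (tone ⊗ tone)) = J (br X tone) by rewrite (ten1X CP).
have eX : ι (X ⊗ tone) = ι X by rewrite (tenX1 CP).
move: e; rewrite J_br_tenr otone oneot => e.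
have bK : J (brI X tone) • J (br X tone) = ι (X ⊗ tone) by rewrite -Jc brK.
rewrite -eX -bK -{2}e ocA bK eX o1c //; ty.
Qed.

Lemma kid_delw X : kid A (Γ ⊗ X) ∘ delw X = ident (Γ ⊗ X).
Proof.
apply: J_inj; rewrite !JE Jid -!otA -!whr; [|ty..].
congr (_ ⋆ _); have := congr1 (@J _ _ _ _) (eps_counitl HS A char0).
by rewrite !Jc Jeqh !Jt ocA o1c //; ty.
Qed.

Lemma wl_kid_delw X : (Γ ◃ kid A X) ∘ delw X = ident (Γ ⊗ X).
Proof.
apply: J_inj; rewrite !JE Jid -!otA -!whr; [|ty..].
congr (_ ⋆ _); have := congr1 (@J _ _ _ _) (eps_counitr HS A char0).
by rewrite !Jc Jeqh !Jt ocA o1c //; ty.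
Qed.

Lemma brw_delw X : brw Γ Γ X ∘ delw X = delw X.
Proof.
by apply: J_inj; rewrite !JE -!whr; [rewrite -Jc (Del_cocomm HS)|ty].
Qed.

Lemma mulw_nat X Y (f : mor X Y) : mulw Y ∘ (Γ ◃ (Γ ◃ f)) = (Γ ◃ f) ∘ mulw X.
Proof. by apply: J_inj; rewrite !JE -otA -Jid; apply: xch; ty. Qed.

Lemma delw_mulw_l X : delw X ∘ mulw X = (Γ ◃ mulw X) ∘ delw (Γ ⊗ X).
Proof.
apply: J_inj; rewrite !JE Jid -!otA -!whr; [|ty..].
congr (_ ⋆ _); have := congr1 (@J _ _ _ _) (frobenius_l HS A).
by rewrite Jce !Jc !Jt.
Qed.

Lemma delw_mulw_r X : delw X ∘ mulw X = mulw (Γ ⊗ X) ∘ (Γ ◃ delw X).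
Proof.
apply: J_inj; rewrite !JE Jid -!otA -!whr; [|ty..].
congr (_ ⋆ _); have := congr1 (@J _ _ _ _) (frobenius_r HS A).
by rewrite Jce !Jc !Jt.
Qed.

Lemma mulw_delw X : mulw X ∘ delw X = #|G0|%:R *: ident (Γ ⊗ X).
Proof.
have -> : mulw X ∘ delw X = (Gmul A ∘ Δ) ▹ X.
  by apply: J_inj; rewrite !JE -whr //; ty.
by rewrite (Gmul_Gdel HS) // tem_Zl (tem_id CP).
Qed.

(** * Strict tensor laws of K *)

Lemma kcmpE X Y Z (t : mor (Γ ⊗ Y) Z) (s : mor (Γ ⊗ X) Y) :
  kcmp t s = t ∘ ((Γ ◃ s) ∘ delw X).
Proof. by rewrite /delw -lock. Qed.

Lemma kcmpf1 X Y (s : mor (Γ ⊗ X) Y) : kcmp s (kid A X) = s.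
Proof. by rewrite kcmpE wl_kid_delw (cmpf1 CP). Qed.

(** The counit removes one leg of Δ. Thus right whiskering in K involves no braiding, and left
    whiskering ([ktem_wl]) exactly one; the computations in K are reduced to these two forms. *)
Lemma ktem_wr X Y W (s : mor (Γ ⊗ X) Y) : ktem s (kid A W) = whr2 s W.
Proof.
apply: J_inj; rewrite J_ktem J_kid J_whr2.
rewrite -!otA -!whr; [|ty..]; congr (_ ⋆ _).
rewrite -(xl (V := Γ ⊗ X) (W := tone)); [|ty..].
rewrite otone -ocA Jid otA.
rewrite (ocA (ι Γ ⋆ (ι X ⋆ J (Geps A)))) -whl; [|ty..].
rewrite -J_br_nat J_br1X o1c; [|ty].
rewrite -otA -!whr; [|ty].
have := congr1 (@J _ _ _ _) (eps_counitr HS A char0).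
by rewrite !Jc Jeqh !Jt ocA o1c; [move=> ->; rewrite -Jid oc1 //|]; ty.
Qed.

Lemma ktem_wl X Y W (t : mor (Γ ⊗ X) Y) : ktem (kid A W) t = (W ◃ t) ∘ brw Γ W X.
Proof.
apply: J_inj; rewrite J_ktem !JE.
rewrite -(xr (V := Γ ⊗ X) (W := W)); [|ty..].
rewrite -ocA; congr (_ • _).
rewrite ocA otA -Jid (xch (V' := tone) (W := (Γ ⊗ W) ⊗ X)); [|ty..]; rewrite oneot -ocA.
have -> : (J (Geps A) ⋆ ι ((Γ ⊗ W) ⊗ X)) • (J Δ ⋆ (ι W ⋆ ι X))
    = J (kid A (Γ ⊗ (W ⊗ X)) ∘ delw (W ⊗ X)).
  by rewrite !JE !Jid !otA.
by rewrite kid_delw oc1 //; ty.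
Qed.

Lemma whr2_kid X Y : whr2 (kid A X) Y = kid A (X ⊗ Y).
Proof. by apply: J_inj; rewrite !JE Jid !otA. Qed.

Lemma ktem1 X Y : ktem (kid A X) (kid A Y) = kid A (X ⊗ Y).
Proof. by rewrite ktem_wr whr2_kid. Qed.

Lemma ktem_cmp X Y X' Y' (s : mor (Γ ⊗ X) Y) (t : mor (Γ ⊗ X') Y') :
  ktem s t = kcmp (ktem s (kid A Y')) (ktem (kid A X) t).
Proof. by rewrite (ktem_kcmp HS) kcmpf1 kcmp1f. Qed.

Lemma ktemA1 X Y V W (s : mor (Γ ⊗ X) Y) :
  J (ktem (ktem s (kid A V)) (kid A W)) = J (ktem s (ktem (kid A V) (kid A W))).
Proof. by rewrite ktem1 !ktem_wr !JE otA -Jid. Qed.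

Lemma ktemA2 X Y V W (s : mor (Γ ⊗ X) Y) :
  J (ktem (ktem (kid A V) s) (kid A W)) = J (ktem (kid A V) (ktem s (kid A W))).
Proof.
by rewrite ktem_wl !ktem_wr ktem_wl !JE whr ?otA -?Jid //; ty.
Qed.

Lemma ktemA3 X Y V W (s : mor (Γ ⊗ X) Y) :
  J (ktem (ktem (kid A V) (kid A W)) s) = J (ktem (kid A V) (ktem (kid A W) s)).
Proof.
rewrite ktem1 !ktem_wl !JE whl; [|ty].
by rewrite J_br_tenr whr; [rewrite !Jid !otA -ocA|ty].
Qed.

Lemma J_ktem1s X Y (s : mor (Γ ⊗ X) Y) : J (ktem (kid A tone) s) = J s.
Proof. by rewrite ktem_wl !JE J_brX1 oneot -Jid oc1 //; ty. Qed.

Lemma J_ktems1 X Y (s : mor (Γ ⊗ X) Y) : J (ktem s (kid A tone)) = J s.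
Proof. by rewrite ktem_wr J_whr2 otone. Qed.

Definition kdata : tcData F :=
  @TcData F (obj C) (fun X Y => mor (Γ ⊗ X) Y) (kid A) (@kcmp F C S G0 E A)
    tone (@ten F C) (@ktem F C S G0 E A).

Notation "s ≈K t" := (@Arr F kdata _ _ s = @Arr F kdata _ _ t) (at level 70).

(** A word in C remembers the source only as Γ ⊗ X, from which X cannot be read off; hence the
    separate equation of sources. *)
Lemma karrP X Y X' Y' (s : mor (Γ ⊗ X) Y) (t : mor (Γ ⊗ X') Y') :
  X = X' -> J s = J t -> s ≈K t.
Proof.
move=> e st; have eY : Y = Y' by case: (congr1 (omap (@atgt F C)) st).
by subst; rewrite (J_inj st).
Qed.

Lemma karr_kcmp X Y Z X' Y' Z' (t : mor (Γ ⊗ Y) Z) (s : mor (Γ ⊗ X) Y)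
    (t' : mor (Γ ⊗ Y') Z') (s' : mor (Γ ⊗ X') Y') :
  t ≈K t' -> s ≈K s' -> kcmp t s ≈K kcmp t' s'.
Proof.
move=> et es; have eX := congr1 (@asrc F kdata) es.
have eY := congr1 (@asrc F kdata) et; have eZ := congr1 (@atgt F kdata) et.
rewrite /= in eX eY eZ; subst.
by rewrite (@arr_inj F kdata _ _ _ _ et) (@arr_inj F kdata _ _ _ _ es).
Qed.

(** By interchange each side is a composite of three factors with one nontrivial tensorand each;
    these are matched by [ktemA1], [ktemA2] and [ktemA3]. *)
Lemma ktemA X Y X' Y' X'' Y'' (s : mor (Γ ⊗ X) Y) (t : mor (Γ ⊗ X') Y')
    (u : mor (Γ ⊗ X'') Y'') : ktem (ktem s t) u ≈K ktem s (ktem t u).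
Proof.
have -> : ktem (ktem s t) u = kcmp (kcmp (ktem (ktem s (kid A Y')) (kid A Y''))
    (ktem (ktem (kid A X) t) (kid A Y'')))
    (ktem (ktem (kid A X) (kid A X')) u).
  by rewrite !(ktem_kcmp HS) !kcmpf1 !(kcmp1f HS char0).
have -> : ktem s (ktem t u) = kcmp (kcmp (ktem s (ktem (kid A Y') (kid A Y'')))
    (ktem (kid A X) (ktem t (kid A Y''))))
    (ktem (kid A X) (ktem (kid A X') u)).
  by rewrite !(ktem_kcmp HS) !kcmpf1 !(kcmp1f HS char0).
by apply: karr_kcmp; [apply: karr_kcmp|]; apply: karrP;
  rewrite ?(tenA CP) //; [exact: ktemA1 | exact: ktemA2 | exact: ktemA3].
Qed.

Lemma kdataP : isStrictTensor kdata.
Proof.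
split.
- by move=> *; exact: kcmpA.
- by move=> *; exact: kcmp1f.
- by move=> *; exact: kcmpf1.
- by move=> *; exact: kcmpPl.
- by move=> *; exact: kcmpPr.
- by move=> *; rewrite /= /ktem (temPl CP) (cmpPl CP).
- by move=> *; rewrite /= /ktem (temPr CP) (cmpPl CP).
- exact: ktem1.
- by move=> *; rewrite /= (ktem_kcmp HS).
- exact: (tenA CP).
- exact: (ten1X CP).
- exact: (tenX1 CP).
- by move=> *; exact: ktemA.
- by move=> X Y f; apply: karrP (ten1X CP X) (J_ktem1s f).
- by move=> X Y f; apply: karrP (tenX1 CP X) (J_ktems1 f).
Qed.

Definition ext : stc F := Stc kdataP.

Local Notation K := ext.
Local Notation KP := kdataP.
Local Notation "g ∙ f" := (@cmp F K _ _ _ g f) (at level 45, right associativity).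
Local Notation "X ◁ f" := (@tem F K X X _ _ (@ident F K X) f)
  (at level 40, left associativity).
Local Notation "f ▷ X" := (@tem F K _ _ X X f (@ident F K X))
  (at level 40, left associativity).
Local Notation kmor X Y := (@mor F K X Y).
Local Notation idK X := (@ident F K X).
Local Notation kJ f := (@J F K _ _ f).
Local Notation kι X := (@J F K X X (@ident F K X)).

Let cinj X Y (f g : mor (Γ ⊗ X) Y) : J f = J g -> f = g :> kmor X Y.
Proof. exact: J_inj. Qed.

(* The inclusion of C into K, and the point [k : 1 -> Z] of K defined by
   [k : Γ -> Z], tensored with X. The monodromy [mono X] is a morphism X -> Γ ⊗ X. *)
Definition emb X Y (f : mor X Y) : kmor X Y := f ∘ kid A X.

Lemma kwlE X Y Z (s : kmor X Y) : Z ◁ s = (Z ◃ s) ∘ brw Γ Z X.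
Proof. exact: ktem_wl. Qed.

Lemma kwrE X Y Z (s : kmor X Y) : s ▷ Z = whr2 s Z.
Proof. exact: ktem_wr. Qed.

Lemma ktemE X Y X' Y' (s : kmor X Y) (t : kmor X' Y') :
  @tem F K _ _ _ _ s t = (s ▷ Y') ∙ (X ◁ t).
Proof. exact: ktem_cmp. Qed.

Lemma emb_kcmp X Y Z (a : mor Y Z) (s : kmor X Y) : emb a ∙ s = a ∘ s.
Proof.
rewrite /= kcmpE /emb -(cmpA CP); congr (_ ∘ _).
by rewrite (cmpA CP) kid_nat -(cmpA CP) kid_delw // (cmpf1 CP).
Qed.

Lemma kcmp_emb X Y Z (a : mor X Y) (s : kmor Y Z) : s ∙ emb a = @cmp F C _ _ _ s (Γ ◃ a).
Proof. by rewrite /= kcmpE /emb wl_cmp -(cmpA CP) wl_kid_delw // (cmpf1 CP). Qed.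

Lemma emb_cmp X Y Z (a : mor Y Z) (b : mor X Y) : emb (a ∘ b) = emb a ∙ emb b.
Proof. by rewrite emb_kcmp /emb (cmpA CP). Qed.

Lemma emb_ident X : emb (ident X) = @ident F K X.
Proof. by rewrite /emb (cmp1f CP). Qed.

Lemma emb_wr X Y W (a : mor X Y) : emb (a ▹ W) = emb a ▷ W.
Proof.
rewrite kwrE; apply: cinj; rewrite /emb !JE whr; last by ty.
by rewrite Jid !otA.
Qed.

Lemma emb_wl X Y W (a : mor X Y) : emb (W ◃ a) = W ◁ emb a.
Proof.
rewrite kwlE; apply: cinj; rewrite /emb.
have := congr1 (@J _ _ _ _) (ktem1 W X).
by rewrite ktem_wl // !JE => <-; rewrite whl ?ocA //; ty.
Qed.

Definition jk Z (k : mor Γ Z) X : kmor X (Z ⊗ X) := k ▹ X.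

Lemma J_brw_delw X : (J (br Γ Γ) ⋆ ι X) • (J Δ ⋆ ι X) = J Δ ⋆ ι X.
Proof. by have := congr1 (@J _ _ _ _) (brw_delw X); rewrite !JE. Qed.

(** On the left k sits on the first leg of Δ and s uses the second; on the right the roles are
    exchanged. Cocommutativity identifies the two. *)
Lemma jk_nat Z (k : mor Γ Z) X Y (s : kmor X Y) :
  jk k Y ∙ s = (Z ◁ s) ∙ jk k X.
Proof.
apply: cinj; rewrite /= ktem_wl // !J_kcmp /jk !JE ocA xl; [|ty..].
rewrite -[in LHS](xr (V := Γ ⊗ X) (W := Z)); [|ty..].
rewrite -!ocA; congr (_ • _).
rewrite ocA -(otA (ι Γ) (J k)) -whr; last by ty.
rewrite J_br_nat whr; last by ty.
by rewrite -ocA J_brw_delw Jid otA.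
Qed.

Lemma emb_jk Z Z' (a : mor Z Z') (k : mor Γ Z) X :
  emb (a ▹ X) ∙ jk k X = jk (a ∘ k) X.
Proof. by rewrite emb_kcmp /jk wr_cmp. Qed.

Lemma emb_jk1 X Y (s : kmor X Y) : emb (s : mor (Γ ⊗ X) Y) ∙ jk (ident Γ) X = s.
Proof. by rewrite emb_kcmp /jk (tem_id CP) (cmpf1 CP). Qed.

(** * Monodromy with Γ and the braiding of C inside K *)

Definition mono X : kmor X (Γ ⊗ X) := br X Γ ∘ br Γ X.

Definition monow X Y : kmor (X ⊗ Y) (Γ ⊗ (X ⊗ Y)) := brw X Γ Y ∘ brw Γ X Y.

(** Sliding the monodromy strand past s also crosses it with the strand Γ of s; both strands issue
    from Δ, which absorbs that crossing. *)
Lemma mono_nat X Y (s : kmor X Y) : mono Y ∙ s = (Γ ◁ s) ∙ mono X.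
Proof.
apply: cinj; rewrite /= ktem_wl // !J_kcmp !JE.
rewrite -!ocA.
have -> : J (br Γ Y) • (ι Γ ⋆ @J F C (Γ ⊗ X) Y s) • (J Δ ⋆ ι X)
  = (@J F C (Γ ⊗ X) Y s ⋆ ι Γ) • (ι Γ ⋆ J (br Γ X)) • (J Δ ⋆ ι X).
  by rewrite ocA J_br_nat -ocA J_br_tenr -ocA J_brw_delw.
rewrite !ocA J_br_nat -!ocA; congr (_ • _).
rewrite J_br_tenl -!ocA; congr (_ • _).
rewrite whl; last by ty.
by rewrite -!ocA.
Qed.

Lemma emb_kid_mono X : emb (kid A X) ∙ mono X = @ident F K X.
Proof.
rewrite emb_kcmp; apply: cinj; rewrite /mono !JE.
by rewrite ocA -J_br_nat -ocA -J_br_nat J_brX1 J_br1X !o1c //; ty.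
Qed.

(** The first crossing of Γ with X is hidden in the left whiskering of K, so that only the returning
    one appears explicitly. *)
Lemma mono_ten X Y :
  mono (X ⊗ Y) = emb (brw X Γ Y) ∙ (X ◁ mono Y).
Proof.
rewrite emb_kcmp kwlE; apply: cinj; rewrite /mono !JE.
by rewrite J_br_tenr J_br_tenl whl ?ocA //; ty.
Qed.

Lemma emb_brw_jk X Y (k : mor Γ Γ) :
  emb (brw X Γ Y) ∙ (X ◁ jk k Y) = emb (k ▹ (X ⊗ Y)) ∙ monow X Y.
Proof.
rewrite !emb_kcmp kwlE; apply: cinj; rewrite /monow /jk !JE !ocA; congr (_ • _).
rewrite -!otA -whr; last by ty.
by rewrite J_br_nat Jid whr ?otA //; ty.
Qed.

Lemma braidL X X' Y (s : kmor X X') :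
  emb (br X' Y) ∙ (s ▷ Y) = (Y ◁ s) ∙ emb (br X Y).
Proof.
rewrite emb_kcmp kcmp_emb kwlE kwrE; apply: cinj; rewrite !JE J_br_nat.
by rewrite J_br_tenl !ocA.
Qed.

(** Left whiskering by X takes the strand Γ of t across X, and the braiding takes it back: the two
    crossings form a full monodromy. *)
Lemma braidR X Y Y' (t : kmor Y Y') :
  emb (br X Y') ∙ (X ◁ t)
  = emb (whr2 (t : mor (Γ ⊗ Y) Y') X) ∙ emb (Γ ◃ br X Y) ∙ monow X Y.
Proof.
rewrite !emb_kcmp kwlE; apply: cinj; rewrite /monow !JE.
by rewrite ocA J_br_nat J_br_tenr !ocA.
Qed.

Lemma J_monow X Y : @J F K _ _ (monow X Y) = ot (@J F K _ _ (mono X)) (kι Y).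
Proof.
rewrite -Jt; congr Some; apply: karrP => //.
by rewrite kwrE /monow /mono !JE whr //; ty.
Qed.

Lemma J_jk Z (k : mor Γ Z) X Y :
  @J F K _ _ (jk k (X ⊗ Y)) = ot (@J F K _ _ (jk k X)) (kι Y).
Proof.
rewrite -Jt; congr Some; apply: karrP => //.
by rewrite kwrE /jk !JE Jid otA.
Qed.

Lemma monow_wr X Y Z (k : mor Γ Γ) (p : kmor Z X) :
  mono X ∙ p = jk k X ∙ p -> monow X Y ∙ (p ▷ Y) = jk k (X ⊗ Y) ∙ (p ▷ Y).
Proof.
move=> e; apply: (@J_inj F K).
rewrite !Jc J_monow J_jk Jt -!whr; [|ty..].
by rewrite -!Jc e.
Qed.

(** Pulling Δ through the monodromy doubles each of its two crossings; cocommutativity ([mn])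
    regroups the four into two successive monodromies. *)
Lemma emb_delw_mono X :
  emb (delw X) ∙ mono X = (Γ ◁ mono X) ∙ mono X.
Proof.
rewrite emb_kcmp; apply: cinj; rewrite /= ktem_wl // J_kcmp /mono !JE.
have db : (J Δ ⋆ ι X) • J (br X Γ)
    = (ι Γ ⋆ J (br X Γ)) • (J (br X Γ) ⋆ ι Γ) • (ι X ⋆ J Δ).
  by rewrite -J_br_nat J_br_tenr ocA.
have da : (ι X ⋆ J Δ) • J (br Γ X)
    = (J (br Γ X) ⋆ ι Γ) • (ι Γ ⋆ J (br Γ X)) • (J Δ ⋆ ι X).
  by rewrite -J_br_nat J_br_tenl ocA.
pose m := br X Γ ∘ br Γ X.
have mn : (J m ⋆ ι Γ) • (ι Γ ⋆ J (br Γ X)) • (J Δ ⋆ ι X)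
    = (ι Γ ⋆ J (br Γ X)) • (J (br Γ Γ) ⋆ ι X) • (ι Γ ⋆ J m) • (J Δ ⋆ ι X).
  rewrite -[in LHS]J_brw_delw (ocA (ι Γ ⋆ J (br Γ X))) -J_br_tenr ocA -J_br_nat.
  by rewrite J_br_tenr !ocA.
rewrite ocA db -!ocA da.
transitivity ((ι Γ ⋆ J (br X Γ)) • (J m ⋆ ι Γ) • (ι Γ ⋆ J (br Γ X)) • (J Δ ⋆ ι X)).
  by rewrite /m Jc (@whr _ _ Γ (J (br X Γ))) ?ocA //; ty.
by rewrite mn /m !Jc !(@whl _ _ Γ (J (br X Γ))) ?ocA //; ty.
Qed.

(** Averaging as in Maschke's theorem. [sh] extends s to a map of cofree Γ-comodules, u is a
    quasi-inverse of it in C, and t is the average of u. The Frobenius relations bring s t s into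
    the form ε m (Γ ⊗ sh u sh) Δ, which equals n s because m Δ = n. *)
Lemma ext_regular X Y (s : kmor X Y) : regular s.
Proof.
pose sh : mor (Γ ⊗ X) (Γ ⊗ Y) := (Γ ◃ s) ∘ delw X.
have [u uP] := semisimple_regular sh (btc_semisimple C).
pose t : mor (Γ ⊗ Y) X := kid A X ∘ mulw X ∘ (Γ ◃ u) ∘ delw Y.
have hat : (Γ ◃ sh) ∘ delw X = delw Y ∘ sh.
  by rewrite /sh wl_cmp -(cmpA CP) -delw_coassoc // !(cmpA CP) delw_nat.
have tE : (Γ ◃ t) ∘ delw Y = mulw X ∘ (Γ ◃ u) ∘ delw Y.
  rewrite /t wl_cmp (wl_cmp _ (mulw X)) (wl_cmp _ (Γ ◃ u)).
  rewrite -!(cmpA CP) -delw_coassoc // (cmpA CP (Γ ◃ (Γ ◃ u))) -delw_nat.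
  rewrite -(cmpA CP) (cmpA CP (Γ ◃ mulw X)) -delw_mulw_l // -(cmpA CP).
  by rewrite (cmpA CP (Γ ◃ kid A X)) wl_kid_delw // (cmp1f CP).
have sE : (s : mor (Γ ⊗ X) Y) = kid A Y ∘ sh.
  by rewrite /sh (cmpA CP) kid_nat -(cmpA CP) kid_delw // (cmpf1 CP).
have sM : @cmp F C _ _ _ s (mulw X) = kid A Y ∘ mulw Y ∘ (Γ ◃ sh).
  rewrite sE /sh wl_cmp -!(cmpA CP) delw_mulw_r // (cmpA CP (mulw Y)).
  by rewrite mulw_nat -!(cmpA CP).
exists (n^-1 *: (t : kmor Y X)).
rewrite (cmpZl (T := K)) (cmpZr (T := K)).
have -> : s ∙ (t : kmor Y X) ∙ s = n *: s; last by rewrite scalerA mulVf // scale1r.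
rewrite /= !kcmpE wl_cmp -(cmpA CP) hat (cmpA CP (Γ ◃ t)) tE.
move: uP sM hat tE sE; move: sh => sh uP sM hat tE sE.
rewrite !(cmpA CP) sM -!(cmpA CP) -hat.
rewrite (cmpA CP (Γ ◃ u)) -wl_cmp (cmpA CP (Γ ◃ sh)) -wl_cmp uP hat.
rewrite (cmpA CP (mulw Y)) mulw_delw // cmpZl (cmp1f CP) !(cmpZr (T := C)) sE.
by rewrite -(cmpA CP).
Qed.

(** * Duality and cancellation in K *)

Lemma emb_same X Y X' Y' (f : mor X Y) (g : mor X' Y') :
  J f = J g -> kJ (emb f) = kJ (emb g).
Proof.
exact: (congr1 (omap (fun a : arrow C => @Arr F K _ _ (emb (amor a))))).
Qed.

Lemma emb_eqh X Y (e : X = Y) : kJ (emb (eqh e)) = kι X.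
Proof. by case: _ / e; rewrite /= emb_ident. Qed.

Lemma kJ_emb_ce X Y Y' Z (e : Y = Y') (g : mor Y' Z) (f : mor X Y) :
  kJ (emb (g ∘[e] f)) = kJ (emb g) • kJ (emb f).
Proof.
rewrite !emb_cmp !Jc emb_eqh o1c //; ty.
Qed.

Lemma J_kzigzag X :
  (kι X ⋆ kJ (emb (ev X))) • (kJ (emb (coev X)) ⋆ kι X) = kι X.
Proof.
have := emb_same (J_same (zigzag X)).
by rewrite kJ_emb_ce emb_wl emb_wr emb_ident.
Qed.

Lemma J_kzigzag_du X :
  (kJ (emb (ev X)) ⋆ kι (du X)) • (kι (du X) ⋆ kJ (emb (coev X))) = kι (du X).
Proof.
have := emb_same (J_same (zigzag_du X)).
by rewrite kJ_emb_ce emb_wl emb_wr emb_ident.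
Qed.

(** Up to a unit constraint s is a functional on Γ, and [Geps], which spans these, is the identity
    of the unit object in K. *)
Lemma end_tone (s : kmor tone tone) : exists a, s = a *: idK tone.
Proof.
have [a aE] := hom_tone HS char0 (@cmp F C _ _ _ s (eqh (esym (tenX1 CP Γ)))).
exists a; have sE : s = @cmp F C _ _ _
    (@cmp F C _ _ _ s (eqh (esym (tenX1 CP Γ)))) (eqh (tenX1 CP Γ)).
  by apply: (@J_inj F C (Γ ⊗ tone)); apply: J_same; rewrite !same_eqhr.
rewrite sE aE cmpZl; congr (_ *: _).
apply: (@J_inj F C (Γ ⊗ tone)); rewrite J_kid; apply: J_same; rewrite same_eqhr.
by apply: esym (temf1 CP _).
Qed.

Lemma kduality_inj X (r : kmor X X) : emb (ev X) ∙ (du X ◁ r) = 0 -> r = 0.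
Proof.
move=> r0; have e : (X ⊗ du X) ⊗ X = X ⊗ (du X ⊗ X) by rewrite (tenA CP).
apply: (@J_eq0 F K _ _ (tone ⊗ X) (X ⊗ tone)).
rewrite -(cmp0l (T := K) _ (@eqh F K _ _ e ∙ (emb (coev X) ▷ X))).
rewrite -(tem0r (T := K) _ _ (idK X)).
rewrite -r0 Jce !Jt Jc Jt whl; last by ty.
rewrite -ocA -otA -Jid -(@xch F K _ _ tone _ _ X); [|ty..].
by rewrite oneot ocA J_kzigzag o1c //; ty.
Qed.

(** [evb] is [ev] preceded by a braiding and a twist, both invertible; [braidL] moves p to the other
    tensor factor, where the zigzag recovers it. *)
Lemma evb_inj X (p : kmor X X) : emb (evb X) ∙ (p ▷ du X) = 0 -> p = 0.
Proof.
rewrite /evb !emb_cmp -!(cmpA KP) emb_wr => e.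
have [twi [twK _]] := tw_iso X.
have : emb (tw X) ∙ p = 0.
  apply: kduality_inj.
  have brE : emb (br X (du X)) ∙ emb (brI X (du X)) = idK (du X ⊗ X).
    by rewrite -emb_cmp brIK emb_ident.
  transitivity ((emb (ev X) ∙ (du X ◁ (emb (tw X) ∙ p)))
    ∙ emb (br X (du X)) ∙ emb (brI X (du X))).
    by rewrite brE (cmpf1 KP).
  rewrite (cmpA KP (_ ∙ _)) -(cmpA KP (emb (ev X))) -braidL.
  rewrite -(tem_cmp KP) (cmp1f KP) in e.
  by rewrite e (cmp0l (T := K)).
move/(congr1 (fun q => emb twi ∙ q)).
by rewrite (cmpA KP) -emb_cmp twK emb_ident (cmp1f KP) (cmp0r (T := K)).
Qed.

(** The target is the unit, whose endomorphisms in K are scalars: for a quasi-inverse t of q, q t is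
    a scalar a, and q t q = q with q nonzero forces a = 1. *)
Lemma evb_split X (p : kmor X X) : p != 0 ->
  exists t : kmor tone (X ⊗ du X), emb (evb X) ∙ (p ▷ du X) ∙ t = idK tone.
Proof.
move=> p0; set q := emb (evb X) ∙ (p ▷ du X).
have q0 : q != 0 by apply: contraNneq p0 => /evb_inj ->.
have [t tP] := ext_regular q; have [a aE] := end_tone (q ∙ t).
exists t; rewrite (cmpA KP) -/q aE.
move: tP; rewrite (cmpA KP) aE (cmpZl (T := K)) (cmp1f KP).
move/eqP; rewrite -subr_eq0 -{2}[q]scale1r -scalerBl scaler_eq0 (negbTE q0) orbF.
by rewrite subr_eq0 => /eqP ->; rewrite scale1r.
Qed.

(* Tensoring with a nonzero endomorphism p of X is faithful, because the
   evaluation restricted to p has a right inverse 1 -> X ⊗ X*. *)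
Lemma tem_cancel V W X (f : kmor V W) (p : kmor X X) : p != 0 ->
  @tem F K _ _ _ _ f p = 0 -> f = 0.
Proof.
move=> /evb_split[t tE] fp.
have eV : V ⊗ (X ⊗ du X) = (V ⊗ X) ⊗ du X by rewrite (tenA CP).
have eW : (W ⊗ X) ⊗ du X = W ⊗ (X ⊗ du X) by rewrite (tenA CP).
apply: (@J_eq0 F K _ _ (V ⊗ tone) (W ⊗ tone)).
pose R := (W ◁ emb (evb X)) ∙ @eqh F K _ _ eW
  ∙ ((@tem F K _ _ _ _ f p) ▷ du X) ∙ @eqh F K _ _ eV ∙ (V ◁ t).
suff : kJ f = kJ R by rewrite /R fp (tem0l (T := K)) !(cmp0l (T := K)) !(cmp0r (T := K)).
rewrite /R Jce Jce !Jt -[LHS]otone -tE !Jc Jt.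
by rewrite -[in LHS](Jid1 f) -[in LHS](J1id f) -ocA !otoc ?otA //; ty.
Qed.

(** The point over X is the point over the unit whiskered by X, so [tem_cancel] applies. This yields
    uniqueness of the grade. *)
Lemma jk_cancel X Z (k : mor Γ Z) (p : kmor X X) : p != 0 ->
  jk k X ∙ p = 0 -> k = 0.
Proof.
move=> p0 kp.
have jkX : kJ (jk k X) = kJ (jk k tone) ⋆ kι X.
  have -> : kJ (jk k X) = kJ (jk k (tone ⊗ X)) by rewrite (ten1X CP).
  exact: J_jk.
have k0 : jk k tone = 0.
  apply: (tem_cancel (f := jk k tone) p0).
  apply: (@J_eq0 F K _ _ X (Z ⊗ X)); rewrite -kp Jt Jc jkX.
  by rewrite -[in RHS](oneot (kJ p)) xl //; ty.
apply: (@J_eq0 F C _ _ (Γ ⊗ tone) (Z ⊗ tone)); rewrite -k0.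
by rewrite /jk Jt otone.
Qed.

(* For an idempotent p and [k = g^-1] this says that p is homogeneous of grade g. *)
Definition isDeg X (p : kmor X X) (k : mor Γ Γ) : Prop :=
  mono X ∙ p = jk k X ∙ p.

Lemma jkZ Z a (k : mor Γ Z) X : jk (a *: k) X = a *: jk k X.
Proof. exact: tem_Zl. Qed.

Lemma jkB Z (k k' : mor Γ Z) X : jk (k - k') X = jk k X - jk k' X.
Proof.
rewrite /jk; have := temPl CP (-1) k' k (ident X).
by rewrite !scaleN1r ![- _ + _]addrC.
Qed.

Lemma jk_sum (I : finType) Z (k : I -> mor Γ Z) X :
  jk (\sum_i k i) X = \sum_i jk (k i) X.
Proof.
rewrite /jk; apply: (big_ind2 (fun a b => a ▹ X = b)) => [|a b a' b' <- <-|//].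
  exact: tem0l.
by have := temPl CP 1 a a' (ident X); rewrite !scale1r.
Qed.

Lemma isDeg_uniq X (p : kmor X X) k k' : p != 0 ->
  isDeg p k -> isDeg p k' -> k = k'.
Proof.
move=> p0 d d'; apply/eqP; rewrite -subr_eq0; apply/eqP; apply: (jk_cancel p0).
by rewrite jkB (cmpBl (T := K)) -d d' subrr.
Qed.

(* The maps [f_g] of [Gam_split], tensored with X. *)
Definition kproj h X : mor (Γ ⊗ (Γ ⊗ X)) X :=
  n^-1 *: (kid A X ∘ mulw X ∘ (rtrans A h ▹ (Γ ⊗ X))).

Lemma kproj_sum X :
  \sum_h (jk (rtrans A h) X ∙ (kproj h X : kmor (Γ ⊗ X) X)) = idK (Γ ⊗ X).
Proof.
pose G h := rtrans A h ∘[tenX1 CP Γ]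
  (ident Γ ⊗ₘ (Geps A ∘ Gmul A ∘ (rtrans A h ⊗ₘ ident Γ)))
  ∘[tenA CP Γ Γ Γ] (Δ ⊗ₘ ident Γ).
have Gsum : \sum_h G h = n *: (eqh (ten1X CP Γ) ∘ (Geps A ⊗ₘ ident Γ)).
  exact: Gam_split.
transitivity (n^-1 *: \sum_h (whr2 (G h) X : kmor (Γ ⊗ X) (Γ ⊗ X))).
  rewrite scaler_sumr; apply: eq_bigr => h _.
  rewrite (cmpZr (T := K)); congr (_ *: _).
  apply: (@J_inj F C (Γ ⊗ (Γ ⊗ X))).
  rewrite /= J_kcmp J_whr2 /G !Jce /jk !JE.
  by rewrite !Jid -!otA -!whr -?otA -?whr //; ty.
have whrL (a : F) (f g : mor (Γ ⊗ Γ) Γ) :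
    whr2 (a *: f + g) X = a *: whr2 f X + whr2 g X.
  by rewrite /whr2 -!lock (temPl CP) (cmpPl CP).
have whr0 : whr2 (0 : mor (Γ ⊗ Γ) Γ) X = 0.
  by have := whrL (-1) 0 0; rewrite scaler0 addr0 scaleN1r addNr.
have <- : whr2 (\sum_h G h) X = \sum_h (whr2 (G h) X : kmor (Γ ⊗ X) (Γ ⊗ X)).
  apply: (big_ind2 (fun a b => whr2 a X = b)) => [|a b a' b' <- <-|//]; first exact: whr0.
  by have := whrL 1 a a'; rewrite !scale1r.
rewrite Gsum -[n *: _]addr0 whrL whr0 addr0 scalerA mulVf // scale1r.
by apply: (@J_inj F C (Γ ⊗ (Γ ⊗ X))); rewrite J_whr2 J_kid J_kid otA Jid.
Qed.

(* Expanding [mono X ∙ p] along [kproj_sum] writes it as [(L ⊗ p) Δ]; that the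
   monodromy with Γ is comultiplicative then forces L to be a coalgebra map. *)
Lemma simple_isDeg X (p : kmor X X) : p != 0 -> p ∙ p = p ->
  (forall s : kmor X X, exists a, p ∙ s ∙ p = a *: p) ->
  exists g : algAut A, isDeg p (g^-1)%g.
Proof.
move=> p0 pp ps.
(* A second p may thus be inserted after the monodromy; it gives each term of the expansion the form
   p s p, a scalar multiple of p. *)
have Tp : (Γ ◁ p) ∙ mono X ∙ p = mono X ∙ p by rewrite (cmpA KP) -mono_nat -(cmpA KP) pp.
have /choice [a aE] := fun h => ps ((kproj h X : kmor (Γ ⊗ X) X) ∙ mono X).
pose L := \sum_h a h *: rtrans A h.
have monoL : mono X ∙ p = jk L X ∙ p.
  rewrite -Tp -[mono X in LHS](cmp1f KP) -kproj_sum !(cmp_suml (T := K)).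
  rewrite (cmp_sumr (T := K)) /L jk_sum (cmp_suml (T := K)); apply: eq_bigr => h _.
  rewrite -!(cmpA KP) (cmpA KP (Γ ◁ p)) -jk_nat -(cmpA KP).
  rewrite (cmpA KP (kproj h X : kmor _ _)) aE.
  by rewrite (cmpZr (T := K)) jkZ (cmpZl (T := K)).
have pL : (Γ ◁ p) ∙ jk L X ∙ p = jk L X ∙ p by rewrite (cmpA KP) -jk_nat -(cmpA KP) pp.
have ee Z Z' (e : Z = Z') X' (s t : kmor X' Z) :
    emb (eqh e) ∙ s = emb (eqh e) ∙ t -> s = t.
  by case: _ / e; rewrite [eqh _]/= emb_ident !(cmp1f KP).
have delE X' : delw X' = eqh (tenA CP Γ Γ X') ∘ (Δ ▹ X') by rewrite /delw -lock.
have LD : Δ ∘ L = (L ⊗ₘ L) ∘ Δ.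
  apply/eqP; rewrite -subr_eq0; apply/eqP; apply: (jk_cancel p0).
  rewrite jkB (cmpBl (T := K)); apply/eqP; rewrite subr_eq0; apply/eqP.
  apply: (ee _ _ (tenA CP Γ Γ X)).
  rewrite -emb_jk !(cmpA KP) -emb_cmp -delE -(cmpA KP) -monoL.
  rewrite (cmpA KP) emb_delw_mono -(cmpA KP (Γ ◁ mono X)) -Tp.
  rewrite (cmpA KP) -(wl_cmp (T := K)) monoL (wl_cmp (T := K)) -(cmpA KP (Γ ◁ jk L X)) pL.
  rewrite (cmpA KP) -jk_nat; congr (_ ∙ p).
  apply: (@J_inj F C (Γ ⊗ X)); rewrite emb_kcmp /= J_kcmp /jk !JE Jeqh o1c; last by ty.
  by rewrite ocA xl; [rewrite -otA -whr //|..]; ty.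
have kidE X' : kid A X' = eqh (ten1X CP X') ∘ (Geps A ▹ X') by [].
have Le : Geps A ∘ L = Geps A.
  apply/eqP; rewrite -subr_eq0; apply/eqP; apply: (jk_cancel p0).
  rewrite jkB (cmpBl (T := K)); apply/eqP; rewrite subr_eq0; apply/eqP.
  apply: (ee _ _ (ten1X CP X)).
  rewrite -emb_jk -[in RHS](cmpf1 CP (Geps A)) -emb_jk !(cmpA KP) -emb_cmp -kidE.
  by rewrite -!(cmpA KP) -monoL !(cmpA KP) emb_kid_mono emb_jk1.
have [h Lh] := coalg_rtrans HS char0 LD Le.
have lA : `[< isAlgAut L >] by apply/asboolP; rewrite Lh; exact: rtrans_algAut.
by exists (AlgAut lA)^-1%g; rewrite /isDeg invgK.
Qed.

(** * Traces and the grade *)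

Definition tr X (a : kmor X X) : kmor tone tone :=
  emb (evb X) ∙ (a ▷ du X) ∙ emb (coev X).

(** b' is the transpose of b; both identities are instances of the zigzag relations. *)
Lemma dual_ex X (b : kmor X X) : exists b' : kmor (du X) (du X),
  (b ▷ du X) ∙ emb (coev X) = (X ◁ b') ∙ emb (coev X) /\
  emb (ev X) ∙ (b' ▷ X) = emb (ev X) ∙ (du X ◁ b).
Proof.
set U := du X.
have e1 : U ⊗ (X ⊗ U) = (U ⊗ X) ⊗ U by rewrite (tenA CP).
have [w wD] : exists w : kmor tone (X ⊗ U), w = (b ▷ U) ∙ emb (coev X) by eexists.
have wE : kJ w = (kJ b ⋆ kι U) • kJ (emb (coev X)) by rewrite wD Jc.
rewrite -wD.
pose b1 : kmor U U := @eqh F K _ _ (ten1X CP U) ∙ (emb (ev X) ▷ U)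
  ∙ @eqh F K _ _ e1 ∙ (U ◁ w) ∙ @eqh F K _ _ (esym (tenX1 CP U)).
have b1E : kJ b1 = (kJ (emb (ev X)) ⋆ kι U) • (kι U ⋆ kJ w).
  by rewrite /b1 !Jc !Jt !Jeqh oc1 ?o1c //; ty.
exists b1; split; apply: (@J_inj F K).
  rewrite Jc Jt b1E whl; last by ty.
  rewrite -ocA -[kι X ⋆ (kι U ⋆ _)]otA -Jid.
  rewrite -[kJ (emb (coev X))]otone (@xr F K); [|ty..].
  rewrite -(@xl F K (kJ (emb (coev X))) (kJ w) tone (X ⊗ U)); [|ty..].
  rewrite oneot ocA Jid -otA -[kJ (emb (coev X)) ⋆ _]otA -whr; last by ty.
  by rewrite J_kzigzag -Jid o1c //; ty.
rewrite !Jc !Jt b1E whr; last by ty.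
rewrite otA ocA -Jid.
have -> : kJ (emb (ev X)) • (kJ (emb (ev X)) ⋆ kι (U ⊗ X))
    = kJ (emb (ev X)) • (kι (U ⊗ X) ⋆ kJ (emb (ev X))).
  transitivity (kJ (emb (ev X)) ⋆ kJ (emb (ev X))).
    by rewrite -{1}[kJ (emb (ev X))]oneot (@xr F K) //; ty.
  by rewrite -{3}[kJ (emb (ev X))]otone (@xl F K) //; ty.
rewrite -ocA Jid !otA -whl; last by ty.
congr (_ • (_ ⋆ _)); rewrite wE whr; last by ty.
rewrite ocA otA -(Jid (C := K)) (@xr F K); [|ty..].
by rewrite -(@xl F K _ _ X tone) ?otone -?ocA ?J_kzigzag ?Jid1 //; ty.
Qed.

(* The twist is natural and tw (Γ ⊗ X) is the monodromy of Γ and X up to tw X,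
   since tw Γ = 1: this lets b cross the second evaluation. *)
Lemma evb_dual X (b : kmor X X) (b' : kmor (du X) (du X)) :
  tw Γ = ident Γ ->
  emb (ev X) ∙ (b' ▷ X) = emb (ev X) ∙ (du X ◁ b) ->
  emb (evb X) ∙ (X ◁ b') = emb (evb X) ∙ (b ▷ du X).
Proof.
set U := du X => twG bb'.
rewrite /evb !emb_cmp -!(cmpA KP) emb_wr (exch (T := K)).
rewrite (cmpA KP _ (X ◁ b')) braidR -!(cmpA KP) (cmpA KP (emb (ev X))) -emb_cmp.
have -> : ev X ∘ whr2 (b' : mor (Γ ⊗ U) U) X = ev X ∘ (U ◃ b) ∘ brw Γ U X.
  by rewrite -kwrE -kwlE -!emb_kcmp.
rewrite -emb_wr kcmp_emb !emb_kcmp kwrE.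
pose bc : mor (Γ ⊗ X) X := b.
have twb : tw X ∘ bc = bc ∘ (br X Γ ∘ br Γ X) ∘ (Γ ◃ tw X).
  by rewrite tw_nat tw_ten twG !(cmpA CP).
have -> : (tw X ▹ U) ∘ whr2 bc U = whr2 (bc ∘ (br X Γ ∘ br Γ X) ∘ (Γ ◃ tw X)) U.
  by apply: J_inj; rewrite -twb !JE whr //; ty.
apply: (@J_inj F C (Γ ⊗ (X ⊗ U))); rewrite /monow !JE -/bc.
rewrite !whr; [|ty..].
rewrite (ocA (J (br X (du X)))) J_br_nat J_br_tenl.
by rewrite !otA -!ocA.
Qed.

(** b travels round the loop: [coev] turns it into its transpose, which commutes with a on the other
    factor and returns as b through [evb]. *)
Lemma tr_cyclic X (a b : kmor X X) : tw Γ = ident Γ -> tr (a ∙ b) = tr (b ∙ a).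
Proof.
move=> twG; have [b' [b1 b2]] := dual_ex b.
rewrite /tr wr_cmp -(cmpA KP) b1 (cmpA KP (a ▷ _)) (exch (T := K)).
by rewrite !(cmpA KP) (evb_dual twG b2) wr_cmp !(cmpA KP).
Qed.

Lemma trZ X c (a : kmor X X) : tr (c *: a) = c *: tr a.
Proof. by rewrite /tr (tem_Zl (T := K)) (cmpZl (T := K)) (cmpZr (T := K)). Qed.

Lemma ident_tone_neq0 : idK tone != 0.
Proof.
apply: contraNneq (btc_one C).1 => k0; apply/eqP.
have : Geps A = 0.
  by apply: (@J_eq0 F C _ _ (Γ ⊗ tone) tone); rewrite -k0 J_kid otone.
by rewrite -(Geps_Gunt HS A) // => ->; rewrite (cmp0l (T := C)).
Qed.

(** Bend the right inverse t of the evaluation on p into an endomorphism t' of X. Then 1 = tr(p t')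
    = tr(p p t') = tr(p t' p), a multiple of tr p. *)
Lemma simple_tr_neq0 X (p : kmor X X) : tw Γ = ident Γ -> p != 0 -> p ∙ p = p ->
  (forall s : kmor X X, exists a, p ∙ s ∙ p = a *: p) -> tr p != 0.
Proof.
move=> twG p0 pp ps; have [t tP] := evb_split p0; set U := du X in t tP.
have e1 : (X ⊗ U) ⊗ X = X ⊗ (U ⊗ X) by rewrite (tenA CP).
pose t' : kmor X X := @eqh F K _ _ (tenX1 CP X) ∙ (X ◁ emb (ev X))
  ∙ @eqh F K _ _ e1 ∙ (t ▷ X) ∙ @eqh F K _ _ (esym (ten1X CP X)).
have t'E : kJ t' = (kι X ⋆ kJ (emb (ev X))) • (kJ t ⋆ kι X).
  by rewrite /t' !Jc !Jt !Jeqh oc1 ?o1c //; ty.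
have tt' : (t' ▷ U) ∙ emb (coev X) = t.
  apply: (@J_inj F K); rewrite Jc Jt t'E whr; last by ty.
  rewrite -ocA !otA -Jid.
  rewrite -[kJ (emb (coev X))]oneot (@xl F K); [|ty..].
  rewrite -(@xr F K (kJ t) (kJ (emb (coev X))) tone (X ⊗ U)); [|ty..].
  rewrite otone ocA Jid otA -whl; last by ty.
  by rewrite J_kzigzag_du -Jid o1c //; ty.
apply: contraNneq ident_tone_neq0 => trp0.
have [a aE] := ps t'.
have : tr (p ∙ t') = idK tone by rewrite -tP -tt' /tr wr_cmp !(cmpA KP).
rewrite -{1}pp -(cmpA KP) tr_cyclic // -(cmpA KP) aE trZ trp0 scaler0.
by move=> /esym/eqP.
Qed.

(** In K the scalar [tr p] is a multiple of [Geps]; [galDim] evaluates it at the unit, where [Geps]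
    is 1. *)
Lemma galDim_tr X (p : kmor X X) (gp : kcmp p p = p) a :
  tr p = a *: idK tone -> galDim (GalObj gp) = a *: ident tone.
Proof.
move=> trE.
have -> : galDim (GalObj gp)
    = @cmp F C _ _ _ (tr p) ((Gunt A ▹ tone) ∘ eqh (esym (tenX1 CP tone))).
  apply: (@J_inj F C); rewrite /galDim /= /tr emb_kcmp kcmp_emb kwrE.
  rewrite !JE !Jeqh.
  rewrite !(oc1 (X := tone)) ?o1c -?ocA ?(@xr F C) //; ty.
rewrite trE (cmpZl (T := C)); congr (_ *: _).
apply: (@J_inj F C); rewrite Jc J_kid !Jc Jeqh !Jt !otone oc1; last by ty.
by rewrite -Jc Geps_Gunt.
Qed.

Lemma scalZ (a : F) : scal (a *: ident (tone : obj C)) = a.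
Proof.
have fr : free [tuple ident (tone : obj C)] by rewrite seq1_free (btc_one C).1.
rewrite /scal linearZ /= -[X in _ * coord _ _ X]/([tuple ident (tone : obj C)]`_(@ord0 0)).
by rewrite (coord_free ord0 ord0 fr) eqxx mulr1.
Qed.

(** On p the inverse monodromy acts as g on the strand Γ. Once g is pulled out, the loop of X closes
    up to [tr p], which the normalization by the dimension cancels. *)
Lemma galDeg_isDeg (X : galObj A) (g : algAut A) :
  tw Γ = ident Γ -> isDeg (gid X) (g^-1)%g -> tr (gid X) != 0 -> galDeg X = g.
Proof.
case: X => X p pP twG dg p0; have [a aE] := end_tone (tr p).
have a0 : a != 0 by apply: contraNneq p0 => a0; rewrite /= aE a0 scale0r.
rewrite /galDeg (galDim_tr pP aE) scalZ /=.
have gg : (g : mor Γ Γ) ∘ (g^-1)%g = ident Γ by exact: (algAut_invP g).2.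
set w := (X in _ *: X).
suff -> : w = a *: (g : mor Γ Γ) by rewrite scalerA mulVf // scale1r.
have -> : a *: (g : mor Γ Γ) = eqh (tenX1 CP Γ)
      ∘ kcmp (jk g tone : mor (Γ ⊗ tone) (Γ ⊗ tone)) (tr p)
      ∘ eqh (esym (tenX1 CP Γ)).
  rewrite -[kcmp _ _]/(jk g tone ∙ tr p) aE (cmpZr (T := K)) (cmpf1 KP).
  rewrite cmpZl cmpZr; congr (_ *: _).
  by apply: (@J_inj F C); rewrite !Jc !Jeqh /jk Jt otone oc1 ?o1c //; ty.
(* The hypothesis says that the monodromy m acts on Q as g^-1; since m commutes with g, its inverse
   acts as g. *)
have gp : (brI Γ X ∘ brI X Γ) ∘ (Γ ◃ p) ∘ delw X = (g ▹ X) ∘ (Γ ◃ p) ∘ delw X.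
  set Q := (Γ ◃ p) ∘ delw X.
  pose m := br X Γ ∘ br Γ X.
  have mQ : m ∘ Q = (((g^-1)%g : mor Γ Γ) ▹ X) ∘ Q.
    by move: dg; rewrite /isDeg /= !kcmpE.
  have mg : m ∘ (g ▹ X) = (g ▹ X) ∘ m.
    by rewrite /m -(cmpA CP) br_nat !(cmpA CP) br_nat.
  have Nm : (brI Γ X ∘ brI X Γ) ∘ m = ident _.
    by rewrite /m (cmpA CP) -(cmpA CP (brI Γ X)) brK (cmpf1 CP) brK.
  have {1}<- : m ∘ (g ▹ X) ∘ Q = Q.
    by rewrite (cmpA CP) mg -(cmpA CP) mQ (cmpA CP) -wr_cmp gg (tem_id CP) (cmp1f CP).
  by rewrite (cmpA CP _ m) Nm (cmp1f CP).
rewrite /w; apply: (@J_inj F C); rewrite [RHS]Jc [J (_ ∘ eqh _)]Jc J_kcmp /tr.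
rewrite emb_kcmp kcmp_emb kwrE /jk.
move: (evb X) (coev X) (brI Γ X ∘ brI X Γ) gp => v co N gp.
have gpJ := congr1 (@J _ _ _ _) gp.
move: gpJ; rewrite !JE !Jeqh => gpJ.
rewrite !(oc1 (X := Γ)); [|ty..].
do !(rewrite o1c; last by ty).
rewrite -(@xl F C (J Δ) (J co) Γ (X ⊗ du X)); [|ty..].
rewrite Jid -[J Δ ⋆ _]otA (ocA ((ι Γ ⋆ J p) ⋆ _)) -whr; last by ty.
rewrite (ocA (J N ⋆ _)) -whr; last by ty.
rewrite gpJ !whr; [|ty..]; rewrite !whl; [|ty..].
rewrite -!ocA !otA -(Jid (C := C)) ocA (@xr F C); [|ty..].
rewrite -(@xl F C (J g) (J v) Γ tone); [|ty..].
rewrite -!ocA; congr (_ • (_ • (_ • _))).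
rewrite -[in RHS]otA -Jid -(@xch F C (J Δ) (J co) Γ (Γ ⊗ Γ) tone (X ⊗ du X)); [|ty..].
by rewrite Jid.
Qed.

(** The order of the composite is that of (g h)^-1 = h^-1 g^-1. *)
Lemma isDeg_ten X Y (p : kmor X X) (q : kmor Y Y) k k' :
  isDeg p k -> isDeg q k' -> isDeg (@tem F K _ _ _ _ p q) (k' ∘ k).
Proof.
move=> dp dq; rewrite /isDeg ktemE mono_ten (exch (T := K)) -!(cmpA KP).
rewrite (cmpA KP (X ◁ mono Y)) -(wl_cmp (T := K)) dq (wl_cmp (T := K)) -(cmpA KP).
rewrite (cmpA KP (emb _)) emb_brw_jk -!(cmpA KP) -(exch (T := K)).
rewrite (cmpA KP (monow _ _)) (monow_wr _ dp) -emb_jk.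
by rewrite -!(cmpA KP).
Qed.

(** The monodromy left over by [braidR] is, on p, the point k; feeding this point into the strand Γ
    of t gives [kact k t]. *)
Lemma braid_isDeg X Y Y' (p : kmor X X) k (t : kmor Y Y') : isDeg p k ->
  emb (br X Y') ∙ @tem F K _ _ _ _ p t
  = @tem F K _ _ _ _ (kact k t : kmor Y Y') p ∙ emb (br X Y).
Proof.
move=> dp; rewrite (ktemE p t) (ktemE (kact k t : kmor Y Y') p) (exch (T := K)).
rewrite (cmpA KP) braidR -!(cmpA KP) (monow_wr _ dp) (cmpA KP (emb (Γ ◃ _))) emb_wl -jk_nat -!(cmpA KP).
rewrite braidL !(cmpA KP); congr ((_ ∙ _) ∙ _); rewrite emb_kcmp kwrE.
by apply: (@J_inj F C (Γ ⊗ (Y ⊗ X))); rewrite /jk !JE Jid -!otA -whr //; ty.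
Qed.

Lemma braid_nat_isDeg X X' Y Y' (p : kmor X X) k (s : kmor X X') (t : kmor Y Y') :
  isDeg p k -> s ∙ p = s ->
  emb (br X' Y') ∙ @tem F K _ _ _ _ s t
  = @tem F K _ _ _ _ (kact k t : kmor Y Y') s ∙ emb (br X Y).
Proof.
move=> dp sp.
have -> : @tem F K _ _ _ _ s t = (s ▷ Y') ∙ @tem F K _ _ _ _ p t.
  by rewrite -(tem_cmp KP) sp (cmp1f KP).
rewrite (cmpA KP) braidL -(cmpA KP) (braid_isDeg _ dp) (cmpA KP).
by rewrite -(tem_cmp KP) sp (cmp1f KP).
Qed.

Lemma isDeg_retract X Y (p : kmor X X) k (i : kmor Y X) (r : kmor X Y) :
  isDeg p k -> p ∙ i = i -> isDeg (r ∙ i) k.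
Proof.
move=> dp pi; rewrite /isDeg (cmpA KP) mono_nat (cmpA KP) jk_nat -!(cmpA KP) -pi.
by rewrite (cmpA KP (mono X)) dp -(cmpA KP).
Qed.

Lemma isDeg_sum (I : finType) X (p : I -> kmor X X) k :
  (forall i, isDeg (p i) k) -> isDeg (\sum_i p i) k.
Proof.
by move=> d; rewrite /isDeg !(cmp_sumr (T := K)); apply: eq_bigr => i _; exact: d.
Qed.

Lemma isDeg_tone : isDeg (idK tone) (ident Γ).
Proof.
rewrite /isDeg !(cmpf1 KP) /mono /jk; apply: (@J_inj F C (Γ ⊗ tone)).
by rewrite Jc J_br1X J_brX1 Jid1 Jt otone.
Qed.

(** * The action of Aut(Γ) on K *)

Section Action.
Variable g : algAut A.
Local Notation act := (@kact F C S G0 E A _ _ g).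

Lemma kact_cmp X Y Z (t : kmor Y Z) (s : kmor X Y) :
  act (t ∙ s) = @cmp F K _ _ _ (act t) (act s).
Proof. exact: kact_algAut. Qed.

Lemma kact_emb X Y (a : mor X Y) : act (emb a) = emb a.
Proof.
have [_ gu _] := algAutP g.
apply: (@J_inj F C (Γ ⊗ X)); rewrite J_kact /emb !JE -ocA -whr; last by ty.
by rewrite -Jc Geps_unit_comp.
Qed.

Lemma kact_jk Z (k : mor Γ Z) X : act (jk k X) = jk (k ∘ g) X.
Proof. by rewrite /kact /jk wr_cmp. Qed.

Lemma kact_tem X Y X' Y' (s : kmor X Y) (t : kmor X' Y') :
  act (@tem F K _ _ _ _ s t) = @tem F K _ _ _ _ (act s) (act t).
Proof.
rewrite (ktemE s t) (ktemE (act s : kmor X Y) (act t)) kact_cmp.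
congr (_ ∙ _); apply: (@J_inj F C (Γ ⊗ _)).
  by rewrite J_kact !kwrE !JE whr ?Jid ?otA //; ty.
rewrite J_kact !kwlE !JE whl; last by ty.
rewrite -!ocA; congr (_ • _); rewrite -otA -whr; last by ty.
by rewrite -J_br_nat Jid -otA -whr //; ty.
Qed.

(** The action multiplies the monodromy by g on the strand Γ and sends the point k to k g;
    cancelling g leaves a conjugate of k. *)
Lemma isDeg_act X (p : kmor X X) k :
  isDeg p k -> isDeg (act p : kmor X X) ((g^-1)%g ∘ k ∘ g).
Proof.
move=> dp; have [hg gh] := algAut_invP g; rewrite /isDeg.
have gm : act (mono X) = emb (g ▹ X) ∙ mono X.
  by rewrite emb_kcmp /kact /mono -(cmpA CP) br_nat !(cmpA CP) br_nat.
have := congr1 (@kact _ _ _ _ _ _ _ _ g) dp; rewrite !kact_cmp gm kact_jk.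
move/(congr1 (fun s => emb ((g^-1)%g ▹ X) ∙ s)).
rewrite !(cmpA KP) -!emb_cmp -!wr_cmp hg (tem_id CP) emb_ident (cmp1f KP) => ->.
by rewrite emb_jk.
Qed.

End Action.

Lemma kact1 X Y (s : kmor X Y) : kact (ident Γ) s = s :> kmor X Y.
Proof. by rewrite /kact (tem_id CP) (cmpf1 CP). Qed.

(** Precomposition reverses products, which is why γ_g has to be [kact] of g^-1. *)
Lemma kactM X Y (s : kmor X Y) (g h : mor Γ Γ) :
  kact (h ∘ g) s = kact g (kact h s) :> kmor X Y.
Proof. by rewrite /kact wr_cmp (cmpA CP). Qed.

(** * The idempotent completion *)

Local Notation D := (galois char0 HS A).
Local Notation dmor X Y := (@mor F D X Y).
Local Notation "g ⊚ f" := (@cmp F D _ _ _ g f) (at level 45, right associativity).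
Local Notation "s ⊠ t" := (@tem F K _ _ _ _ s t) (at level 40, left associativity).
Implicit Types P Q R : obj D.

Definition kval P Q (s : dmor P Q) : kmor (gob P) (gob Q) := vsval s.

Definition kgid P : kmor (gob P) (gob P) := gid P.

Lemma kgid_idem P : kgid P ∙ kgid P = kgid P.
Proof. exact: gidP. Qed.

Lemma kval_l P Q (s : dmor P Q) : kgid Q ∙ kval s = kval s.
Proof. exact: galSpace_cmpl. Qed.

Lemma kval_r P Q (s : dmor P Q) : kval s ∙ kgid P = kval s.
Proof. exact: galSpace_cmpr. Qed.

Lemma kval_inj P Q (s t : dmor P Q) : kval s = kval t -> s = t.
Proof. exact: subvs_inj. Qed.

Lemma kvalK P Q (u : kmor (gob P) (gob Q)) (uD : u \in galSpace P Q) :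
  kval (Subvs uD : dmor P Q) = u.
Proof. by []. Qed.

Lemma kval_cmp P Q R (t : dmor Q R) (s : dmor P Q) :
  kval (t ⊚ s) = kval t ∙ kval s.
Proof. by []. Qed.

Lemma kval_tem P Q P' Q' (s : dmor P Q) (t : dmor P' Q') :
  kval (@tem F D _ _ _ _ s t) = kval s ⊠ kval t.
Proof. by []. Qed.

Lemma galObj_eq P Q : kJ (kgid P) = kJ (kgid Q) -> P = Q.
Proof.
case: P Q => [X p pP] [Y q qP] /J_eq; rewrite /kgid /= => e.
have eX := congr1 (@asrc F K) e; rewrite /= in eX; subst.
have pq := arr_inj e; rewrite /= in pq; subst.
by rewrite (Prop_irrelevance pP qP).
Qed.

Lemma galarr_eq P Q P' Q' (s : dmor P Q) (t : dmor P' Q') : P = P' -> Q = Q' ->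
  kJ (kval s) = kJ (kval t) -> s ≈ t.
Proof. by move=> eP eQ; subst => /J_inj/kval_inj ->. Qed.

Lemma kJ_kval_cast P Q Q' R (e : Q = Q') (t : dmor Q' R) (s : dmor P Q) :
  kJ (kval (@cmp F D _ _ _ t (@cmp F D _ _ _ (@eqh F D _ _ e) s)))
  = kJ (kval t) • kJ (kval s).
Proof. by subst; rewrite -Jc; congr Some; rewrite !kval_cmp kval_l. Qed.

Lemma galTenA P Q R :
  galTen HS (galTen HS P Q) R = galTen HS P (galTen HS Q R).
Proof. by apply: galObj_eq; rewrite !Jt otA. Qed.

Lemma galTen1 P : galTen HS (galOne char0 HS A) P = P.
Proof. by apply: galObj_eq; rewrite Jt oneot. Qed.

Lemma galOneT P : galTen HS P (galOne char0 HS A) = P.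
Proof. by apply: galObj_eq; rewrite Jt otone. Qed.

Lemma galois_strict : isStrictTensor D.
Proof.
split.
- by move=> *; apply: kval_inj; exact: (cmpA KP).
- by move=> P Q s; apply: kval_inj; exact: kval_l.
- by move=> P Q s; apply: kval_inj; exact: kval_r.
- by move=> *; apply: kval_inj; exact: (cmpPl KP).
- by move=> *; apply: kval_inj; exact: (cmpPr KP).
- by move=> *; apply: kval_inj; exact: (temPl KP).
- by move=> *; apply: kval_inj; exact: (temPr KP).
- by move=> *; apply: kval_inj.
- by move=> *; apply: kval_inj; exact: (tem_cmp KP).
- exact: galTenA.
- exact: galTen1.
- exact: galOneT.
- move=> *; apply: galarr_eq; [exact: galTenA|exact: galTenA|].
  by rewrite !kval_tem !Jt otA.
- move=> P Q s; apply: galarr_eq; [exact: galTen1|exact: galTen1|].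
  by rewrite kval_tem Jt oneot.
- move=> P Q s; apply: galarr_eq; [exact: galOneT|exact: galOneT|].
  by rewrite kval_tem Jt otone.
Qed.

Definition galStc : stc F := Stc galois_strict.

Lemma gal_regular P Q (s : dmor P Q) : regular (T := galStc) s.
Proof.
have [u uP] := ext_regular (kval s).
have uD : kgid P ∙ u ∙ kgid Q \in galSpace Q P.
  apply/galSpaceP; rewrite -[kcmp _ _]/(kgid P ∙ (kgid P ∙ u ∙ kgid Q) ∙ kgid Q).
  by rewrite -!(cmpA KP) kgid_idem !(cmpA KP) kgid_idem.
exists (Subvs uD); apply: kval_inj; rewrite !kval_cmp kvalK.
by rewrite -!(cmpA KP) kval_l !(cmpA KP) kval_r -(cmpA KP) uP.
Qed.

(** e is both inclusion and projection for the object (X, e). *)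
Lemma gal_idem_split P (e : dmor P P) : e ⊚ e = e ->
  exists Q (i : dmor Q P) (r : dmor P Q), r ⊚ i = @ident F D Q /\ i ⊚ r = e.
Proof.
move=> ee; have kee : kcmp (vsval e) (vsval e) = vsval e.
  exact: (congr1 (@kval P P) ee).
pose Q : obj D := GalObj kee.
have iD : vsval e \in galSpace Q P.
  by apply/galSpaceP; rewrite /= kee; exact: kval_l.
have rD : vsval e \in galSpace P Q.
  by apply/galSpaceP; rewrite /= -[X in kcmp _ X]/(kval e ∙ kgid P) kval_r kee.
exists Q, (Subvs iD), (Subvs rD); split; apply: kval_inj; rewrite kval_cmp !kvalK.
  exact: kee.
exact: kee.
Qed.

Lemma gal_dec P : exists n, exists Q : 'I_n -> obj D,
  (forall k, simple (Q k)) /\ isDsum Q P.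
Proof.
apply: (semisimple_dec (T := galStc)) => [P' Q f|P' e ee]; first exact: gal_regular.
exact: gal_idem_split.
Qed.

Lemma nonzeroE P : nonzero P <-> kgid P != 0.
Proof.
split; apply: contra => /eqP e; apply/eqP; last by rewrite /kgid -[gid P]/(kval (@ident F D P)) e.
by apply: kval_inj.
Qed.

Lemma simple_corner P : simple P ->
  forall s : kmor (gob P) (gob P), exists a, kgid P ∙ s ∙ kgid P = a *: kgid P.
Proof.
move=> [_ sP] s; have sD : kgid P ∙ s ∙ kgid P \in galSpace P P.
  apply/galSpaceP; rewrite -[kcmp _ _]/(kgid P ∙ (kgid P ∙ s ∙ kgid P) ∙ kgid P).
  by rewrite -!(cmpA KP) kgid_idem !(cmpA KP) kgid_idem.
have [a aE] := sP (Subvs sD); exists a.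
by have := congr1 (@kval P P) aE; rewrite kvalK /kval linearZ.
Qed.

Definition gdeg P (g : algAut A) : Prop := isDeg (kgid P) (g^-1)%g.

Lemma gdeg_uniq P g h : nonzero P -> gdeg P g -> gdeg P h -> g = h.
Proof.
move=> /nonzeroE P0 dg dh; apply: invg_inj; apply: val_inj.
exact: (isDeg_uniq P0 dg dh).
Qed.

Lemma gdeg_retract P Q (i : dmor Q P) (r : dmor P Q) g :
  r ⊚ i = @ident F D Q -> gdeg P g -> gdeg Q g.
Proof.
move=> ri d; rewrite /gdeg.
have -> : kgid Q = kval r ∙ kval i by rewrite -kval_cmp ri.
by apply: isDeg_retract d _; exact: kval_l.
Qed.

Lemma gdeg_dsum n (Q : 'I_n -> obj D) P g :
  (forall k, gdeg (Q k) g) -> isDsum Q P -> gdeg P g.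
Proof.
move=> d [i [r [_ _ sP]]]; rewrite /gdeg.
have -> : kgid P = \sum_k (kval (i k) ∙ kval (r k)).
  rewrite /kgid -[gid P]/(kval (@ident F D P)) -sP /kval linear_sum.
  by apply: eq_bigr.
by apply: isDeg_sum => k; apply: isDeg_retract (d k) _; exact: kval_l.
Qed.

Section Twist.
Hypothesis twG : tw Γ = ident Γ.

Lemma simple_gdeg P : simple P -> exists2 g, gdeg P g & galDeg P = g.
Proof.
move=> sP; have P0 := (nonzeroE P).1 sP.1.
have [g dg] := simple_isDeg P0 (kgid_idem P) (simple_corner sP).
exists g => //; apply: galDeg_isDeg => //.
exact: (simple_tr_neq0 twG P0 (kgid_idem P) (simple_corner sP)).
Qed.

(** This replaces the trace formula by [gdeg]. For the converse, each simple summand has a grade of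
    its own, and being a retract of P it also has grade g; uniqueness identifies them. *)
Lemma homogP P g : homogOf P g <-> nonzero P /\ gdeg P g.
Proof.
split=> [[P0 [n [Q [sQ dQ]]]]|[P0 dP]]; split=> //.
  apply: gdeg_dsum dQ => k; have [sk gk] := sQ k.
  have [g' dg' eg'] := simple_gdeg sk.
  by rewrite (val_inj (etrans (esym gk) eg') : g = g').
have [n [Q [sQ dQ]]] := gal_dec P; exists n, Q; split=> // k; split=> //.
have [i [r [ri _ _]]] := dQ.
have [g' dg' ->] := simple_gdeg (sQ k).
by rewrite (gdeg_uniq (sQ k).1 dg' (gdeg_retract (ri k) dP)).
Qed.

Lemma gdeg_ten P Q g h :
  gdeg P g -> gdeg Q h -> gdeg (galTen HS P Q) (g * h)%g.
Proof. by move=> dg dh; rewrite /gdeg invMg; exact: (isDeg_ten dg dh). Qed.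

Lemma nonzero_ten P Q : nonzero P -> nonzero Q -> nonzero (galTen HS P Q : obj D).
Proof.
move=> /nonzeroE P0 /nonzeroE Q0; apply/nonzeroE; apply: contraNneq P0.
by move=> e; apply/eqP; exact: tem_cancel Q0 e.
Qed.

Lemma gdeg_act P g h : gdeg P h -> gdeg (galActO HS g P) (g * h * g^-1)%g.
Proof.
move=> d; rewrite /gdeg !invMg invgK.
by have := isDeg_act (g^-1)%g d; rewrite invgK.
Qed.

(** * The crossed G-category *)

Let W := galoisCrossed char0 HS A.
Local Notation actO := (galActO HS).

Lemma kgid_act g P : kgid (actO g P) = kact (g^-1)%g (kgid P).
Proof. by []. Qed.

Lemma kval_act g P Q (s : dmor P Q) : kval (Defs.actM W g s) = kact (g^-1)%g (kval s).
Proof. by []. Qed.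

Lemma actO_tone g : actO g (galOne char0 HS A) = galOne char0 HS A.
Proof.
apply: galObj_eq; rewrite kgid_act -[kgid _]/(idK tone) -emb_ident kact_emb //.
Qed.

Lemma actO_tenE g P Q : actO g (galTen HS P Q) = galTen HS (actO g P) (actO g Q).
Proof. by apply: galObj_eq; rewrite kgid_act kact_tem. Qed.

Lemma actO_1E P : actO 1%g P = P.
Proof. by apply: galObj_eq; rewrite kgid_act invg1 kact1. Qed.

Lemma actO_ME g h P : actO (g * h)%g P = actO g (actO h P).
Proof. by apply: galObj_eq; rewrite !kgid_act invMg kactM. Qed.

Lemma homogE (P : {P | homog P}) :
  nonzero (sval P) /\ gdeg (sval P) (galGrade P).
Proof. by apply/homogP; rewrite /galGrade; case: (cid _). Qed.

Lemma gradeP (P : {P | homog P}) g : gdeg (sval P) g -> galGrade P = g.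
Proof. by have [P0 d] := homogE P; apply: gdeg_uniq. Qed.

Lemma galois_crossed : isCrossed W.
Proof.
split.
- exact: galois_strict.
- exists 1%g; apply/homogP; split; first by apply/nonzeroE; exact: ident_tone_neq0.
  by rewrite /gdeg invg1; exact: isDeg_tone.
- move=> P Q [g /homogP[P0 dg]] [h /homogP[Q0 dh]].
  exists (g * h)%g; apply/homogP; split; first exact: nonzero_ten.
  exact: gdeg_ten.
- move=> P Q [f [i [fi if_]]]; apply: gradeP; have [Q0 dQ] := homogE Q.
  exact: gdeg_retract fi dQ.
- by move=> g P Q a s t; apply: kval_inj; exact: cmpPl CP _ _ _ _ _ _ _.
- by move=> g P; apply: kval_inj.
- by move=> g P Q R t s; apply: kval_inj; rewrite kval_act !kval_cmp kact_cmp.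
- exact: actO_tone.
- exact: actO_tenE.
- move=> g P Q P' Q' s t; apply: galarr_eq; [exact: actO_tenE|exact: actO_tenE|].
  by rewrite kval_act !kval_tem kact_tem !kval_act.
- exact: actO_1E.
- move=> P Q s; apply: galarr_eq; [exact: actO_1E|exact: actO_1E|].
  by rewrite kval_act invg1 kact1.
- exact: actO_ME.
- move=> g h P Q s; apply: galarr_eq; [exact: actO_ME|exact: actO_ME|].
  by rewrite !kval_act invMg kactM.
- move=> P Q R RE; apply: gradeP; rewrite RE.
  by apply: gdeg_ten; [exact: (homogE P).2 | exact: (homogE Q).2].
- move=> g P [h /homogP[/nonzeroE P0 d]]; exists (g * h * g^-1)%g; apply/homogP.
  split; last exact: gdeg_act.
  apply/nonzeroE; apply: contra P0 => /eqP e; apply/eqP.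
  have := congr1 (fun s : kmor _ _ => kact g s : kmor (gob P) (gob P)) e.
  rewrite kgid_act -kactM; have [-> _] := algAut_invP g; rewrite kact1 => ->.
  by rewrite /kact cmp0l.
- by move=> g P Q QE; apply: gradeP; rewrite QE; apply: gdeg_act; exact: (homogE P).2.
move=> _ P; have [n [Q [sQ dQ]]] := gal_dec P; exists n, Q; split=> // k.
have [g dg _] := simple_gdeg (sQ k); exists g; apply/homogP; split=> //.
by have [] := sQ k.
Qed.

(** * The crossed braiding *)

Lemma kJ_br_tenr X Y Z : kJ (emb (br X (Y ⊗ Z)))
  = (kι Y ⋆ kJ (emb (br X Z))) • (kJ (emb (br X Y)) ⋆ kι Z).
Proof.
by rewrite (emb_same (J_same (br_tenr X Y Z))) kJ_emb_ce emb_wl emb_wr.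
Qed.

Lemma kJ_br_tenl X Y Z : kJ (emb (br (X ⊗ Y) Z))
  = (kJ (emb (br X Z)) ⋆ kι Y) • (kι X ⋆ kJ (emb (br Y Z))).
Proof.
by rewrite (emb_same (J_same (br_tenl X Y Z))) kJ_emb_ce emb_wl emb_wr.
Qed.

(** Compression at the source is natural for every P. For homogeneous P it agrees with compression
    at the target by γ_g(q) ⊗ p ([kbraidE]), which puts it into the Hom-space required. *)
Definition kbraid P Q : kmor (gob P ⊗ gob Q) (gob Q ⊗ gob P) :=
  emb (br (gob P) (gob Q)) ∙ (kgid P ⊠ kgid Q).

Lemma kten_idem P Q : (kgid P ⊠ kgid Q) ∙ (kgid P ⊠ kgid Q) = kgid P ⊠ kgid Q.
Proof. by rewrite -(tem_cmp KP) !kgid_idem. Qed.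

Lemma kbraidE P Q g : gdeg P g ->
  kbraid P Q = (kgid (actO g Q) ⊠ kgid P) ∙ emb (br (gob P) (gob Q)).
Proof. by move=> d; exact: braid_isDeg. Qed.

Lemma kbraid_r P Q : kbraid P Q ∙ (kgid P ⊠ kgid Q) = kbraid P Q.
Proof. by rewrite /kbraid -(cmpA KP) kten_idem. Qed.

Lemma kbraid_l P Q g : gdeg P g ->
  (kgid (actO g Q) ⊠ kgid P) ∙ kbraid P Q = kbraid P Q.
Proof. by move=> d; rewrite (kbraidE _ d) (cmpA KP) kten_idem. Qed.

Lemma gbraid_subproof (P : {P | homog P}) Q :
  kbraid (sval P) Q \in galSpace (galTen HS (sval P) Q)
    (galTen HS (actO (galGrade P) Q) (sval P)).
Proof.
have [_ d] := homogE P; apply/galSpaceP.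
rewrite -[kcmp _ _]/((kgid (actO (galGrade P) Q) ⊠ kgid (sval P)) ∙ kbraid (sval P) Q
  ∙ (kgid (sval P) ⊠ kgid Q)).
by rewrite kbraid_r kbraid_l.
Qed.

Definition gbraid (P : {P | homog P}) Q :
    dmor (galTen HS (sval P) Q) (galTen HS (actO (galGrade P) Q) (sval P)) :=
  Subvs (gbraid_subproof P Q).

Lemma kval_gbraid (P : {P | homog P}) Q : kval (gbraid P Q) = kbraid (sval P) Q.
Proof. by []. Qed.

Lemma gbraid_iso (P : {P | homog P}) Q : isIso (gbraid P Q).
Proof.
have [_ d] := homogE P; set P' := sval P in d *; set g := galGrade P in d *.
pose b' := emb (brI (gob P') (gob Q)) ∙ (kgid (actO g Q) ⊠ kgid P').
have b'E : b' = (kgid P' ⊠ kgid Q) ∙ emb (brI (gob P') (gob Q)).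
  have brIE : emb (br (gob P') (gob Q)) ∙ emb (brI (gob P') (gob Q)) = idK _.
    by rewrite -emb_cmp brIK emb_ident.
  have brE : emb (brI (gob P') (gob Q)) ∙ emb (br (gob P') (gob Q)) = idK _.
    by rewrite -emb_cmp brK emb_ident.
  transitivity (b' ∙ emb (br (gob P') (gob Q)) ∙ emb (brI (gob P') (gob Q))).
    by rewrite brIE (cmpf1 KP).
  rewrite /b' (cmpA KP _ (emb (br _ _))) -(cmpA KP (emb (brI _ _))).
  by rewrite -(kbraidE Q d) /kbraid (cmpA KP (emb (brI _ _))) brE (cmp1f KP).
have bD : b' \in galSpace (galTen HS (actO g Q) P') (galTen HS P' Q).
  apply/galSpaceP; rewrite -[kcmp _ _]/((kgid P' ⊠ kgid Q) ∙ b' ∙ (kgid (actO g Q) ⊠ kgid P')).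
  rewrite /b' -(cmpA KP (emb _)) kten_idem -/b' b'E (cmpA KP).
  by rewrite kten_idem.
exists (Subvs bD); split; apply: kval_inj; rewrite kval_cmp !kvalK -/P'.
  rewrite b'E /kbraid -!(cmpA KP) (cmpA KP (emb (brI _ _))) -emb_cmp brK.
  by rewrite emb_ident (cmp1f KP) kten_idem.
rewrite (kbraidE Q d) -!(cmpA KP) (cmpA KP (emb _)) -emb_cmp brIK.
by rewrite emb_ident (cmp1f KP) kten_idem.
Qed.

Lemma gbraid_nat (P P' : {P | homog P}) Q Q' (s : dmor (sval P) (sval P'))
    (t : dmor Q Q') : galGrade P = galGrade P' ->
  gbraid P' Q' ⊚ @tem F D _ _ _ _ s t
  ≈ @tem F D _ _ _ _ (Defs.actM W (galGrade P) t) s ⊚ gbraid P Q.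
Proof.
move=> gPP'; have [_ d] := homogE P.
apply: galarr_eq => //; first by rewrite /= gPP'.
congr (kJ _); rewrite !kval_cmp !kval_tem !kval_gbraid kval_act /kbraid.
rewrite -(cmpA KP) -(tem_cmp KP) !kval_l (cmpA KP).
rewrite -(braid_nat_isDeg (kval t) d (kval_r s)) -(cmpA KP) -(tem_cmp KP).
by rewrite !kval_r.
Qed.

(** The action fixes morphisms coming from C, in particular the braiding, and moves only the
    idempotents. *)
Lemma gbraid_act g (P gP : {P | homog P}) Q : sval gP = actO g (sval P) ->
  Defs.actM W g (gbraid P Q) ≈ gbraid gP (actO g Q).
Proof.
move=> gPE; have [_ d] := homogE P.
have gdE : galGrade gP = (g * galGrade P * g^-1)%g.
  by apply: gradeP; rewrite gPE; exact: gdeg_act.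
apply: galarr_eq.
- by rewrite [LHS]actO_tenE gPE.
- by rewrite [LHS]actO_tenE gPE gdE -!actO_ME mulgKV.
rewrite kval_act !kval_gbraid gPE /kbraid kact_cmp kact_emb kact_tem.
by rewrite !kgid_act.
Qed.

(** The idempotents between the two braidings are absorbed by [kbraid_l]; what remains is the
    hexagon of C. *)
Lemma gbraid_tenr (P : {P | homog P}) Q R e :
  gbraid P (galTen HS Q R)
  ≈ @cmp F D _ _ _ (@tem F D _ _ _ _ (@ident F D (actO (galGrade P) Q)) (gbraid P R))
     (@cmp F D _ _ _ (@eqh F D _ _ e) (@tem F D _ _ _ _ (gbraid P Q) (@ident F D R))).
Proof.
have [_ d] := homogE P; apply: galarr_eq.
- by rewrite /= galTenA.
- by rewrite /= actO_tenE galTenA.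
rewrite kJ_kval_cast !kval_tem !kval_gbraid.
rewrite -[kval (@ident F D R)]/(kgid R) -[kval (@ident F D _)]/(kgid (actO (galGrade P) Q)).
clear e; move: (sval P) (galGrade P) d => {}P g d.
have -> : kJ (kgid (actO g Q) ⊠ kbraid P R)
    = (kι (gob Q) ⋆ kJ (emb (br (gob P) (gob R))))
      • (kJ (kgid (actO g Q) ⊠ kgid P) ⋆ kJ (kgid R)).
  by rewrite -{1}[kgid (actO g Q)](cmp1f KP) (tem_cmp KP) Jc !Jt otA.
rewrite -ocA -Jt -[kJ (_ ⊠ kgid R) • _]Jc -(tem_cmp KP) (kbraid_l _ d) kgid_idem.
have -> : kJ (kbraid P Q ⊠ kgid R)
    = (kJ (emb (br (gob P) (gob Q))) ⋆ kι (gob R))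
      • (kJ (kgid P ⊠ kgid Q) ⋆ kJ (kgid R)).
  by rewrite -{1}[kgid R](cmp1f KP) (tem_cmp KP) Jc !Jt.
rewrite ocA Jt -kJ_br_tenr.
by rewrite /kbraid Jc !Jt otA.
Qed.

Lemma gbraid_tenl (P Q PQ : {P | homog P}) R e : sval PQ = galTen HS (sval P) (sval Q) ->
  gbraid PQ R
  ≈ @cmp F D _ _ _
     (@tem F D _ _ _ _ (gbraid P (actO (galGrade Q) R)) (@ident F D (sval Q)))
     (@cmp F D _ _ _ (@eqh F D _ _ e)
       (@tem F D _ _ _ _ (@ident F D (sval P)) (gbraid Q R))).
Proof.
move=> PQE; have [_ dP] := homogE P; have [_ dQ] := homogE Q.
have gdE : galGrade PQ = (galGrade P * galGrade Q)%g.
  by apply: gradeP; rewrite PQE; exact: gdeg_ten.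
apply: galarr_eq.
- by rewrite /= PQE galTenA.
- by rewrite /= gdE actO_ME PQE galTenA.
rewrite kJ_kval_cast !kval_tem !kval_gbraid PQE.
rewrite -[kval (@ident F D (sval Q))]/(kgid (sval Q)) -[kval (@ident F D _)]/(kgid (sval P)).
clear e PQE gdE.
move: (sval P) (sval Q) (galGrade P) (galGrade Q) dQ dP => P1 Q1 g h dQ dP.
have -> : kJ (kbraid P1 (actO h R) ⊠ kgid Q1)
    = (kJ (emb (br (gob P1) (gob R))) ⋆ kι (gob Q1))
      • (kJ (kgid P1) ⋆ kJ (kgid (actO h R) ⊠ kgid Q1)).
  by rewrite -{1}[kgid Q1](cmp1f KP) (tem_cmp KP) Jc !Jt -otA.
rewrite -ocA -Jt -[kJ (kgid P1 ⊠ _) • _]Jc -(tem_cmp KP) (kbraid_l _ dQ) kgid_idem.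
have -> : kJ (kgid P1 ⊠ kbraid Q1 R)
    = (kι (gob P1) ⋆ kJ (emb (br (gob Q1) (gob R))))
      • (kJ (kgid P1) ⋆ kJ (kgid Q1 ⊠ kgid R)).
  by rewrite -{1}[kgid P1](cmp1f KP) (tem_cmp KP) Jc !Jt.
rewrite ocA Jt -kJ_br_tenl.
by rewrite /kbraid Jc !Jt otA.
Qed.

Lemma galois_braided : isBraidedCrossed W.
Proof.
exists galois_crossed, gbraid; split.
- exact: gbraid_iso.
- exact: gbraid_nat.
- by move=> *; exact: gbraid_tenr.
- by move=> *; exact: gbraid_tenl.
- exact: gbraid_act.
Qed.

End Twist.

End GaloisExtension.

Theorem theorem3p20 (F : closedFieldType) (char0 : [pchar F] =i pred0)
    (C : btc F) (S : obj C -> Prop) (HS : isTensorSub S)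
    (Hadm : isFiniteAdmissible S) (G0 : finGroupType) (E : repEquiv S G0)
    (A : regAlg E) :
  isBraidedCrossed (galoisCrossed char0 HS A).
Proof.
by apply: galois_braided; case: Hadm => _ _ [twS _]; apply: twS; exact: Gam_sub.
Qed.
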